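(* Let $r\ge 2$, let $2\le s_1\le\cdots\le s_r$ be integers, let $a_r=\prod_{j=1}^{r-1}s_j$, $a_{r+1}=\prod_{j=1}^{r}s_j$, and $$\beta_1=\frac{\sum_{i=1}^r s_i-r}{a_{r+1}-1},\qquad \beta_2=\frac{a_r\left(\sum_{i=1}^{r-1}s_i-r\right)+1}{(a_r-1)(a_{r+1}-1)}.$$ Suppose $\mathrm{ex}(n,K_{s_1,\ldots,s_r})=\Omega(n^{r-1/a_r})$. Then asymptotically almost surely $$\mathrm{ex}(H^r_{n,p},K_{s_1,\ldots,s_r})=\begin{cases}\Theta(pn^r) & n^{-r/2}\log n\le p\le n^{-\beta_1},\\ n^{r-\beta_1+o(1)} & n^{-\beta_1}\le p\le n^{-\beta_2}(\log n)^{2a_r/(a_r-1)},\\ \Theta\left(p^{1-1/a_r}n^{r-1/a_r}\right) & n^{-\beta_2}(\log n)^{2a_r/(a_r-1)}\le p\le 1.\end{cases}$$ More precisely, for $n^{-\beta_1}\le p\le n^{-\beta_2}(\log n)^{2a_r/(a_r-1)}$, asymptotically almost surely $$\Omega(n^{r-\beta_1})=\mathrm{ex}(H^r_{n,p},K_{s_1,\ldots,s_r})=O\left(n^{r-\beta_1}(\log n)^2\right).$$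
   Context: An $r$-graph is an $r$-uniform hypergraph. $\mathrm{ex}(n,F)$ is the maximum number of edges in an $n$-vertex $r$-graph with no copy of $F$; for an $r$-graph $H$, $\mathrm{ex}(H,F)$ is the maximum number of edges in a subgraph of $H$ with no copy of $F$. $K_{s_1,\ldots,s_r}$ is the complete $r$-partite $r$-graph with parts of sizes $s_1,\ldots,s_r$. $H^r_{n,p}$ is the random $r$-graph on $n$ vertices in which each $r$-subset is an edge independently with probability $p=p(n)$. An event holds asymptotically almost surely if its probability tends to $1$ as $n\to\infty$. *)

(* Defs.v *)
From HB Require Import structures.
From mathcomp Require Import all_boot all_order all_algebra.
From mathcomp Require Import all_classical all_reals all_analysis.
Import Order.TTheory GRing.Theory Num.Theory.
Import numFieldNormedType.Exports.

Set Implicit Arguments.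
Unset Strict Implicit.
Unset Printing Implicit Defensive.

Local Open Scope ring_scope.

Record rgraph (r : nat) (V : finType) := RGraph {
  edges :> {set {set V}};
  edges_uniform : [forall e in edges, #|e| == r]
}.

HB.instance Definition _ r V := [isSub for @edges r V].
HB.instance Definition _ r V := [Finite of rgraph r V by <:].

Lemma full_uniform r (V : finType) :
  [forall e in [set e : {set V} | #|e| == r], #|e| == r].
Proof. by apply/forall_inP => e; rewrite inE. Qed.

Definition full_rgraph (r : nat) (V : finType) : rgraph r V :=
  RGraph (full_uniform r V).

(* A (not necessarily induced) copy of F in G. *)
Definition has_copy r (V W : finType) (F : rgraph r W) (G : rgraph r V) : bool :=
  [exists f : {ffun W -> V},
    injectiveb f && [forall e in edges F, (f @: e) \in edges G]].

(* ex(H, F). Only spanning subgraphs G of H are considered: deleting vertices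
   does not raise the number of edges, and isolated vertices of G cannot be used
   by a copy of an F without isolated vertices. *)
Definition turan_in r (V W : finType) (H : rgraph r V) (F : rgraph r W) : nat :=
  \max_(G : rgraph r V | (edges G \subset edges H) && ~~ has_copy F G)
    #|edges G|.

(* ex(n, F) *)
Definition turan r (W : finType) (n : nat) (F : rgraph r W) : nat :=
  turan_in (full_rgraph r 'I_n) F.

Section CompleteMultipartite.
Variables (r : nat) (s : 'I_r -> nat).

Definition part_vertex := {i : 'I_r & 'I_(s i)}.

Definition multipartite_edges : {set {set part_vertex}} :=
  [set e : {set part_vertex} | [forall i, #|[set v in e | tag v == i]| == 1%N]].

Lemma multipartite_uniform : [forall e in multipartite_edges, #|e| == r].
Proof.
apply/forall_inP => e; rewrite inE => /forallP he.
rewrite -sum1_card (partition_big (fun v : part_vertex => tag v) predT) //=.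
rewrite (eq_bigr (fun=> 1%N)) ?sum1_card ?card_ord // => i _.
by rewrite sum1dep_card; exact/eqP/he.
Qed.

(* K_{s_1, ..., s_r}, the part sizes being indexed by 0, ..., r - 1. *)
Definition complete_multipartite : rgraph r part_vertex :=
  RGraph multipartite_uniform.

(* a_r = s_1 * ... * s_(r-1), i.e. all parts but the last one *)
Definition a_r : nat := \prod_(i < r | (i.+1 < r)%N) s i.
(* a_(r+1) = s_1 * ... * s_r *)
Definition a_r1 : nat := \prod_(i < r) s i.

Definition beta1 (R : realType) : R :=
  ((\sum_(i < r) (s i)%:R) - r%:R) / (a_r1%:R - 1).

Definition beta2 (R : realType) : R :=
  (a_r%:R * ((\sum_(i < r | (i.+1 < r)%N) (s i)%:R) - r%:R) + 1)
    / ((a_r%:R - 1) * (a_r1%:R - 1)).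

End CompleteMultipartite.

Section RandomGraph.
Variable R : realType.

(* The law of H^r_{n,p}: the r-subsets are edges independently with
   probability p. *)
Definition Hnp_mass r n (p : R) (H : rgraph r 'I_n) : R :=
  \prod_(e : {set 'I_n} | #|e| == r) (if e \in edges H then p else 1 - p).

Definition Hnp_prob r n (p : R) (A : pred (rgraph r 'I_n)) : R :=
  \sum_(H : rgraph r 'I_n | A H) Hnp_mass p H.

Definition aas r (p : nat -> R) (A : forall n, pred (rgraph r 'I_n)) : Prop :=
  ((fun n => Hnp_prob (p n) (A n)) @ \oo --> (1 : R))%classic.

(* The bounds on p are only required for large n: for n <= 1 the ones used in
   random Turan theorems can be contradictory, as ln 1 = 0. *)
Definition prob_between (lo hi p : nat -> R) : Prop :=
  (forall n, 0 <= p n <= 1) /\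
  (\forall n \near \oo%classic, lo n <= p n <= hi n).

(* A.a.s. L n <= ex(H^r_{n,p}, F) <= U n. *)
Definition aas_turan_between r (W : finType) (F : rgraph r W)
    (p L U : nat -> R) : Prop :=
  aas p (fun n (H : rgraph r 'I_n) => L n <= (turan_in H F)%:R <= U n).

End RandomGraph.

(* Main.v *)
(* Lower bounds. The map H |-> ex(H, K) changes by at most one when an edge is added, so
   by the Efron-Stein inequality its variance is at most p n^r, and a lower bound on its
   expectation suffices. For small p the expectation is bounded by thinning H_{n,p} and
   deleting an edge from each copy of K. For large p, colour the vertices with m ~ p n
   colours, take an extremal K-free r-graph on the set of colours, and keep the edges of
   H that map to it, except those e for which another edge of H arises from e by exchanging
   one vertex for a vertex of the same colour: two vertices in a part of K then have
   different colours, so a copy of K would map to a copy on the colours.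

   Upper bounds. Let Z(G) be the sum of (e p)^|I| over the K-free I in G; by the union
   bound P(ex(H, K) >= m) <= e^-m Z(complete graph). Containers bound Z(G) by
   (number of fingerprints, weighted) * max Z(C) over C of size (1 - delta)|G|, and this is
   iterated down to |G| ~ p^(-1/a) n^(r-1/a). The containers come from a probability
   distribution on the copies of K in G with small codegrees: start with a random edge and,
   part by part, resample the vertex of the part s_i times independently from its
   conditional distribution, discarding the outcomes of too small probability. *)
From mathcomp Require Import all_boot all_order all_algebra fingroup perm.
From mathcomp Require Import all_classical all_reals all_analysis.
From mathcomp Require Import ring lra zify.
Require Import Defs.
Import boot.fintype boot.finset.
Import Order.TTheory GRing.Theory Num.Theory.
Import numFieldNormedType.Exports.

Set Implicit Arguments.
Unset Strict Implicit.
Unset Printing Implicit Defensive.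

Local Open Scope ring_scope.

(** * Containers *)

(** Two codegree constraints shape the upper bounds. If G has density g and Q is of order 1/g, full
    copies force tau >= Q n^(-beta1), and pairs of edges that differ only in the last part force tau
    >= Q^a / n. Fingerprints have size about tau |G|, which gives the terms n^(r-beta1) and n^(ra-1)
    / |G|^(a-1). The second decays geometrically away from the final size. The first is the same in
    each of the O(log n) rounds, and the number of fingerprints costs a further factor l in round l,
    counted from the final size; hence (log n)^2. At p = n^(-beta1) there are about as many copies
    as edges, the limit of deletion; n^(-beta2) is where p^(1-1/a) n^(r-1/a) meets n^(r-beta1).
    Between the thresholds both bounds come from monotonicity in p. The obstacle is that every set
    of edges of a copy needs a codegree bound, not only the two extreme ones. Resampling gives a
    factor Q^(s_1 ... s_(l-1)) / n for each vertex of part l beyond the first, and an inequality on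
    the shapes (t_1, .., t_r) shows that the two extreme shapes decide. *)

Section Container.
Variables (R : realType) (T : finType).
Implicit Types (w : {set T} -> R) (e U S I C sg : {set T}) (v : T).

Definition deg w sg : R := \sum_(e : {set T} | sg \subset e) w e.

Definition indep w I := forall e, w e != 0 -> ~~ (e \subset I).

(** The container [f S] sees [I] only through its fingerprint [S], so containers can be counted by
    fingerprints. Leaving [P] abstract lets every answer of the query algorithm be added to it. *)
Definition has_containers (P : {set T} -> Prop) U (b : nat) (M : R) :=
  exists f : {set T} -> {set T}, forall I, P I ->
    exists2 S : {set T}, (S \subset I :&: U) && (#|S| <= b)%N &
               ((I :&: U) :\: S \subset f S) && (#|f S|%:R <= M).

Lemma has_containers_leaf P U M : #|U|%:R <= M -> has_containers P U 0 M.
Proof.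
move=> hU; exists (fun=> U) => I _; exists set0; first by rewrite sub0set cards0.
by rewrite hU setD0 subsetIr.
Qed.

Lemma has_containers_mono (P Q : {set T} -> Prop) U b b' M M' :
  (forall I, Q I -> P I) -> (b <= b')%N -> M <= M' ->
  has_containers P U b M -> has_containers Q U b' M'.
Proof.
move=> QP bb MM [f hf]; exists f => I /QP /hf [S /andP[S1 S2] /andP[S3 S4]].
exists S; first by rewrite S1 (leq_trans S2 bb).
by rewrite S3 (le_trans S4 MM).
Qed.

(** One query. If [v] is in [I] it joins the fingerprint; as neither branch returns a fingerprint
    containing [v], membership of [v] in [S] tells the decoder which branch was taken. A negative
    answer removes [v] from [U] at no cost. *)
Lemma has_containers_query (P : {set T} -> Prop) U v b M : v \in U ->
  has_containers (fun I => P I /\ v \in I) (U :\ v) b M ->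
  has_containers (fun I => P I /\ v \notin I) (U :\ v) b.+1 M ->
  has_containers P U b.+1 M.
Proof.
move=> vU [f hf] [g hg].
exists (fun S => if v \in S then f (S :\ v) else g S) => I PI.
have [vI|vI] := boolP (v \in I).
  have [S /andP[S1 S2] /andP[S3 S4]] := hf I (conj PI vI).
  have vS : v \notin S by apply/negP => /(fintype.subsetP S1); rewrite !inE eqxx andbF.
  have Sv : (v |: S) :\ v = S by rewrite setU1K.
  exists (v |: S).
    rewrite subUset sub1set inE vI vU cardsU1 vS /= ltnS S2 andbT.
    by apply: subset_trans S1 _; apply: setIS; exact: subD1set.
  rewrite setU11 Sv S4 andbT; apply: subset_trans S3.
  apply/fintype.subsetP => z; rewrite !inE negb_or.
  by case/andP=> /andP[-> ->] /andP[-> ->].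
have [S /andP[S1 S2] /andP[S3 S4]] := hg I (conj PI vI).
have vS : v \notin S by apply/negP => /(fintype.subsetP S1); rewrite !inE eqxx andbF.
exists S.
  by rewrite S2 andbT; apply: subset_trans S1 _; apply: setIS; exact: subD1set.
rewrite (negbTE vS) S4 andbT; apply: subset_trans S3.
apply/fintype.subsetP => z; rewrite !inE => /andP[-> /andP[zI ->]].
by rewrite zI !andbT /=; apply: contraNneq vI => <-.
Qed.

Lemma degE0 w : deg w set0 = \sum_(e : {set T}) w e.
Proof. by apply: eq_bigl => e; rewrite sub0set. Qed.

Lemma deg_ge0 w sg : (forall e, 0 <= w e) -> 0 <= deg w sg.
Proof. by move=> w0; apply: sumr_ge0. Qed.

Lemma deg_le w w' sg : (forall e, w e <= w' e) -> deg w sg <= deg w' sg.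
Proof. by move=> w0; apply: ler_sum. Qed.

Lemma exchange_deg w (A : {pred {set T}}) :
  \sum_(sg in A) deg w sg = \sum_e w e * #|[set sg in A | sg \subset e]|%:R.
Proof.
rewrite /deg (exchange_big_dep predT) //=; apply: eq_bigr => e _.
by rewrite sumr_const mulr_natr; congr (_ *+ _); apply: eq_card => sg; rewrite !inE.
Qed.

Lemma sum_deg1 w U :
  \sum_(v in U) deg w [set v] = \sum_e w e * #|e :&: U|%:R.
Proof.
rewrite /deg (exchange_big_dep predT) //=; apply: eq_bigr => e _.
rewrite sumr_const mulr_natr; congr (_ *+ _); apply: eq_card => z.
by rewrite !inE unfold_in /= sub1set andbC.
Qed.

Lemma mass_restrict w U0 U (D : R) : (forall e, 0 <= w e) ->
  (forall e, w e != 0 -> e \subset U0) ->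
  (forall v, deg w [set v] <= D) -> 
  \sum_(e : {set T} | ~~ (e \subset U)) w e <= #|U0 :\: U|%:R * D.
Proof.
move=> w0 wU0 wD.
apply: le_trans (_ : \sum_(v in U0 :\: U) deg w [set v] <= _); last first.
  rewrite -sum1_card natr_sum mulr_suml; apply: ler_sum => v _.
  by rewrite mul1r.
rewrite sum_deg1 big_mkcond; apply: ler_sum => e _.
case: ifP => [eU|_]; last by rewrite mulr_ge0.
have [->|we] := eqVneq (w e) 0; first by rewrite mul0r.
rewrite ler_peMr// ler1n card_gt0.
have /subsetPn[z ze zU] := eU.
by apply/set0Pn; exists z; rewrite !inE ze zU (fintype.subsetP (wU0 _ we)).
Qed.

Lemma deg_link w v sg :
  \sum_(f : {set T} | (sg \subset f) && (v \notin f)) w (v |: f) =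
  if v \in sg then 0 else deg w (v |: sg).
Proof.
case: ifP => vsg.
  rewrite big_pred0 // => f; apply/negbTE/negP => /andP[/fintype.subsetP sf].
  by rewrite sf.
rewrite /deg [RHS](reindex_onto (fun f => v |: f) (fun e => e :\ v)) /=; last first.
  by move=> e; rewrite subUset sub1set => /andP[ve _]; rewrite setD1K.
apply: eq_bigl => f; rewrite subUset sub1set setU11 /=.
have [vf|vf] := boolP (v \in f).
  rewrite andbF; apply/esym/negbTE; rewrite negb_and; apply/orP; right.
  by apply: contraTneq vf => <-; rewrite !inE eqxx.
rewrite setU1K // eqxx !andbT.
apply/idP/idP => [h|/fintype.subsetP h]; first by apply: subset_trans h (subsetUr _ _).
apply/fintype.subsetP => z zs; have := h z zs; rewrite !inE => /predU1P[zv|//].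
by rewrite -zv zs in vsg.
Qed.

Section Step.
Variables (k : nat) (K K' c delta cap tau N : R) (w0 : {set T} -> R) (U0 : {set T}) (B : nat).
Hypotheses (K0 : 0 < K) (c0 : 0 < c) (tau0 : 0 < tau) (N0 : 0 < N).
Hypothesis (cap0 : cap = 2 ^+ k.+2 * K ^+ 2 / c).
Hypothesis (K'E : K' = cap + K).
Hypothesis dK : delta * K <= c / 4.
Hypothesis U0N : #|U0|%:R <= N.
Hypothesis w0_ge0 : forall e, 0 <= w0 e.
Hypothesis w0_supp : forall e, w0 e != 0 -> (#|e| == k.+1) && (e \subset U0).
Hypothesis w0_mass : c <= deg w0 set0.
Hypothesis w0_deg : forall sg, sg != set0 -> deg w0 sg <= K * tau ^+ #|sg|.-1 / N.
Hypothesis Btau : B%:R <= tau * N + 1.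

(** Once the degree of [sg] in the accumulated links reaches the cap, the edges of [w0] above [sg]
    are frozen, so later links cannot raise that degree again. *)
Definition saturated w' sg := (sg != set0) && (cap * tau ^+ #|sg|.-1 / N <= deg w' sg).

Definition unsaturated_part U w' e :=
  if (e \subset U) && [forall sg : {set T}, (sg \subset e) ==> ~~ saturated w' sg]
  then w0 e else 0.

Definition add_link v w w' f := w' f + (if v \notin f then w (v |: f) else 0) / tau.

(* The run of the algorithm that asks, for vertices of large degree, whether they belong to
   [I]: [U] holds the vertices not yet queried, [y] is the number of positive answers, and
   [w'] is the sum of the links of the vertices found in [I], divided by [tau]. *)
Record link_state U (y : nat) w' : Prop := LinkState {
  ls_sub : U \subset U0;
  ls_y : (y <= B)%N;
  ls_ge0 : forall f, 0 <= w' f;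
  ls_supp : forall f, w' f != 0 -> (#|f| == k) && (f \subset U0);
  ls_mass_le : deg w' set0 <= y%:R * (K / (N * tau));
  ls_mass_ge : y%:R * (c / (2 * (N * tau))) <= deg w' set0;
  ls_deg : forall sg, sg != set0 -> deg w' sg <= K' * tau ^+ #|sg|.-1 / N }.

Lemma deg_add_link v w w' sg :
  deg (add_link v w w') sg = deg w' sg + (if v \in sg then 0 else deg w (v |: sg)) / tau.
Proof.
rewrite /deg /add_link big_split /=; congr (_ + _).
by rewrite -mulr_suml -deg_link big_mkcondr.
Qed.

Lemma cap_gt0 : 0 < cap.
Proof. by rewrite cap0; apply: divr_gt0 => //; apply: mulr_gt0; apply: exprn_gt0. Qed.

Lemma unsat_ge0 U w' e : 0 <= unsaturated_part U w' e.
Proof. by rewrite /unsaturated_part; case: ifP. Qed.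

Lemma unsat_le U w' e : unsaturated_part U w' e <= w0 e.
Proof. by rewrite /unsaturated_part; case: ifP. Qed.

Lemma unsat_neq0 U w' e : unsaturated_part U w' e != 0 ->
  [/\ w0 e != 0, e \subset U & forall sg, sg \subset e -> ~~ saturated w' sg].
Proof.
rewrite /unsaturated_part; case: ifP => [|_]; last by rewrite eqxx.
by move=> /andP[-> /forallP h] ->; split => // sg; exact/implyP.
Qed.

(** By saturation [deg w0 sg] is at most K / cap times [deg w' sg], and an edge of [w'] has 2^k
    subsets; the value of [cap] is what turns 2^k K^2 / cap into c / 4. *)
Lemma saturated_loss U y w' : link_state U y w' -> (y < B)%N ->
  \sum_(sg | saturated w' sg) deg w0 sg <= c / 4.
Proof.
move=> st yB.
have mass_le : deg w' set0 <= K.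
  apply: (le_trans (ls_mass_le st)).
  (* A further positive answer is still allowed, so y + 1 <= B <= tau N + 1. *)
  have yt : y%:R <= tau * N by move: yB; rewrite -(ler_nat R) -natr1 => yB; have := Btau; lra.
  have tN : 0 < N * tau by rewrite mulr_gt0.
  by rewrite mulrA ler_pdivrMr // mulrC ler_wpM2l ?(ltW K0) // mulrC.
apply: le_trans (_ : \sum_sg (K / cap) * deg w' sg <= _).
  rewrite big_mkcond; apply: ler_sum => sg _; case: ifP => [/andP[sg0 sg_sat]|_].
    apply: (le_trans (w0_deg sg0)).
    have -> : K * tau ^+ #|sg|.-1 / N = K / cap * (cap * tau ^+ #|sg|.-1 / N).
      by field; rewrite (gt_eqF N0) (gt_eqF cap_gt0).
    by rewrite ler_wpM2l // divr_ge0 ?ltW ?cap_gt0.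
  by rewrite mulr_ge0 ?divr_ge0 ?(ltW cap_gt0) ?(ltW K0) // deg_ge0 //; exact: ls_ge0 st.
rewrite -mulr_sumr.
have -> : \sum_sg deg w' sg = 2 ^+ k * deg w' set0.
  have := exchange_deg w' predT; rewrite /= => ->.
  rewrite degE0 mulr_sumr; apply: eq_bigr => f _.
  have [->|/(ls_supp st)/andP[/eqP <- _]] := eqVneq (w' f) 0; first by rewrite mul0r mulr0.
  rewrite mulrC -natrX -card_powerset; congr (_%:R * _); apply: eq_card => sg.
have -> : c / 4 = K / cap * (2 ^+ k * K).
  rewrite cap0 2!exprS; field.
  by rewrite (gt_eqF K0) (gt_eqF c0) expf_neq0.
apply: ler_wpM2l; first by rewrite divr_ge0 ?ltW ?cap_gt0.
by apply: ler_wpM2l => //; apply: exprn_ge0.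
Qed.

(** Of the mass c, at most c / 4 sits on edges leaving [U], which has lost at most delta N vertices
    of degree at most K / N, and at most c / 4 above saturated sets. *)
Lemma unsat_mass U y w' : link_state U y w' -> (y < B)%N -> (1 - delta) * N < #|U|%:R ->
  c / 2 <= deg (unsaturated_part U w') set0.
Proof.
move=> st yB UN.
have loss1 : \sum_(e : {set T} | ~~ (e \subset U)) w0 e <= c / 4.
  apply: le_trans (_ : #|U0 :\: U|%:R * (K / N) <= _).
    apply: mass_restrict => // [e /w0_supp/andP[]//|v].
    have := @w0_deg [set v]; rewrite cards1 mulr1; apply.
    by apply/set0Pn; exists v; rewrite inE.
  have cD : #|U0 :\: U|%:R <= delta * N.
    have cU : #|U0 :\: U|%:R + #|U|%:R = #|U0|%:R :> R.
      by rewrite -natrD -(cardsID U U0) (setIidPr (ls_sub st)) addnC.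
    by have := U0N; lra.
  apply: le_trans (_ : delta * N * (K / N) <= _).
    by rewrite ler_wpM2r // divr_ge0 // ltW.
  by rewrite mulrACA divff ?gt_eqF // mulr1.
have loss2 := saturated_loss st yB.
suff : deg w0 set0 <= deg (unsaturated_part U w') set0 +
    \sum_(e : {set T} | ~~ (e \subset U)) w0 e + \sum_(sg | saturated w' sg) deg w0 sg.
  by have := w0_mass; lra.
rewrite (exchange_deg w0 (saturated w')) 2!degE0 [X in _ + X + _]big_mkcond -!big_split /=.
apply: ler_sum => e _; rewrite /unsaturated_part.
case: (boolP (e \subset U)) => /= eU; last first.
  by rewrite add0r lerDl mulr_ge0.
case: ifP => [_|/negbT]; first by rewrite addr0 lerDl mulr_ge0.
rewrite negb_forall => /existsP[sg]; rewrite negb_imply negbK => /andP[se ss].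
rewrite !add0r ler_peMr // ler1n card_gt0; apply/set0Pn; exists sg.
by rewrite inE -topredE /= ss.
Qed.

(** Averaging: edges are nonempty, so the degrees over [U] sum to at least the mass c / 2, and |U|
    <= N. *)
Lemma unsat_vertex U y w' : link_state U y w' -> (y < B)%N -> (1 - delta) * N < #|U|%:R ->
  exists2 v, v \in U & c / (2 * N) <= deg (unsaturated_part U w') [set v].
Proof.
move=> st yB UN.
have mass := unsat_mass st yB UN.
have [/existsP[v /andP[vU hv]]|] :=
  boolP [exists v, (v \in U) && (c / (2 * N) <= deg (unsaturated_part U w') [set v])].
  by exists v.
move=> /existsPn noex; exfalso.
have mass_le : deg (unsaturated_part U w') set0 <=
    \sum_(v in U) deg (unsaturated_part U w') [set v].
  rewrite sum_deg1 degE0; apply: ler_sum => e _.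
  have [->|/unsat_neq0[we eU _]] := eqVneq (unsaturated_part U w' e) 0.
    by rewrite mul0r.
  have /andP[/eqP ce _] := w0_supp we.
  by rewrite ler_peMr ?unsat_ge0 // ler1n (setIidPl eU) ce.
have [U00|[v vU]] := set_0Vmem U.
  move: mass_le; rewrite U00 big_set0 => mass_le; move: c0 mass mass_le; rewrite U00; lra.
have lt : \sum_(v in U) deg (unsaturated_part U w') [set v] < \sum_(v in U) c / (2 * N).
  apply: ltr_sum; first by apply/hasP; exists v; rewrite ?mem_index_enum.
  by move=> z zU; rewrite ltNge; have := noex z; rewrite zU.
move: lt; rewrite sumr_const -mulr_natl => lt.
have : #|U|%:R * (c / (2 * N)) <= c / 2.
  have -> : c / 2 = N * (c / (2 * N)) by field; rewrite gt_eqF.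
  rewrite ler_wpM2r ?divr_ge0 ?mulr_ge0 ?(ltW c0) ?(ltW N0) //.
  by apply: le_trans U0N; rewrite ler_nat subset_leq_card ?(ls_sub st).
lra.
Qed.

Lemma link_state_no U y w' v : link_state U y w' -> link_state (U :\ v) y w'.
Proof.
case=> *; split => //; by apply: subset_trans (subD1set _ _) _.
Qed.

(** Degrees stay below the level K' because a saturated set gains nothing, while an unsaturated one
    lies below the cap and gains at most deg w0 (v |: sg) / tau <= K tau^(|sg|-1) / N. *)
Lemma link_state_yes U y w' v : link_state U y w' -> (y < B)%N -> v \in U ->
  c / (2 * N) <= deg (unsaturated_part U w') [set v] ->
  link_state (U :\ v) y.+1 (add_link v (unsaturated_part U w') w').
Proof.
move=> st yB vU hv; set w := unsaturated_part U w'.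
have wle sg : deg w sg <= deg w0 sg by apply: deg_le => e; exact: unsat_le.
have w_ge0 := unsat_ge0 U w'.
split => //.
- by apply: subset_trans (subD1set _ _) (ls_sub st).
- move=> f; rewrite addr_ge0 ?(ls_ge0 st) // divr_ge0 ?(ltW tau0) //.
  by case: ifP.
- move=> f; rewrite /add_link.
  have [->|/(ls_supp st)//] := eqVneq (w' f) 0.
  rewrite add0r mulf_eq0 negb_or => /andP[+ _].
  case: ifP => [vf|]; last by rewrite eqxx.
  move=> /unsat_neq0[/w0_supp/andP[]]; rewrite cardsU1 vf eqSS => -> fU _ _.
  exact: subset_trans (subsetUr _ _) fU.
- rewrite deg_add_link inE setU0 -natr1 mulrDl mul1r lerD ?(ls_mass_le st) //.
  rewrite invfM mulrA ler_wpM2r ?invr_ge0 ?(ltW tau0) //.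
  apply: (le_trans (wle _)).
  have := @w0_deg [set v]; rewrite cards1 mulr1; apply.
  by apply/set0Pn; exists v; rewrite inE.
- rewrite deg_add_link inE setU0 -natr1 mulrDl mul1r lerD ?(ls_mass_ge st) //.
  by rewrite mulrA invfM mulrA ler_wpM2r ?invr_ge0 ?(ltW tau0).
move=> sg sg0; rewrite deg_add_link; case: ifP => vsg.
  by rewrite mul0r addr0 (ls_deg st).
have [sat|nsat] := boolP (saturated w' sg).
  rewrite [deg w _]big1 ?mul0r ?addr0 ?(ls_deg st) // => e.
  rewrite subUset => /andP[_ se]; apply/eqP/negPn/negP => /unsat_neq0[_ _ /(_ _ se)].
  by rewrite sat.
have lt : deg w' sg <= cap * tau ^+ #|sg|.-1 / N.
  by move: nsat; rewrite /saturated sg0 /= -ltNge => /ltW.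
rewrite K'E mulrDl mulrDl lerD // ler_pdivrMr //.
apply: (le_trans (wle _)); apply: (le_trans (@w0_deg (v |: sg) _)).
  by apply/set0Pn; exists v; rewrite !inE eqxx.
rewrite cardsU1 vsg /=.
have [m ->] : exists m, #|sg| = m.+1.
  by exists #|sg|.-1; rewrite prednK // card_gt0.
by rewrite /= exprS le_eqVlt; apply/orP; left; apply/eqP; ring.
Qed.

(** Queries go on until [U] is small, and is itself the container, or until B answers were positive
    and the links are handed to [down], one uniformity lower. A set independent for [w0] that
    contains the vertices answered positively is independent for their links. *)
Lemma container_step (M : R) : 0 <= M -> (1 - delta) * N <= M ->
  (forall U y w', link_state U y w' -> ~~ (y < B)%N -> (1 - delta) * N < #|U|%:R ->
     has_containers (indep w') U (k * B) M) ->
  has_containers (indep w0) U0 (k.+1 * B) M.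
Proof.
move=> M0 dM down.
have main : forall m U y w', (#|U| <= m)%N -> link_state U y w' ->
    has_containers (fun I => indep w0 I /\ indep w' I) U (B - y + k * B) M.
  elim=> [|m IH] U y w' Um st.
    apply: has_containers_mono (leq0n _) (lexx M) (has_containers_leaf _ _); last first.
      move: Um; rewrite leqn0 => /eqP ->; exact: M0.
    by [].
  have [Usmall|Ubig] := lerP #|U|%:R ((1 - delta) * N).
    exact: has_containers_mono (fun _ _ => Logic.I) (leq0n _) dM (has_containers_leaf _ Usmall).
  have [yB|yB] := ltnP y B; last first.
    apply: has_containers_mono _ (leq_addl _ _) (lexx M) (down U y w' st _ Ubig).
      by move=> I [].
    by rewrite -leqNgt.
  have [v vU hv] := unsat_vertex st yB Ubig.
  have UE : (#|U :\ v| <= m)%N by move: Um; rewrite (cardsD1 v) vU.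
  have -> : (B - y + k * B = (B - y.+1 + k * B).+1)%N by rewrite -addSn subnSK.
  apply: (has_containers_query vU).
    apply: has_containers_mono (IH _ _ _ UE (link_state_yes st yB vU hv)) => //.
    move=> I [[i0 i'] vI]; split => // f; rewrite /add_link.
    have [->|/i' //] := eqVneq (w' f) 0.
    rewrite add0r mulf_eq0 negb_or => /andP[+ _].
    case: ifP => [_|]; last by rewrite eqxx.
    move=> /unsat_neq0[/i0 + _ _]; apply: contra => fI.
    by rewrite subUset sub1set vI.
  rewrite -addSn subnSK //.
  apply: has_containers_mono (IH _ _ _ UE (link_state_no v st)) => //.
  by move=> I [].
rewrite mulSn -{1}(subn0 B).
apply: has_containers_mono (main #|U0| U0 0%N (fun=> 0) (leqnn _) _) => //.
  by move=> I i0; split => // f; rewrite eqxx.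
have z sg : deg (fun=> 0) sg = 0 by rewrite /deg big1.
split => //; rewrite ?z ?mul0r //; first by move=> f; rewrite eqxx.
move=> sg _; rewrite z !mulr_ge0 ?exprn_ge0 ?invr_ge0 ?(ltW tau0) ?(ltW N0) //.
by rewrite K'E addr_ge0 ?(ltW cap_gt0) ?(ltW K0).
Qed.
End Step.

End Container.

(** Induction on the uniformity. After B >= tau N positive answers the links have mass at least c /
    2 and keep c / 4 when restricted to the unqueried vertices, so the constants go from (K, c) to
    (cap + K, c / 4). *)
Lemma container (R : realType) (k : nat) (K c : R) : 0 < K -> 0 < c ->
  exists2 delta : R, 0 < delta < 1 & forall (T : finType) (tau N : R) (w : {set T} -> R)
      (U : {set T}) (B : nat),
    0 < tau -> 0 < N -> #|U|%:R <= N -> (forall e, 0 <= w e) ->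
    (forall e, w e != 0 -> (#|e| == k) && (e \subset U)) -> c <= deg w set0 ->
    (forall sg, sg != set0 -> deg w sg <= K * tau ^+ #|sg|.-1 / N) ->
    tau * N <= B%:R <= tau * N + 1 ->
    has_containers (indep w) U (k * B) ((1 - delta) * N).
Proof.
elim: k K c => [|k IH] K c K0 c0.
  exists 2^-1 => [|T tau N w U B _ N0 UN w0 wk wc _ _]; first by apply/andP; split; lra.
  (* In uniformity 0 a positive mass sits on the empty edge, so no set is independent. *)
  exists (fun=> set0) => I indI; exfalso.
  have : deg w set0 = w set0.
    rewrite degE0 (bigD1 set0) //= big1 ?addr0 // => e e0.
    by apply/eqP/negPn/negP => /wk /andP[]; rewrite cards_eq0 (negbTE e0).
  move=> E; have w00 : w set0 != 0 by rewrite -E gt_eqF // (lt_le_trans c0).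
  by have := indI _ w00; rewrite sub0set.
have c40 : 0 < c / 4 by rewrite divr_gt0.
have [cap capE] : exists cap, cap = 2 ^+ k.+2 * K ^+ 2 / c by eexists.
have cap0 : 0 < cap by rewrite capE; apply: divr_gt0 => //; apply: mulr_gt0; apply: exprn_gt0.
have K'0 : 0 < cap + K by rewrite addr_gt0.
have [d /andP[d0 d1] IHd] := IH (cap + K) (c / 4) K'0 c40.
(* The three bounds serve the inductive call, the loss in [w], and the loss when the links are
   restricted to [U']. *)
pose dl := Num.min d (Num.min (c / 4 / K) (c / 4 / (cap + K))).
have dl0 : 0 < dl by rewrite !lt_min d0 !divr_gt0.
have dld : dl <= d by rewrite ge_min lexx.
have dlK : dl * K <= c / 4 by rewrite -ler_pdivlMr // !ge_min lexx orbT.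
have dlK' : dl * (cap + K) <= c / 4 by rewrite -ler_pdivlMr // !ge_min lexx !orbT.
exists dl; first by rewrite dl0 (le_lt_trans dld).
move=> T tau N w U B tau0 N0 UN w_ge0 w_supp w_mass w_deg /andP[tB Bt].
apply: (container_step K0 c0 tau0 N0 capE erefl dlK UN w_ge0 w_supp w_mass w_deg Bt) => //.
  by rewrite mulr_ge0 ?(ltW N0) //; lra.
clear capE; move=> U' y w' st yB UN'.
(* Links may contain vertices already queried, which the next stage can no longer use. *)
pose w2 (f : {set T}) := if f \subset U' then w' f else 0.
have w2le f : w2 f <= w' f by rewrite /w2; case: ifP => // _; exact: (ls_ge0 st).
have MM : (1 - d) * N <= (1 - dl) * N by rewrite ler_wpM2r ?(ltW N0) //; lra.
have UN2 : #|U'|%:R <= N.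
  by apply: le_trans UN; rewrite ler_nat subset_leq_card ?(ls_sub st).
apply: has_containers_mono (leqnn _) MM (IHd T tau N w2 U' B tau0 N0 UN2 _ _ _ _ _) => //.
- by move=> I iI e; rewrite /w2; case: ifP => [_ /iI//|]; rewrite eqxx.
- by move=> e; rewrite /w2; case: ifP => // _; exact: (ls_ge0 st).
- move=> e; rewrite /w2; case: ifP => [_ /(ls_supp st)/andP[->//]|_]; by rewrite eqxx.
- have loss : \sum_(e : {set T} | ~~ (e \subset U')) w' e <= c / 4.
    apply: le_trans (_ : #|U :\: U'|%:R * ((cap + K) / N) <= _).
      apply: mass_restrict; first exact: (ls_ge0 st).
        by move=> e /(ls_supp st)/andP[].
      move=> v; have vn : [set v] != set0 by apply/set0Pn; exists v; rewrite inE.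
      by have := ls_deg st vn; rewrite cards1 mulr1.
    have cD : #|U :\: U'|%:R <= dl * N.
      have cU : #|U :\: U'|%:R + #|U'|%:R = #|U|%:R :> R.
        by rewrite -natrD -(cardsID U' U) (setIidPr (ls_sub st)) addnC.
      lra.
    apply: le_trans (_ : dl * N * ((cap + K) / N) <= _).
      by rewrite ler_wpM2r // divr_ge0 // ltW.
    by rewrite mulrACA divff ?gt_eqF // mulr1.
  have mass : c / 2 <= deg w' set0.
    apply: le_trans (ls_mass_ge st).
    have yt : N * tau <= y%:R.
      by rewrite mulrC (le_trans tB) // ler_nat leqNgt.
    have -> : c / 2 = N * tau * (c / (2 * (N * tau))).
      by field; rewrite !gt_eqF.
    by rewrite ler_wpM2r // divr_ge0 ?(ltW c0) // !mulr_ge0 ?(ltW N0) ?(ltW tau0).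
  have : deg w' set0 = deg w2 set0 + \sum_(e : {set T} | ~~ (e \subset U')) w' e.
    rewrite 2!degE0 [X in _ + X]big_mkcond -big_split /=; apply: eq_bigr => e _.
    by rewrite /w2; case: ifP; rewrite ?addr0 ?add0r.
  lra.
- by move=> sg sg0; apply: le_trans (ls_deg st sg0); apply: deg_le.
- by rewrite tB Bt.
Qed.

(** * Balanced densities on copies *)

Section Averages.
Variables (R : realType) (W V : finType).
Hypothesis V0 : (0 < #|V|)%N.
Implicit Types (x y : {ffun W -> V}) (u : W) (v : V) (F g : {ffun W -> V} -> R).

Definition avg F : R := (\sum_x F x) / #|{ffun W -> V}|%:R.
Definition mean (h : V -> R) : R := (\sum_v h v) / #|V|%:R.
Definition upd x u v := [ffun u' => if u' == u then v else x u'].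
Definition merge (J : {set W}) y x := [ffun u => if u \in J then y u else x u].

Let card_gt0R : 0 < #|V|%:R :> R. Proof. by rewrite ltr0n. Qed.
Let cardW_gt0 : 0 < #|{ffun W -> V}|%:R :> R.
Proof. by rewrite card_ffun ltr0n expn_gt0 V0. Qed.

Lemma eq_avg F g : F =1 g -> avg F = avg g.
Proof. by move=> E; rewrite /avg (eq_bigr g). Qed.

Lemma le_avg F g : (forall x, F x <= g x) -> avg F <= avg g.
Proof. by move=> E; rewrite /avg ler_wpM2r ?invr_ge0 ?ler_sum // ltW. Qed.

Lemma avg_ge0 F : (forall x, 0 <= F x) -> 0 <= avg F.
Proof. by move=> E; rewrite /avg divr_ge0 ?sumr_ge0 // ltW. Qed.

Lemma avgD F g : avg (fun x => F x + g x) = avg F + avg g.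
Proof. by rewrite /avg big_split mulrDl. Qed.

Lemma avgZ (c : R) F : avg (fun x => c * F x) = c * avg F.
Proof. by rewrite /avg -mulr_sumr mulrA. Qed.

Lemma avg_cst (c : R) : avg (fun=> c) = c.
Proof.
by rewrite /avg sumr_const -[X in X / _]mulr_natr mulfK // gt_eqF.
Qed.

Lemma avg_sum (I : finType) (P : pred I) (F : I -> {ffun W -> V} -> R) :
  avg (fun x => \sum_(i | P i) F i x) = \sum_(i | P i) avg (F i).
Proof. by rewrite /avg exchange_big mulr_suml. Qed.

Lemma meanZ (c : R) h : mean (fun v => c * h v) = c * mean h.
Proof. by rewrite /mean -mulr_sumr mulrA. Qed.

Lemma upd_at x u v : upd x u v u = v.
Proof. by rewrite ffunE eqxx. Qed.

Lemma upd_ne x u v u' : u' != u -> upd x u v u' = x u'.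
Proof. by rewrite ffunE => /negbTE ->. Qed.

(** Resampling a coordinate preserves the uniform measure: exchanging [x u] with the fresh vertex is
    an involution on pairs. *)
Lemma avg_upd u F : avg F = avg (fun x => mean (fun v => F (upd x u v))).
Proof.
rewrite /avg /mean -mulr_suml.
have -> : \sum_x \sum_v F (upd x u v) = #|V|%:R * \sum_x F x.
  rewrite pair_bigA /=.
  pose s (p : {ffun W -> V} * V) := (upd p.1 u p.2, p.1 u).
  have sK : involutive s.
    case=> x v; rewrite /s /= upd_at; congr pair; apply/ffunP => u'.
    by rewrite !ffunE; case: eqP => // ->.
  rewrite (reindex_inj (inv_inj sK)) /=.
  rewrite (eq_bigr (fun p : {ffun W -> V} * V => F p.1)); last first.
    by case=> x v _; have := sK (x, v) => /(congr1 fst) /= ->.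
  rewrite -(pair_bigA _ (fun x (v : V) => F x)) /= mulr_sumr; apply: eq_bigr => x _.
  by rewrite sumr_const mulr_natl.
by rewrite [X in X / _ / _]mulrC mulfK // gt_eqF.
Qed.

Lemma avg_merge J F : avg F = avg (fun y => avg (fun x => F (merge J y x))).
Proof.
rewrite /avg -mulr_suml.
have -> : \sum_y \sum_x F (merge J y x) = #|{ffun W -> V}|%:R * \sum_x F x.
  rewrite pair_bigA /=.
  pose s (p : {ffun W -> V} * {ffun W -> V}) := (merge J p.1 p.2, merge J p.2 p.1).
  have sK : involutive s.
    by case=> x v; rewrite /s /=; congr pair; apply/ffunP => u';
      rewrite !ffunE; case: (u' \in J).
  rewrite (reindex_inj (inv_inj sK)) /=.
  rewrite (eq_bigr (fun p : {ffun W -> V} * {ffun W -> V} => F p.1)); last first.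
    by case=> x v _; have := sK (x, v) => /(congr1 fst) /= ->.
  rewrite -(pair_bigA _ (fun x (v : {ffun W -> V}) => F x)) /= mulr_sumr.
  by apply: eq_bigr => x _; rewrite sumr_const mulr_natl.
by rewrite [X in X / _ / _]mulrC mulfK // gt_eqF.
Qed.

(** Independence of the coordinates in [Q]: each enters only through its own displayed factor, so
    they can be averaged out one at a time. *)
Lemma avg_prod (Q : {set W}) g (h : W -> {ffun W -> V} -> V -> R) :
  (forall x u v, u \in Q -> g (upd x u v) = g x) ->
  (forall x u u' v v', u \in Q -> u' \in Q -> h u' (upd x u v) v' = h u' x v') ->
  avg (fun x => g x * \prod_(u in Q) h u x (x u)) =
  avg (fun x => g x * \prod_(u in Q) mean (h u x)).
Proof.
have [m] := ubnP #|Q|; elim: m Q g => // m IH Q g Qm gQ hQ.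
have [->|[u0 u0Q]] := set_0Vmem Q; first by apply: eq_avg => x; rewrite !big_set0.
rewrite (avg_upd u0).
pose g' x := g x * mean (h u0 x).
rewrite (eq_avg (g := fun x => g' x * \prod_(u in Q :\ u0) h u x (x u))); last first.
  move=> x; rewrite /g' mulrAC -meanZ; congr mean; apply/funext => v.
  rewrite gQ // (big_setD1 u0) //= hQ // upd_at mulrA mulrAC; congr (_ * _ * _).
  apply: eq_bigr => u; rewrite !inE => /andP[uu uQ].
  by rewrite hQ // upd_ne.
rewrite IH.
- by apply: eq_avg => x; rewrite /g' -mulrA -(big_setD1 u0).
- by move: Qm; rewrite (cardsD1 u0 Q) u0Q.
- move=> x u v; rewrite !inE => /andP[_ uQ]; rewrite /g' gQ //; congr (_ * _).
  by rewrite /mean; congr (_ / _); apply: eq_bigr => w _; rewrite hQ.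
- by move=> x u u' v v'; rewrite !inE => /andP[_ uQ] /andP[_ u'Q]; rewrite hQ.
Qed.

Lemma avg_perm (s : {perm W}) F : avg F = avg (fun x => F [ffun u => x (s u)]).
Proof.
rewrite /avg; congr (_ / _).
rewrite (reindex (fun x : {ffun W -> V} => [ffun u => x (s u)])) //.
exists (fun x : {ffun W -> V} => [ffun u => x ((s^-1)%g u)]) => x _; apply/ffunP => u.
  by rewrite !ffunE permKV.
by rewrite !ffunE permK.
Qed.

End Averages.

Section Density.
Variables (R : realType) (W V : finType) (r : nat) (tg : W -> nat) (b : nat -> W).
Hypothesis V0 : (0 < #|V|)%N.
Hypothesis tg_lt : forall u, (tg u < r)%N.
Hypothesis tg_b : forall l, (l < r)%N -> tg (b l) = l.
Variables (W0 : {ffun 'I_r -> V} -> R) (eps Q : R).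
Hypothesis W0_ge0 : forall z, 0 <= W0 z.
Hypothesis eps0 : 0 < eps.
Hypothesis W0_le : forall z, W0 z <= eps * Q.
Implicit Types (x y : {ffun W -> V}) (u : W) (v : V) (c : nat -> W) (i l : nat).

Definition part l := [set u | tg u == l].
Definition base c x : {ffun 'I_r -> V} := [ffun l : 'I_r => x (c l)].

(* A density with respect to the uniform measure on all maps [W -> V]: resampling the
   vertices of the parts [l < i], one after the other, in a random edge on the vertices
   [b l]. The coordinates outside those parts and [b] are irrelevant to it. *)
Fixpoint density i x : R :=
  if i is j.+1 then
    let A := mean (fun v => density j (upd x (b j) v)) in
    if eps <= A then
      (\prod_(u in part j) density j (upd x (b j) (x u))) / A ^+ #|part j|.-1
    else (0:R)
  else W0 (base b x).

Hypothesis avg_W0 : avg (fun x => W0 (base b x)) = 1.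

Lemma density_ge0 i x : 0 <= density i x.
Proof.
elim: i x => [|i IH] x /=; first exact: W0_ge0.
case: ifP => // eA; have A0 := le_trans (ltW eps0) eA.
by apply: divr_ge0; [exact: prodr_ge0 | exact: exprn_ge0].
Qed.

Lemma density_local i x y : (i <= r)%N ->
  (forall u, (tg u < i)%N -> x u = y u) ->
  (forall l, (i <= l < r)%N -> x (b l) = y (b l)) -> density i x = density i y.
Proof.
elim: i x y => [|i IH] x y ir xy xyb /=.
  by congr W0; apply/ffunP => l; rewrite !ffunE xyb // ltn_ord.
have E v : density i (upd x (b i) v) = density i (upd y (b i) v).
  apply: IH; first exact: ltnW.
    by move=> u ui; rewrite !ffunE; case: ifP => // _; rewrite xy // (ltn_trans ui).
  move=> l /andP[il lr]; rewrite !ffunE; case: eqP => // bb.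
  apply: xyb; rewrite lr andbT ltn_neqAle il andbT.
  by apply: contra_notN bb => /eqP ->.
have -> : (fun v => density i (upd x (b i) v)) = (fun v => density i (upd y (b i) v)).
  exact/funext.
case: ifP => // _; congr (_ / _); apply: eq_bigr => u.
by rewrite inE => /eqP ui; rewrite xy ?ui // E.
Qed.

Lemma density_upd_local i x u v v' : (i < r)%N -> u \in part i ->
  density i (upd (upd x u v) (b i) v') = density i (upd x (b i) v').
Proof.
move=> ir; rewrite inE => /eqP ui; apply: density_local; first exact: ltnW.
  move=> u' u'i; rewrite !ffunE; case: ifP => // _; case: eqP => // uu'.
  by move: u'i; rewrite uu' ui ltnn.
move=> l /andP[il lr]; rewrite !ffunE; case: ifP => // bl; case: eqP => // bu.
have : tg (b l) = i by rewrite bu.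
by rewrite tg_b // => li; rewrite li eqxx in bl.
Qed.

(** Resampling a part of size s turns a bound eps T on the density into (eps T)^s / eps^(s-1) = eps
    T^s, by the truncation at [eps]; hence the exponents multiply. *)
Definition exponent l := (\prod_(j < l) #|part j|)%N.
Definition supdens l := eps * Q ^+ exponent l.

(** Coordinates that carry an edge under [density i]: any vertex of a resampled part, but only [b l]
    in a part still to be resampled. *)
Definition transversal i c (J : {set W}) :=
  (forall l, (l < r)%N -> (tg (c l) == l) && (c l \in J)) /\
  (forall l, (i <= l < r)%N -> c l = b l).

Lemma part_gt0 l : (l < r)%N -> (0 < #|part l|)%N.
Proof. by move=> lr; apply/card_gt0P; exists (b l); rewrite inE tg_b. Qed.

(** A vertex of [J] beyond the first in part l costs a factor Q^(exponent l). In the top part, [J]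
    fixes t coordinates: one is kept, and the other t - 1 factors are bounded by eps Q^(exponent i),
    the powers of eps being absorbed by A >= eps. The free coordinates average to powers of A and
    cancel the rest of the denominator. What is left is the previous density through the kept
    vertex, to which induction applies. *)
Lemma density_marginal_step i : (i <= r)%N ->
  (forall l x, (l < i)%N -> density l x <= supdens l) ->
  forall (J : {set W}) c y, transversal i c J ->
  avg (fun x => density i (merge J y x)) <=
  W0 (base c y) * \prod_(l < i) (Q ^+ exponent l) ^+ #|J :&: part l|.-1.
Proof.
elim: i => [|i IH] ir sup J c y [cJ cb].
  rewrite big_ord0 mulr1 (eq_avg (g := fun=> W0 (base c y))) ?avg_cst //.
  move=> x /=; congr W0; apply/ffunP => l; rewrite !ffunE.
  by have /andP[_] := cJ l (ltn_ord l); rewrite cb ?ltn_ord //= => ->.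
have /andP[/eqP tci ciJ] := cJ i ir.
set h := fun x v => density i (upd (merge J y x) (b i) v).
set A := fun x => mean (h x).
set Qs := part i :\: J.
have h_upd x u v v' : u \in part i -> h (upd x u v) v' = h x v'.
  move=> ui; have [uJ|uJ] := boolP (u \in J).
    congr (density i (upd _ _ _)); apply/ffunP => u'; rewrite !ffunE.
    by case: ifP => // u'J; case: eqP => // uu'; rewrite uu' uJ in u'J.
  rewrite /h -(density_upd_local (merge J y x) v v' ir ui).
  congr (density i (upd _ _ _)); apply/ffunP => u'; rewrite !ffunE.
  by case: eqP => [->|//]; rewrite (negbTE uJ).
have A_upd x u v : u \in part i -> A (upd x u v) = A x.
  by move=> ui; rewrite /A /mean; congr (_ / _); apply: eq_bigr => v' _; rewrite h_upd.
set t := #|J :&: part i|.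
have t0 : (0 < t)%N by apply/card_gt0P; exists (c i); rewrite !inE ciJ tci eqxx.
set M := Q ^+ exponent i.
have M0 : 0 <= eps * M.
  by apply: le_trans (density_ge0 i y) (sup i y (ltnSn i)).
have Mge : 0 <= M by rewrite -(pmulr_rge0 _ eps0).
(* What remains after bounding the t - 1 extra fixed factors; this power of [A] cancels against the
   free coordinates [Qs]. *)
pose g x := (if eps <= A x then (A x) ^- #|Qs| else 0) * h x (y (c i)).
have bound x : density i.+1 (merge J y x) <=
    M ^+ t.-1 * (g x * \prod_(u in Qs) h x (x u)).
  rewrite /= -/(h x) -/(A x) /g; case: ifP => [eA|_]; last by rewrite !mul0r mulr0.
  have A0 : 0 < A x by apply: lt_le_trans eA.
  have -> : \prod_(u in part i) density i (upd (merge J y x) (b i) (merge J y x u)) =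
      h x (y (c i)) * \prod_(u in (J :&: part i) :\ c i) h x (y u) *
      \prod_(u in Qs) h x (x u).
    rewrite (big_setID J) /= setIC (big_setD1 (c i)) /= ?inE ?ciJ ?tci ?eqxx //.
    congr (_ * _ * _); first by rewrite ffunE ciJ.
      by apply: eq_bigr => u; rewrite !inE => /and3P[_ uJ _]; rewrite ffunE uJ.
    by apply: eq_bigr => u; rewrite !inE => /andP[/negbTE uJ _]; rewrite ffunE uJ.
  have -> : (#|part i|.-1 = t.-1 + #|Qs|)%N.
    by rewrite -(cardsID J (part i)) setIC -/t -/Qs -(prednK t0) addSn.
  have prod_le : \prod_(u in (J :&: part i) :\ c i) h x (y u) <= (eps * M) ^+ t.-1.
    have -> : t.-1 = #|(J :&: part i) :\ c i|.
      by rewrite /t (cardsD1 (c i)) !inE ciJ tci eqxx.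
    rewrite -prodr_const; apply: ler_prod => u _.
    by rewrite density_ge0 sup.
  set P := \prod_(u in Qs) _; have P0 : 0 <= P by apply: prodr_ge0 => u _; exact: density_ge0.
  have -> : h x (y (c i)) * \prod_(u in (J :&: part i) :\ c i) h x (y u) * P / A x ^+ (t.-1 + #|Qs|)
     = (\prod_(u in (J :&: part i) :\ c i) h x (y u) / A x ^+ t.-1) * (A x ^- #|Qs| * h x (y (c i)) * P).
    by rewrite exprD invfM; ring.
  rewrite ler_wpM2r //.
    by rewrite !mulr_ge0 ?invr_ge0 ?exprn_ge0 ?(ltW A0) ?density_ge0.
  rewrite ler_pdivrMr ?exprn_gt0 //; apply: le_trans prod_le _.
  rewrite exprMn [X in X <= _]mulrC; apply: ler_wpM2l; first exact: exprn_ge0.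
  by apply: lerXn2r; rewrite ?nnegrE ?(ltW eps0) ?(ltW A0).
apply: le_trans (le_avg bound) _.
rewrite avgZ big_ord_recr /= -/M mulrA mulrC.
apply: ler_wpM2r; first exact: exprn_ge0.
have -> : avg (fun x => g x * \prod_(u in Qs) h x (x u)) =
    avg (fun x => g x * \prod_(u in Qs) A x).
  apply: (avg_prod V0 (h := fun=> h)).
    by move=> x u v; rewrite inE => /andP[_ ui]; rewrite /g A_upd // h_upd.
  by move=> x u u' v v'; rewrite inE => /andP[_ ui] _; rewrite h_upd.
(* The kept vertex [y (c i)] moves to the coordinate [b i], the only one of part i that [density i]
   reads. *)
pose J' := b i |: (J :\: part i).
pose y' := upd y (b i) (y (c i)).
pose c' l := if l == i then b i else c l.
have c'J' : transversal i c' J'.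
  split=> l.
    move=> lr; rewrite /c'; case: (eqVneq l i) => [->|li]; first by rewrite tg_b // !inE !eqxx.
    have /andP[/eqP tl lJ] := cJ l lr; rewrite tl eqxx !inE tl lJ li orbT //.
  by move=> /andP[il lr]; rewrite /c'; case: (eqVneq l i) => [->//|li]; rewrite cb // lr andbT ltn_neqAle eq_sym li.
have := IH (ltnW ir) (fun l x li => sup l x (ltnW li)) J' c' y' c'J'.
have -> : W0 (base c' y') = W0 (base c y).
  congr W0; apply/ffunP => l; rewrite !ffunE /c'; case: (eqVneq (l : nat) i) => [->|li].
    by rewrite eqxx.
  case: eqP => // bb; have /andP[/eqP tl _] := cJ l (ltn_ord l).
  by move: li; rewrite -tl bb tg_b // eqxx.
have -> : \prod_(l < i) (Q ^+ exponent l) ^+ #|J' :&: part l|.-1 =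
          \prod_(l < i) (Q ^+ exponent l) ^+ #|J :&: part l|.-1.
  apply: eq_bigr => l _; congr (_ ^+ _.-1); apply: eq_card => u; rewrite !inE.
  have [tl|] := eqVneq (tg u) l; last by rewrite !andbF.
  rewrite !andbT tl (ltn_eqF (ltn_ord l)) /=.
  case: eqP => //= ub; move: tl; rewrite ub tg_b // => ei.
  by have := ltn_ord l; rewrite -ei ltnn.
apply: le_trans; apply: le_avg => // x.
have -> : density i (merge J' y' x) = h x (y (c i)).
  apply: density_local; first exact: ltnW.
    move=> u ui; rewrite !ffunE !inE (ltn_eqF ui) /=.
    by case: eqP => //= ->.
  move=> l /andP[il lr]; rewrite !ffunE !inE.
  case: (eqVneq (b l) (b i)) => //= bb; rewrite tg_b //.
  by have [li|//] := eqVneq l i; rewrite li eqxx in bb.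
rewrite /g; case: ifP => [eA|_]; last by rewrite !mul0r density_ge0.
have A0 : 0 < A x by apply: lt_le_trans eA.
rewrite prodr_const -/(A x) mulrAC mulVf ?mul1r // expf_neq0 // gt_eqF //.
Qed.

Lemma prod_exponent i : (i <= r)%N ->
  Q * \prod_(l < i) (Q ^+ exponent l) ^+ #|part l|.-1 = Q ^+ exponent i.
Proof.
elim: i => [|i IH] ir; first by rewrite /exponent !big_ord0 mulr1 expr1.
rewrite big_ord_recr /= mulrA IH ?(ltnW ir) // -exprS prednK ?part_gt0 //.
by rewrite -exprM /exponent big_ord_recr.
Qed.

(** The marginal on all of [W] is the density itself. The induction is strong, since the marginal
    bound at i uses the suprema below i. *)
Lemma density_sup i x : (i <= r)%N -> density i x <= supdens i.
Proof.
have [m] := ubnP i; elim: m i x => // m IH i x im ir.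
have tb : transversal i b [set: W] by split=> l //; move=> lr; rewrite tg_b // inE eqxx.
have := density_marginal_step ir (fun l x li => IH l x (leq_trans li im) (leq_trans (ltnW li) ir)) x tb.
rewrite (eq_avg (g := fun=> density i x)) ?avg_cst //; last first.
  by move=> z; congr (density i _); apply/ffunP => u; rewrite !ffunE inE.
move/le_trans; apply; rewrite /supdens -(prod_exponent ir) mulrA.
have -> : \prod_(l < i) Q ^+ exponent l ^+ #|[set: W] :&: part l|.-1 =
    \prod_(l < i) Q ^+ exponent l ^+ #|part l|.-1.
  by apply: eq_bigr => l _; rewrite setTI.
apply: ler_wpM2r => //; apply: prodr_ge0 => l _; do 2 apply: exprn_ge0.
rewrite -(pmulr_rge0 _ eps0); exact: le_trans (W0_ge0 _) (W0_le (base b x)).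
Qed.

Lemma density_marginal i (J : {set W}) c y : (i <= r)%N -> transversal i c J ->
  avg (fun x => density i (merge J y x)) <=
  W0 (base c y) * \prod_(l < i) (Q ^+ exponent l) ^+ #|J :&: part l|.-1.
Proof.
move=> ir; apply: density_marginal_step => // l x li.
by apply: density_sup; exact: leq_trans (ltnW li) ir.
Qed.

(** Over a part of size s the new density averages to A^s / A^(s-1) = A if A >= eps and to 0
    otherwise, so a stage loses at most eps. *)
Lemma avg_density i : (i <= r)%N -> 1 - i%:R * eps <= avg (density i).
Proof.
elim: i => [|i IH] ir.
  by rewrite mul0r subr0 (_ : avg _ = 1) // -avg_W0; apply: eq_avg.
set A := fun x => mean (fun v => density i (upd x (b i) v)).
set h := fun x v => density i (upd x (b i) v).
pose g x : R := if eps <= A x then (A x) ^- #|part i|.-1 else 0.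
have A_upd x u v : u \in part i -> A (upd x u v) = A x.
  move=> ui; rewrite /A /mean; congr (_ / _); apply: eq_bigr => v' _.
  exact: density_upd_local.
have -> : avg (density i.+1) = avg (fun x => g x * \prod_(u in part i) h x (x u)).
  apply: eq_avg => x /=; rewrite -/(A x) /g /h; case: ifP => _; last by rewrite mul0r.
  by rewrite mulrC.
have -> : avg (fun x => g x * \prod_(u in part i) h x (x u)) =
    avg (fun x => g x * \prod_(u in part i) A x).
  apply: (avg_prod V0 (h := fun=> h)).
    by move=> x u v ui; rewrite /g A_upd.
  by move=> x u u' v v' ui _; rewrite /h density_upd_local.
apply: (@le_trans _ _ (avg (fun x => A x + - eps))).
  rewrite avgD avg_cst // -[avg A](avg_upd V0 (b i)) -natr1 mulrDl mul1r.
  by have := IH (ltnW ir); lra.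
apply: le_avg => x; rewrite /g prodr_const.
have A0 : 0 <= A x.
  by apply: divr_ge0 => //; apply: sumr_ge0 => v _; exact: density_ge0.
case: ifP => [eA|/negbT]; last by rewrite mul0r -ltNge => /ltW; rewrite subr_le0.
have Ap : 0 < A x by apply: lt_le_trans eA.
have -> : A x ^- #|part i|.-1 * A x ^+ #|part i| = A x.
  by rewrite -{2}(prednK (part_gt0 ir)) exprS mulrCA mulVf ?mulr1 // expf_neq0 // gt_eqF.
by rewrite gerDl oppr_le0 ltW.
Qed.

Lemma avg_W0_swap i u : (i < r)%N -> tg u = i ->
  avg (fun x => W0 (base (fun l => if l == i then u else b l) x)) = 1.
Proof.
move=> ir tu; rewrite -avg_W0 [RHS](avg_perm (tperm (b i) u)).
apply: eq_avg => x; congr W0; apply/ffunP => l; rewrite !ffunE.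
case: (eqVneq (l : nat) i) => [->|li]; first by rewrite tpermL.
rewrite tpermD //; apply/eqP => e.
  by move: li; rewrite -(tg_b (ltn_ord l)) -e tg_b // eqxx.
by move: li; rewrite -(tg_b (ltn_ord l)) -e tu eqxx.
Qed.

(** Marginal on a transversal through [u] together with [u']: the one extra vertex costs one factor
    Q^(exponent (tg u)). In the resulting bound [u'] is free and meets [u] with probability 1 /
    |V|. *)
Lemma avg_coincidence u u' : u != u' -> tg u = tg u' ->
  avg (fun x => density r x * (x u == x u')%:R) <= Q ^+ exponent (tg u) / #|V|%:R.
Proof.
move=> uu' tuu'; set i := tg u.
pose c l := if l == i then u else b l.
pose J := u' |: [set c l | l : 'I_r].
have tgc l : (l < r)%N -> tg (c l) = l.
  by move=> lr; rewrite /c; case: (eqVneq l i) => [->//|_]; rewrite tg_b.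
have tJ : transversal r c J.
  split=> l; last by case: ltngtP.
  move=> lr; rewrite tgc // eqxx /= !inE; apply/orP; right.
  by apply/imsetP; exists (Ordinal lr).
have cardJ (l : 'I_r) : #|J :&: part l|.-1 = (l == i :> nat).
  have E : J :&: part l = (if l == i :> nat then [set u'] else set0) :|: [set c l].
    apply/setP => z; rewrite !inE; apply/idP/idP.
      case/andP=> /orP[/eqP ->|/imsetP[m _ ->]] /eqP.
        by move=> <-; rewrite -tuu' eqxx inE eqxx.
      by rewrite tgc // => ->; rewrite eqxx orbT.
    case/orP=> [|/eqP ->]; last first.
      by rewrite tgc // eqxx andbT; apply/orP; right; apply/imsetP; exists l.
    by case: eqP => [e|_]; rewrite inE // => /eqP ->; rewrite eqxx -tuu' e eqxx.
  rewrite E; case: eqP => [e|_]; last by rewrite set0U cards1.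
  by rewrite cards2 /c e eqxx eq_sym uu'.
rewrite (avg_merge V0 J).
have uJ : u \in J.
  rewrite !inE; apply/orP; right; apply/imsetP; exists (Ordinal (tg_lt u)) => //.
  by rewrite /c /= eqxx.
have u'J : u' \in J by rewrite !inE eqxx.
set K := Q ^+ exponent i.
have K0 : 0 <= K.
  apply: exprn_ge0; rewrite -(pmulr_rge0 _ eps0).
  have /card_gt0P[v _] := V0.
  exact: le_trans (W0_ge0 _) (W0_le [ffun=> v]).
apply: (@le_trans _ _ (avg (fun y => K * (W0 (base c y) * (y u == y u')%:R)))).
  apply: le_avg => y.
  rewrite (eq_avg (g := fun x => (y u == y u')%:R * density r (merge J y x))); last first.
    by move=> x; rewrite !ffunE uJ u'J mulrC.
  rewrite avgZ mulrA [leRHS]mulrC; apply: ler_wpM2l => //.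
  apply: le_trans (density_marginal y (leqnn r) tJ) _.
  rewrite [leRHS]mulrC; apply: ler_wpM2l => //.
  rewrite (bigD1 (Ordinal (tg_lt u))) // cardJ /= eqxx expr1 big1 ?mulr1 // => l li.
  by rewrite cardJ; case: eqP => [e|//]; move: li; rewrite -val_eqE /= e eqxx.
rewrite avgZ; apply: ler_wpM2l => //.
rewrite (avg_upd V0 u').
rewrite (eq_avg (g := fun y => #|V|%:R^-1 * W0 (base c y))).
  have E : avg (fun x => W0 (base c x)) = 1 := avg_W0_swap (tg_lt u) erefl.
  by rewrite avgZ E mulr1.
move=> y; rewrite /mean mulrC; congr (_ * _).
have cu' v : base c (upd y u' v) = base c y.
  apply/ffunP => l; rewrite !ffunE; case: eqP => // e.
  move: (tgc l (ltn_ord l)); rewrite e -tuu' => li.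
  by move: e uu'; rewrite /c -li eqxx => ->; rewrite eqxx.
rewrite (bigD1 (y u)) //= upd_at upd_ne // eqxx mulr1 cu' big1 ?addr0 // => v vu.
by rewrite upd_at upd_ne // eq_sym (negbTE vu) mulr0.
Qed.

(** The weight is [density r] without the maps that identify two vertices of a part; each pair costs
    at most [eta]. Positive density forces [W0] to be nonzero on every transversal, because the
    marginal on all of [W] is bounded by a multiple of [W0] on any of them. *)
Lemma balanced_density (eta : R) :
  (forall l, (l < r)%N -> Q ^+ exponent l <= eta * #|V|%:R) ->
  exists w : {ffun W -> V} -> R,
  [/\ forall x, 0 <= w x,
      1 - r%:R * eps - #|W|%:R ^+ 2 * eta <= avg w,
      forall x, w x != 0 -> (forall u u', u != u' -> tg u = tg u' -> x u != x u') /\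
        (forall c, (forall l, (l < r)%N -> tg (c l) = l) -> W0 (base c x) != 0) &
      forall (J : {set W}) y, (forall l, (l < r)%N -> J :&: part l != set0) ->
        avg (fun x => w (merge J y x)) <=
        eps * Q * \prod_(l < r) (Q ^+ exponent l) ^+ #|J :&: part l|.-1].
Proof.
move=> etaP.
pose bad x (p : W * W) := [&& p.1 != p.2, tg p.1 == tg p.2 & x p.1 == x p.2].
pose w x := if [exists p, bad x p] then 0 else density r x.
have wle x : w x <= density r x by rewrite /w; case: ifP => // _; exact: density_ge0.
have Q0 : 0 <= Q.
  rewrite -(pmulr_rge0 _ eps0).
  have /card_gt0P[v _] := V0.
  exact: le_trans (W0_ge0 _) (W0_le [ffun=> v]).
have Vp : 0 < #|V|%:R :> R by rewrite ltr0n.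
exists w; split.
- by move=> x; rewrite /w; case: ifP => // _; exact: density_ge0.
- pose F (p : W * W) x : R := if (p.1 != p.2) && (tg p.1 == tg p.2) then
      density r x * (x p.1 == x p.2)%:R else 0.
  have F_ge0 p x : 0 <= F p x.
    by rewrite /F; case: ifP => // _; rewrite mulr_ge0 ?density_ge0.
  have F_le p : avg (F p) <= eta.
    case E : ((p.1 != p.2) && (tg p.1 == tg p.2)).
      rewrite (eq_avg (g := fun x => density r x * (x p.1 == x p.2)%:R)).
        move: E => /andP[E1 /eqP E2]; apply: le_trans (avg_coincidence E1 E2) _.
        by rewrite ler_pdivrMr // etaP.
      by move=> x; rewrite /F E.
    rewrite (eq_avg (g := fun=> 0)) ?avg_cst //; last by move=> x; rewrite /F E.
    have := etaP _ (tg_lt p.1); rewrite -ler_pdivrMr //; apply: le_trans.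
    by rewrite divr_ge0 ?exprn_ge0.
  have le1 : avg (density r) <= avg w + avg (fun x => \sum_p F p x).
    rewrite -avgD; apply: le_avg => x; rewrite /w.
    case: ifP => [/existsP[p /and3P[p1 p2 p3]]|_]; last first.
      by rewrite lerDl sumr_ge0.
    by rewrite add0r (bigD1 p) //= {1}/F p1 p2 p3 mulr1 lerDl sumr_ge0.
  have le2 : avg (fun x => \sum_p F p x) <= #|W|%:R ^+ 2 * eta.
    rewrite avg_sum; apply: le_trans (ler_sum _ (fun p _ => F_le p)) _.
    by rewrite sumr_const card_prod -[leLHS]mulr_natl natrM expr2.
  by have := avg_density (leqnn r); lra.
- move=> x; rewrite /w; case: ifP => [|/negbT/existsPn nbad]; first by rewrite eqxx.
  move=> dx; split=> [u u' uu' tuu'|c tgc].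
    by have := nbad (u, u'); rewrite /bad /= uu' tuu' eqxx.
  apply: contraNneq dx => W0x; rewrite eq_le density_ge0 andbT.
  have tc : transversal r c [set: W].
    by split=> l lr; [rewrite tgc // inE eqxx|move: lr; case: ltngtP].
  have := density_marginal x (leqnn r) tc; rewrite W0x mul0r.
  rewrite (eq_avg (g := fun=> density r x)) ?avg_cst // => z.
  by congr (density r _); apply/ffunP => u; rewrite !ffunE inE.
move=> J y JP.
have /card_gt0P[v0 _] := V0.
have [c cP] : exists c, forall l, (l < r)%N -> (tg (c l) == l) && (c l \in J).
  exists (fun l => odflt (b l) [pick u in J :&: part l]) => l lr.
  case: pickP => [u|]; first by rewrite !inE /= => /andP[-> ->].
  by move=> h; have /set0Pn[u uJ] := JP l lr; have := h u; rewrite uJ.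
have tc : transversal r c J by split=> // l; case: ltngtP.
apply: le_trans (le_avg (fun x => wle (merge J y x))) _.
apply: le_trans (density_marginal y (leqnn r) tc) _.
apply: ler_wpM2r => //; apply: prodr_ge0 => l _; do 2 apply: exprn_ge0.
exact: Q0.
Qed.

End Density.

(** * Codegree exponents *)

Section Exponents.
Variables (R : realType) (r : nat) (s : nat -> R) (L lam ell : R).
Hypothesis s2 : forall l, (l < r)%N -> 2 <= s l.
Hypotheses (lam0 : 0 <= lam) (ell0 : 0 <= ell).

(** In the application L = ln n and lam = ln Q, so [Lev l] is - ln (Q^(b l) / n), the gain from a
    further vertex in part l. The inequality F m >= 0 is the level inequality at the corner (1, ..,
    1, s_m, .., s_(r-1)). *)
Let b l : R := \prod_(j < l) s j.
Let Lev l : R := L - b l * lam.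
Let P m : R := \prod_(l < r | (m <= l)%N) s l.
Let F m : R := \sum_(l < r | (m <= l)%N) (s l - 1) * Lev l - (P m - 1) * ell.

Hypothesis full : (P 0 - 1) * ell <= \sum_(l < r) (s l - 1) * Lev l.
Hypothesis last_level : ell <= Lev r.-1.

Let P_ge1 m : 1 <= P m.
Proof.
by rewrite /P; elim/big_rec: _ => // l x _ x1; have := s2 (ltn_ord l); nra.
Qed.

Let PS m : (m < r)%N -> P m = s m * P m.+1.
Proof.
move=> mr; rewrite /P (bigD1 (Ordinal mr)) //=; congr (_ * _).
by apply: eq_bigl => l; rewrite ltn_neqAle andbC eq_sym.
Qed.

Let FS m : (m < r)%N -> F m = F m.+1 + (s m - 1) * (Lev m - P m.+1 * ell).
Proof.
move=> mr; rewrite /F (PS mr) (bigD1 (Ordinal mr)) //=.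
rewrite (eq_bigl (fun l : 'I_r => (m < l)%N)); first by ring.
by move=> l; rewrite ltn_neqAle andbC eq_sym.
Qed.

Let Fr : F r = 0.
Proof.
rewrite /F /P !big_pred0; last 2 first.
- by move=> l; apply/negbTE; rewrite -ltnNge.
- by move=> l; apply/negbTE; rewrite -ltnNge.
by rewrite subrr mul0r subr0.
Qed.

Let bS l : b l.+1 = s l * b l.
Proof. by rewrite /b big_ord_recr mulrC. Qed.

Let b_ge0 l : (l <= r)%N -> 0 < b l.
Proof.
elim: l => [|l IH] lr; first by rewrite /b big_ord0.
by rewrite bS mulr_gt0 ?IH ?(ltnW lr) //; have := s2 lr; lra.
Qed.

Let b_mono l m : (l <= m)%N -> (m <= r)%N -> b l <= b m.
Proof.
elim: m => [|m IH] lm mr; first by move: lm; rewrite leqn0 => /eqP ->.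
move: lm; rewrite leq_eqVlt => /predU1P[->//|]; rewrite ltnS => lm.
apply: (le_trans (IH lm (ltnW mr))); rewrite bS.
by have := s2 mr; have := b_ge0 (ltnW mr); nra.
Qed.

Let Lev_mono l m : (l <= m)%N -> (m <= r)%N -> Lev m <= Lev l.
Proof. by move=> lm mr; rewrite /Lev lerD2l lerN2 ler_wpM2r ?b_mono. Qed.

(** By [FS] this says F m.+1 <= F m. Since it is inherited upwards, [F] rises and then falls, from F
    0 >= 0 to F r = 0, and is nonnegative throughout. *)
Let good m := P m.+1 * ell <= Lev m.

(** From [good m] follows 2 P m.+2 ell <= L, and from [last_level] 2 b m.+1 lam <= L; their average
    is [good m.+1]. At the last index the claim is [last_level] itself. *)
Let goodS m : (m.+1 < r)%N -> good m -> good m.+1.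
Proof.
move=> mr gm; rewrite /good.
have [e|mr1] := eqVneq m.+2 r.
  rewrite e /P big_pred0 ?mul1r; last by move=> l; apply/negbTE; rewrite -ltnNge.
  by have := last_level; rewrite -e.
have mr2 : (m.+2 < r)%N by rewrite ltn_neqAle mr1.
have h1 : b m.+2 <= b r.-1 by apply: b_mono; rewrite ?leq_pred // -ltnS prednK // (leq_trans _ mr).
have h2 : b m.+2 = s m.+1 * b m.+1 := bS _.
have h3 := s2 mr; have h4 := b_ge0 (ltnW mr); have h5 := b_ge0 (ltnW (ltnW mr)).
have h6 := last_level; rewrite /Lev in h6.
move: gm; rewrite /good (PS mr) /Lev => gm.
have h7 := P_ge1 m.+2; have l0 := lam0; have e0 := ell0.
have h8 : 2 * b m.+1 * lam <= L.
  have : 2 * b m.+1 <= b r.-1 by nra.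
  by move=> h9; have := ler_wpM2r l0 h9; lra.
have h9 : 2 * (P m.+2 * ell) <= s m.+1 * P m.+2 * ell.
  by rewrite -mulrA; apply: ler_wpM2r => //; rewrite mulr_ge0 // (le_trans _ h7).
have h10 : 0 <= b m * lam by rewrite mulr_ge0 // ltW.
lra.
Qed.

Let F_good m : (m < r)%N -> good m -> 0 <= F m.
Proof.
have [k] := ubnP (r - m); elim: k m => // k IH m km mr gm.
have h : 0 <= (s m - 1) * (Lev m - P m.+1 * ell).
  by rewrite mulr_ge0 // subr_ge0 //; have := s2 mr; lra.
rewrite (FS mr) addr_ge0 //.
have [->|mr1] := eqVneq m.+1 r; first by rewrite Fr.
have mr2 : (m.+1 < r)%N by rewrite ltn_neqAle mr1.
apply: IH => //; last exact: goodS.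
by rewrite -ltnS (leq_trans _ km) // ltnS subnS prednK // subn_gt0.
Qed.

Let F_ge0 m : (m <= r)%N -> 0 <= F m.
Proof.
elim: m => [_|m IH mr]; first by rewrite /F subr_ge0.
have [mr1|mr1] := eqVneq m.+1 r; first by rewrite mr1 Fr.
have mr2 : (m.+1 < r)%N by rewrite ltn_neqAle mr1.
have [g|ng] := lerP (P m.+1 * ell) (Lev m); first by apply: F_good => //; exact: goodS.
have := IH (ltnW mr); rewrite (FS mr) => h; apply: le_trans h _.
by rewrite gerDl mulr_ge0_le0 // ?subr_le0 ?(ltW ng) //; have := s2 mr; lra.
Qed.

Let bernoulli (Q : pred 'I_r) (x : 'I_r -> R) : (forall l, 1 <= x l) ->
  1 + \sum_(l | Q l) (x l - 1) <= \prod_(l | Q l) x l.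
Proof.
move=> x1.
have [] : 1 + \sum_(l | Q l) (x l - 1) <= \prod_(l | Q l) x l /\ 1 <= \prod_(l | Q l) x l.
  elim/big_rec2: _ => [|l y1 y2 Ql [h1 h2]]; first by rewrite addr0.
  by have := x1 l; split; nra.
by [].
Qed.

(* The left-hand side minus the right-hand side is affine in every [t l], so on the box
   [1 <= t l <= s l] it is minimal at a vertex; moving the coordinates one at a time,
   only the vertices (1, .., 1, s_m, .., s_r) have to be examined, which is [F_ge0]. *)
Lemma level_inequality (t : 'I_r -> R) : (forall l, 1 <= t l <= s l) ->
  (\prod_l t l - 1) * ell <= \sum_l (t l - 1) * Lev l.
Proof.
have [k] := ubnP #|[pred l | 1 < t l]|; elim: k t => // k IH t kt tP.
have t1 l : 1 <= t l by case/andP: (tP l).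
set T := \prod_l t l.
have TD l : T = t l * \prod_(j | j != l) t j by rewrite /T (bigD1 l).
have others1 l : 1 <= \prod_(j | j != l) t j.
  by elim/big_rec: _ => // j x _ x1; have := t1 j; nra.
(* A coordinate in which the difference of the two sides is nondecreasing may be lowered to 1, which
   leaves fewer coordinates above 1. *)
have [/existsP[l /andP[tl gl]]|nex] :=
    boolP [exists l, (1 < t l) && ((\prod_(j | j != l) t j) * ell <= Lev l)].
  pose t' j := if j == l then 1 else t j.
  have IHt' : (\prod_l t' l - 1) * ell <= \sum_l (t' l - 1) * Lev l.
    apply: IH => [|j].
      move: kt; rewrite (cardD1 l) inE tl add1n ltnS; apply: leq_trans.
      rewrite ltnS; apply: subset_leq_card; apply/fintype.subsetP => j.
      rewrite !inE /t'; case: eqP => //=; by rewrite ltxx.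
    rewrite /t'; case: eqP => // _; rewrite lexx /=.
    by case/andP: (tP j) => h1 h2; exact: le_trans h2.
  move: IHt'; rewrite (bigD1 l) //= [X in _ <= X](bigD1 l) //=.
  have -> : t' l = 1 by rewrite /t' eqxx.
  rewrite mul1r subrr mul0r add0r.
  rewrite (eq_bigr t); last by move=> j /negbTE jl; rewrite /t' jl.
  rewrite [X in _ <= X](eq_bigr (fun j => (t j - 1) * Lev j)); last by move=> j /negbTE jl; rewrite /t' jl.
  move=> IHt'; rewrite (TD l) [X in _ <= X](bigD1 l) //=.
  set X := \prod_(j | _) _ in gl IHt' *.
  have : 0 <= (t l - 1) * (Lev l - X * ell) by rewrite mulr_ge0 // subr_ge0 // ltW.
  have := t1 l; nra.
have [/existsP[m0 tm0]|none] := boolP [exists l, 1 < t l]; last first.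
  have tE l : t l = 1.
    apply/eqP; rewrite eq_le t1 andbT leNgt; apply: contra none => h; apply/existsP.
    by exists l.
  rewrite /T big1 // subrr mul0r sumr_ge0 // => l _.
  by rewrite tE subrr mul0r.
case: (@arg_minnP _ m0 (fun l => 1 < t l) (fun l : 'I_r => l : nat) tm0) => m tm minm.
have tlt (l : 'I_r) : (l < m)%N -> t l = 1.
  move=> lm; apply/eqP; rewrite eq_le t1 andbT leNgt; apply/negP => /minm.
  by rewrite leqNgt lm.
(* From m on the difference is nonincreasing in every coordinate, also in those equal to 1, since
   [Lev] decreases along the parts. *)
have step (l : 'I_r) : (m <= l)%N -> t l * Lev l <= T * ell.
  move=> ml; have h l' : 1 < t l' -> Lev l' <= (\prod_(j | j != l') t j) * ell.
    move=> tl; move/existsPn: nex => /(_ l'); rewrite tl /= -ltNge; exact: ltW.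
  have [tl|] := ltP 1 (t l).
    rewrite (TD l) -mulrA; apply: ler_wpM2l; last exact: h.
    by rewrite (le_trans _ (t1 l)).
  move=> tl; have -> : t l = 1 by apply/eqP; rewrite eq_le tl t1.
  rewrite mul1r; apply: (le_trans (Lev_mono ml (ltnW (ltn_ord l)))).
  apply: le_trans (h m tm) _; rewrite (TD m); apply: ler_wpM2r => //.
  by rewrite ler_peMl // (le_trans ler01).
have Fm := F_ge0 (ltnW (ltn_ord m)).
(* All coordinates from m on are raised to s_l together: the side with [Lev] gains at most the sum
   of (rho l - 1) T ell, and by Bernoulli the side with [ell] gains at least as much. *)
pose rho (l : 'I_r) := if (m <= l)%N then s l / t l else 1.
have t_gt0 l : 0 < t l by apply: lt_le_trans (t1 l).
have rho1 l : 1 <= rho l.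
  rewrite /rho; case: ifP => // _; rewrite ler_pdivlMr // mul1r.
  by case/andP: (tP l).
have := bernoulli (fun l => (m <= l)%N) rho1.
set B := \prod_(l | _) rho l => bern.
have TE : T = \prod_(l < r | (m <= l)%N) t l.
  rewrite /T (bigID (fun l : 'I_r => (m <= l)%N)) /= [X in _ * X]big1 ?mulr1 // => l.
  by rewrite -ltnNge => /tlt.
have TB : T * B = P m.
  rewrite TE /B -big_split /=; apply: eq_bigr => l ml; rewrite /rho ml.
  by rewrite mulrC divfK // gt_eqF.
have sumE : \sum_l (t l - 1) * Lev l = \sum_(l < r | (m <= l)%N) (t l - 1) * Lev l.
  rewrite (bigID (fun l : 'I_r => (m <= l)%N)) /= [X in _ + X]big1 ?addr0 // => l.
  by rewrite -ltnNge => /tlt ->; rewrite subrr mul0r.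
have diff : \sum_(l < r | (m <= l)%N) (s l - 1) * Lev l <=
    \sum_(l < r | (m <= l)%N) (t l - 1) * Lev l +
    (\sum_(l < r | (m <= l)%N) (rho l - 1)) * (T * ell).
  rewrite mulr_suml -big_split /=; apply: ler_sum => l ml.
  have -> : (s l - 1) * Lev l = (t l - 1) * Lev l + (rho l - 1) * (t l * Lev l).
    by rewrite /rho ml; field; rewrite gt_eqF.
  by rewrite lerD2l; apply: ler_wpM2l; [rewrite subr_ge0|exact: step].
rewrite sumE; move: Fm; rewrite /F -TB => Fm.
have Tl : 0 <= T * ell.
  by rewrite mulr_ge0 // prodr_ge0 // => l _; exact: ltW.
have : (\sum_(l < r | (m <= l)%N) (rho l - 1)) * (T * ell) <= (B - 1) * (T * ell).
  by apply: ler_wpM2r => //; lra.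
lra.
Qed.

End Exponents.

(** Here j edges of a copy span t_l vertices in part l, so j <= prod t_l, and each vertex beyond the
    first in its part contributes one factor. The two upper bounds on [ell] are the cases t = (1,
    .., 1, 2) and t = s; taking logarithms, [level_inequality] yields all the others. *)
Lemma codegree_exponents (R : realType) (r : nat) (s t : nat -> nat) (n Q ell : R) (j : nat) :
  (forall l, (l < r)%N -> (2 <= s l)%N) ->
  (forall l, (l < r)%N -> (1 <= t l <= s l)%N) -> 1 <= Q -> 0 < n -> 0 <= ell ->
  ell <= ln n - (\prod_(l < r.-1) s l)%:R * ln Q ->
  ((\prod_(l < r) s l)%:R - 1) * (ell + ln Q) <= (\sum_(l < r) (s l)%:R - r%:R) * ln n ->
  (j <= \prod_(l < r) t l)%N ->
  \prod_(l < r) (Q ^+ (\prod_(i < l) s i) / n) ^+ (t l).-1 <= expR (- ell) ^+ j.-1.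
Proof.
move=> s2 tP Q1 n0 ell0 last_lev full jt.
have Q0 : 0 < Q by apply: lt_le_trans Q1.
have lnQ : 0 <= ln Q by rewrite ln_ge0.
pose sR l : R := (s l)%:R.
have sR2 l : (l < r)%N -> 2 <= sR l by move=> lr; rewrite /sR ler_nat s2.
have bE l : \prod_(i < l) sR i = (\prod_(i < l) s i)%:R by rewrite natr_prod.
have h1 : ((\prod_(l < r | (0 <= l)%N) sR l) - 1) * ell <=
    \sum_(l < r) (sR l - 1) * (ln n - \prod_(i < l) sR i * ln Q).
  (* The powers of Q in a full copy telescope to prod s_l - 1. *)
  have tele m : \sum_(l < m) (sR l - 1) * \prod_(i < l) sR i = \prod_(i < m) sR i - 1.
    elim: m => [|m IH]; first by rewrite !big_ord0 subrr.
    by rewrite big_ord_recr IH big_ord_recr /=; ring.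
  have -> : \sum_(l < r) (sR l - 1) * (ln n - \prod_(i < l) sR i * ln Q) =
      (\sum_(l < r) (s l)%:R - r%:R) * ln n - (\prod_(i < r) sR i - 1) * ln Q.
    rewrite -(tele r) mulr_suml.
    have -> : \sum_(l < r) (s l)%:R - r%:R = \sum_(l < r) (sR l - 1) :> R.
      by rewrite sumrB sumr_const card_ord.
    rewrite mulr_suml -sumrB; apply: eq_bigr => l _; ring.
  move: full; rewrite -(bE r) => full; lra.
have h2 : ell <= ln n - \prod_(i < r.-1) sR i * ln Q by rewrite bE.
have := level_inequality sR2 lnQ ell0 h1 h2 (t := fun l : 'I_r => (t l)%:R).
have tR (l : 'I_r) : (1 : R) <= (t l)%:R <= sR l.
  by rewrite /sR ler1n ler_nat; exact: tP (ltn_ord l).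
move=> /(_ tR) main.
have pos l : 0 < Q ^+ (\prod_(i < l) s i) / n by rewrite divr_gt0 // exprn_gt0.
rewrite -ler_ln ?posrE; last 2 first.
- by apply: prodr_gt0 => l _; exact: exprn_gt0.
- by rewrite exprn_gt0 // expR_gt0.
rewrite lnXn ?expR_gt0 // expRK.
have -> : ln (\prod_(l < r) (Q ^+ (\prod_(i < l) s i) / n) ^+ (t l).-1) =
   \sum_(l < r) - (((t l)%:R - 1) * (ln n - \prod_(i < l) sR i * ln Q)).
  apply: (@proj2 (0 < \prod_(l < r) (Q ^+ (\prod_(i < l) s i) / n) ^+ (t l).-1)).
  elim/big_rec2: _ => [|l x y _ [y0 yE]]; first by rewrite ln1.
  split; first by rewrite mulr_gt0 // exprn_gt0.
  rewrite lnM ?posrE ?exprn_gt0 // yE; congr (_ + _).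
  rewrite lnXn // lnM ?posrE ?invr_gt0 ?exprn_gt0 // lnV ?posrE // lnXn //.
  have /andP[t1 _] := tP l (ltn_ord l).
  rewrite -{2}(prednK t1) -natr1 bE -mulr_natl -[_ *+ _.-1]mulr_natl; ring.
rewrite sumrN -mulr_natl mulrN lerN2; apply: le_trans main.
apply: ler_wpM2r => //.
rewrite -natr_prod.
case: j jt => [_|j jt] /=; last by rewrite lerBrDr natr1 ler_nat.
by rewrite subr_ge0 ler1n; apply: prodn_cond_gt0 => l _; case/andP: (tP l (ltn_ord l)).
Qed.

(** * Supersaturation for complete multipartite hypergraphs *)

(** The predicate [has_copy] for a bare edge set, so that subfamilies can be quantified over without
    a proof of uniformity. *)
Definition contains_copy r (W V : finType) (F : rgraph r W) (G : {set {set V}}) : bool :=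
  [exists f : {ffun W -> V}, injectiveb f && [forall e in edges F, (f @: e) \in G]].

Section MultipartiteContainers.
Variables (R : realType) (r : nat) (s : 'I_r -> nat).
Hypothesis hr : (2 <= r)%N.
Hypothesis hs : forall i, (2 <= s i)%N.

Let W : finType := part_vertex s.
Let r_gt0 : (0 < r)%N := ltnW hr.
Let s_gt0 i : (0 < s i)%N := ltnW (hs i).
Let tg (u : W) : nat := tag u.
(** Vertex 0 of part l. Parts are indexed by [nat] to match the recursion of [density]; out of range
    the default is part 0. *)
Let b (l : nat) : W :=
  let i := odflt (Ordinal r_gt0) (insub l) in Tagged (fun i => 'I_(s i)) (Ordinal (s_gt0 i)).

Let tg_lt u : (tg u < r)%N. Proof. exact: ltn_ord. Qed.

Let tg_b l : (l < r)%N -> tg (b l) = l.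
Proof. by move=> lr; rewrite /tg /b /=; case: insubP => [i _ <-|]; rewrite ?lr. Qed.

Let card_part (i : 'I_r) : #|part tg i| = s i.
Proof.
have -> : part tg i = [set Tagged (fun i => 'I_(s i)) j | j : 'I_(s i)].
  apply/setP => -[i' j]; rewrite !inE /tg /=; apply/idP/imsetP => [/eqP ii'|[j' _ /(congr1 (fun u : W => tag u)) /= ->]] //.
  have {}ii' : i' = i by apply: val_inj.
  by subst i'; exists j.
rewrite card_imset ?card_ord // => j j' /eqP.
by rewrite -tag_eqE /tag_eq eqxx /= tagged_asE => /eqP.
Qed.

Let cp l := #|part tg l|.

Let cp2 l : (l < r)%N -> (2 <= cp l)%N.
Proof. by move=> lr; rewrite /cp (card_part (Ordinal lr)). Qed.

Let exponentE : (\prod_(l < r) cp l = a_r1 s)%N.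
Proof. by apply: eq_bigr => l _; exact: card_part. Qed.

Let exponent_last : (\prod_(l < r.-1) cp l = a_r s)%N.
Proof.
rewrite /a_r -(eq_bigr _ (fun i _ => card_part i)).
rewrite -(big_mkord predT cp) -(big_mkord (fun i => (i.+1 < r)%N) cp).
rewrite [RHS](@big_cat_nat _ _ _ r.-1) ?leq_pred //= [X in (_ * X)%N]big_nat_cond.
rewrite [X in (_ * X)%N]big_pred0 ?muln1; last first.
  by move=> l; apply/negbTE/negP => /andP[/andP[l1 _] l2]; lia.
rewrite big_nat_cond [RHS]big_nat_cond; apply: eq_bigl => l.
by apply/idP/idP => /andP[/andP[h1 h2] h3]; apply/andP; split; try (apply/andP; split); lia.
Qed.

Lemma multipartite_edgeP (e : {set W}) : e \in multipartite_edges s ->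
  exists2 c : nat -> W, forall l, (l < r)%N -> tg (c l) = l & e = [set c i | i : 'I_r].
Proof.
rewrite inE => /forallP he.
have h (i : 'I_r) : exists u, [set v in e | tag v == i] == [set u].
  by have /cards1P[u ->] := he i; exists u.
pose c (l : nat) := if insub l is Some i then xchoose (h i) else b 0.
have cP (i : 'I_r) : [set v in e | tag v == i] = [set c i].
  by rewrite /c valK; apply/eqP; exact: xchooseP (h i).
exists c => [l lr|].
  have := set11 (c (Ordinal lr)); rewrite -cP inE => /andP[_ /eqP] /= e1.
  by rewrite /tg e1.
apply/setP => u; apply/idP/imsetP => [ue|[i _ ->]].
  exists (tag u) => //; apply/set1P; by rewrite -cP inE ue eqxx.
by have := set11 (c i); rewrite -cP inE => /andP[].
Qed.

Lemma transversal_edge (c : nat -> W) : (forall l, (l < r)%N -> tg (c l) = l) ->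
  [set c i | i : 'I_r] \in multipartite_edges s.
Proof.
move=> tc; rewrite inE; apply/forallP => i; apply/cards1P; exists (c i).
apply/setP => u; rewrite !inE; apply/andP/eqP => [[/imsetP[j _ ->]]|->].
  move=> /eqP e; congr c; rewrite -(tc j) // /tg e //.
split; first by apply/imsetP; exists i.
by apply/eqP/val_inj; exact: (tc i).
Qed.

Lemma card_part_vertex : #|{: part_vertex s}| = (\sum_i s i)%N.
Proof.
rewrite -sum1_card (partition_big (fun u : W => tag u) predT) //=.
apply: eq_bigr => i _; rewrite -card_part sum1dep_card; apply: eq_card => u.
by rewrite !inE /tg -val_eqE.
Qed.

Lemma card_multipartite_edges : (a_r1 s <= #|multipartite_edges s|)%N.
Proof.
pose A := [set f : {ffun 'I_r -> W} | f \in family (fun i : 'I_r => mem (part tg i))].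
have cA : #|A| = a_r1 s.
  rewrite cardsE card_family foldrE big_map big_enum /=.
  by apply: eq_bigr => i _; exact: card_part.
have tA f i : f \in A -> tg (f i) = i.
  rewrite inE => /familyP/(_ i) h.
  by have : f i \in part tg i := h; rewrite inE => /eqP.
have inj : {in A &, injective (fun f : {ffun 'I_r -> W} => [set f i | i : 'I_r])}.
  move=> f f' fA f'A e; apply/ffunP => i.
  have : f i \in [set f' i | i : 'I_r] by rewrite -e; apply/imsetP; exists i.
  case/imsetP => j _ ij; rewrite ij; congr (f' _); apply: val_inj => /=.
  by rewrite -(tA _ _ f'A) -ij tA.
rewrite -cA -(card_in_imset inj); apply: subset_leq_card; apply/fintype.subsetP => e.
case/imsetP => f fA ->.
pose c (l : nat) := if insub l is Some i then f i else b 0.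
rewrite (eq_imset (g := fun i : 'I_r => c i)); last by move=> i; rewrite /c valK.
apply: transversal_edge => l lr; rewrite /c; case: insubP => [i _ <-|]; last by rewrite lr.
exact: tA.
Qed.

Section Balanced.
Variables (n : nat) (G : {set {set 'I_n}}).
Hypothesis n0 : (0 < n)%N.
Hypothesis Gr : forall e, e \in G -> #|e| = r.
Hypothesis G0 : (0 < #|G|)%N.

Let V := 'I_n.
Let V0 : (0 < #|V|)%N. Proof. by rewrite card_ord. Qed.
Let N : R := #|G|%:R.
Let g : R := N / n%:R ^+ r.
Let W0raw (z : {ffun 'I_r -> V}) : R := ([set z i | i : 'I_r] \in G)%:R.
Let q : R := avg (fun x : {ffun W -> V} => W0raw (base r b x)).

Let nR : 0 < n%:R :> R. Proof. by rewrite ltr0n. Qed.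
Let N0 : 0 < N. Proof. by rewrite ltr0n. Qed.
Let g0 : 0 < g. Proof. by rewrite divr_gt0 ?exprn_gt0. Qed.

(** Each edge has at least one ordering, and a fixed ordering is hit with probability n^(-r). *)
Let q_ge : g <= q.
Proof.
pose Q := [set b i | i : 'I_r].
have b_inj : injective (fun i : 'I_r => b i).
  by move=> i j /(congr1 tg); rewrite !tg_b // => /val_inj.
have cQ : #|Q| = r by rewrite card_imset // card_ord.
have one (e : {set V}) : e \in G -> n%:R ^- r <=
    avg (fun x : {ffun W -> V} => ([set base r b x i | i : 'I_r] == e)%:R) :> R.
  move=> eG; have ce := Gr eG.
  have [z zP] : exists z : {ffun 'I_r -> V}, [set z i | i : 'I_r] = e.
    exists [ffun i => enum_val (cast_ord (esym ce) i)].
    apply/setP => v; apply/imsetP/idP => [[i _ ->]|ve]; first by rewrite ffunE; exact: enum_valP.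
    exists (cast_ord ce (enum_rank_in ve v)) => //.
    by rewrite ffunE cast_ordK enum_rankK_in.
  have -> : n%:R ^- r = avg (fun x : {ffun W -> V} => 1 * \prod_(u in Q) (x u == z (tag u))%:R) :> R.
    rewrite (avg_prod V0 (g := fun=> 1) (h := fun u _ v => (v == z (tag u))%:R)) //.
    rewrite (eq_avg (g := fun=> n%:R ^- r)) ?avg_cst // => x.
    rewrite mul1r (eq_bigr (fun=> n%:R^-1)) ?prodr_const ?cQ ?exprVn // => u _.
    rewrite /mean (bigD1 (z (tag u))) //= eqxx big1 ?addr0 ?mul1r ?card_ord // => v /negbTE ->.
    by [].
  apply: le_avg => x; rewrite mul1r.
  have [h|/forallPn[u]] := boolP [forall u, (u \in Q) ==> (x u == z (tag u))].
    rewrite (_ : [set base r b x i | i : 'I_r] = e) ?eqxx.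
      by rewrite big1 // => u uQ; move/forallP: h => /(_ u); rewrite uQ => /= ->.
    rewrite -zP; apply: eq_imset => i; rewrite ffunE.
    have bQ : b i \in Q by apply/imsetP; exists i.
    move/forallP: h => /(_ (b i)); rewrite bQ => /eqP ->.
    by congr (z _); apply: val_inj; exact: (tg_b (ltn_ord i)).
  rewrite negb_imply => /andP[uQ /negbTE h].
  by rewrite (bigD1 u) //= h mul0r.
have -> : q = \sum_(e in G) avg (fun x : {ffun W -> V} => ([set base r b x i | i : 'I_r] == e)%:R).
  rewrite -avg_sum; apply: eq_avg => x; rewrite /W0raw.
  have [eG|eG] := boolP ([set base r b x i | i : 'I_r] \in G).
    rewrite (bigD1 _ eG) /= eqxx big1 ?addr0 // => e /andP[_ ne].
    by rewrite eq_sym (negbTE ne).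
  by rewrite big1 // => e eG'; case: eqP => // ee; rewrite ee eG' in eG.
rewrite /g /N -sum1_card natr_sum mulr_suml; apply: ler_sum => e eG.
by rewrite mul1r; exact: one.
Qed.

Let q0 : 0 < q. Proof. exact: lt_le_trans q_ge. Qed.

Definition copy_edges (x : {ffun W -> V}) : {set {set V}} :=
  [set x @: (e : {set W}) | e in multipartite_edges s].

(** Truncation loses at most r eps = 1/4 of the mass and coincidences at most |W|^2 eta = 1/4. The
    choice of [Q] makes eps Q = 1 / g, a bound for the normalised edge indicator. [K] pays for 2^|W|
    vertex sets [J] and at most |W|^|W| maps from one of them to the vertices of a given family. *)
Let eps : R := (4 * r%:R)^-1.
Let eta : R := (4 * #|W|%:R ^+ 2)^-1.
Let Q : R := (eps * g)^-1.
Let K : R := (2 * #|W|%:R) ^+ #|W|.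

Let W_gt0 : (0 < #|W|)%N. Proof. by apply/card_gt0P; exists (b 0). Qed.
Let eps0 : 0 < eps. Proof. by rewrite invr_gt0 mulr_gt0 // ltr0n. Qed.
Let Q0 : 0 < Q. Proof. by rewrite invr_gt0 mulr_gt0. Qed.

Hypothesis dense : Q ^+ a_r s <= eta * n%:R.

Let g_le1 : g <= 1.
Proof.
apply: (le_trans q_ge); rewrite -(@avg_cst R W V V0 1); apply: le_avg => x.
by rewrite /W0raw; case: (_ \in _).
Qed.

Let Q1 : 1 <= Q.
Proof.
have eg0 : 0 < eps * g by rewrite mulr_gt0.
rewrite /Q invf_ge1 //; apply: mulr_ile1; rewrite ?(ltW eps0) ?(ltW g0) //.
rewrite /eps invf_le1 ?mulr_gt0 ?ltr0n //.
have r1 : (1 : R) <= r%:R by rewrite ler1n.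
lra.
Qed.

(** Resampling started from the normalised indicator of ordered edges. Vertices of different parts
    get different images because some transversal contains both and maps to an edge, which has r
    elements. *)
Lemma balanced_copies : exists w : {ffun W -> V} -> R,
  [/\ forall x, 0 <= w x, 2^-1 <= avg w,
      forall x, w x != 0 -> injective x /\ (copy_edges x \subset G) &
      forall (J : {set W}) y, (forall l, (l < r)%N -> J :&: part tg l != set0) ->
        avg (fun x => w (merge J y x)) <=
        g^-1 * \prod_(l < r) (Q ^+ (\prod_(j < l) cp j)) ^+ #|J :&: part tg l|.-1].
Proof.
have avgW0 : avg (fun x => (fun z => W0raw z / q) (base r b x)) = 1.
  rewrite (eq_avg (g := fun x => q^-1 * W0raw (base r b x))); last by move=> x; rewrite mulrC.
  by rewrite avgZ mulVf // gt_eqF.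
have W0_ge0 z : 0 <= W0raw z / q by rewrite divr_ge0 ?(ltW q0) // /W0raw.
have eQ : eps * Q = g^-1 by rewrite /Q invfM mulrA mulfV ?mul1r // gt_eqF.
have W0_le z : W0raw z / q <= eps * Q.
  rewrite eQ; apply: (@le_trans _ _ q^-1); last by rewrite lef_pV2 ?posrE.
  by rewrite ler_piMl ?invr_ge0 ?(ltW q0) // /W0raw; case: (_ \in _).
have etaP l : (l < r)%N -> Q ^+ exponent tg l <= eta * #|V|%:R.
  move=> lr; rewrite card_ord; apply: le_trans dense; apply: ler_weXn2l => //.
  rewrite -exponent_last /exponent.
  have lr1 : (l <= r.-1)%N by rewrite -ltnS prednK.
  rewrite -!(big_mkord predT cp) (big_cat_nat _ lr1) //= leq_pmulr //.
  rewrite big_nat_cond; apply: prodn_cond_gt0 => j /andP[/andP[_ jr] _].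
  by apply: ltnW; apply: cp2; exact: leq_trans jr (leq_pred _).
have [w [w0 wavg wsupp wmarg]] :=
  balanced_density V0 tg_lt tg_b W0_ge0 eps0 W0_le avgW0 etaP.
exists w; split => //.
- apply: le_trans wavg.
  have -> : r%:R * eps = 4^-1 by rewrite /eps; field; rewrite pnatr_eq0 -lt0n.
  have -> : #|W|%:R ^+ 2 * eta = 4^-1.
    by rewrite /eta; field; rewrite pnatr_eq0 -lt0n.
  lra.
- move=> x /wsupp [dist trans].
  have memG c : (forall l, (l < r)%N -> tg (c l) = l) -> [set x (c i) | i : 'I_r] \in G.
    move=> /trans; rewrite mulf_eq0 negb_or /W0raw => /andP[+ _].
    rewrite (_ : [set base r c x i | i : 'I_r] = [set x (c i) | i : 'I_r]).
      by case: (_ \in G) => //; rewrite eqxx.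
    by apply: eq_imset => i; rewrite ffunE.
  split.
    move=> u u' xuu'; apply/eqP/negPn/negP => uu'.
    have [tuu'|tuu'] := eqVneq (tg u) (tg u').
      by have := dist _ _ uu' tuu'; rewrite xuu' eqxx.
    pose c l := if l == tg u then u else if l == tg u' then u' else b l.
    have tc l : (l < r)%N -> tg (c l) = l.
      move=> lr; rewrite /c; case: eqVneq => [->//|_]; case: eqVneq => [->//|_].
      exact: tg_b.
    have := Gr (memG c tc).
    rewrite -[in RHS](card_ord r) => /eqP/imset_injP inj.
    have : Ordinal (tg_lt u) = Ordinal (tg_lt u').
      apply: inj => //=; rewrite /c eqxx eq_sym (negbTE tuu') eqxx //.
    by move=> /(congr1 val) /= e; rewrite e eqxx in tuu'.
  apply/fintype.subsetP => e /imsetP[e' /multipartite_edgeP[c tc ->] ->].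
  by rewrite -imset_comp; exact: memG.
move=> J y JP; apply: le_trans (wmarg J y JP) _; rewrite eQ.
exact: lexx.
Qed.

Let edge_transversal (e : {set W}) : {ffun 'I_r -> W} :=
  [ffun i : 'I_r => odflt (b 0) [pick u in e | tg u == i]].

Let edge_transversalK (e : {set W}) : e \in multipartite_edges s ->
  [/\ e = [set edge_transversal e i | i : 'I_r],
      forall i, edge_transversal e i \in e & forall i, tg (edge_transversal e i) = i].
Proof.
move=> /multipartite_edgeP[c tc ec].
have fE (i : 'I_r) : edge_transversal e i = c i.
  rewrite ffunE; case: pickP => [u /=|].
    rewrite {1}ec => /andP[/imsetP[j _ ->]]; rewrite tc // => /eqP/val_inj ->.
    by [].
  move=> /(_ (c i)); rewrite tc // eqxx andbT => /negP[].
  by rewrite ec; apply/imsetP; exists i.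
split=> [|i|i]; rewrite ?fE ?tc //; last by rewrite ec; apply/imsetP; exists i.
by rewrite {1}ec; apply: eq_imset => i; rewrite fE.
Qed.

Let card_transversals (A : {set {set W}}) : A \subset multipartite_edges s ->
  (#|A| <= \prod_(i < r) #|cover A :&: part tg i|)%N.
Proof.
move=> /fintype.subsetP AE.
have inj : {in A &, injective edge_transversal}.
  move=> e e' /AE eA /AE e'A ee'.
  have [-> _ _] := edge_transversalK eA; have [-> _ _] := edge_transversalK e'A.
  by rewrite ee'.
rewrite -(card_in_imset inj).
have -> : (\prod_(i < r) #|cover A :&: part tg i|)%N =
    #|family (fun i : 'I_r => mem (cover A :&: part tg i))|.
  by rewrite card_family foldrE big_map big_enum.
apply: subset_leq_card; apply/fintype.subsetP => f /imsetP[e eA ->].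
have [_ h1 h2] := edge_transversalK (AE _ eA).
apply/familyP => i; change (edge_transversal e i \in cover A :&: part tg i).
rewrite !inE h2 eqxx andbT.
by apply/bigcupP; exists e.
Qed.

Variable w : {ffun W -> V} -> R.
Hypothesis w0 : forall x, 0 <= w x.
Hypothesis w_avg : 2^-1 <= avg w.
Hypothesis w_supp : forall x, w x != 0 -> injective x /\ (copy_edges x \subset G).
Hypothesis w_marg : forall (J : {set W}) y,
  (forall l, (l < r)%N -> J :&: part tg l != set0) ->
  avg (fun x => w (merge J y x)) <=
    g^-1 * \prod_(l < r) (Q ^+ (\prod_(j < l) cp j)) ^+ #|J :&: part tg l|.-1.

(** The container hypergraph has the edges of [G] as vertices and the edge sets of copies as
    hyperedges; [w] is pushed forward to it. *)
Definition copy_weight (e : {set {set V}}) : R := avg (fun x => w x * (copy_edges x == e)%:R).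

Lemma deg_copy_weight sg :
  deg copy_weight sg = avg (fun x => w x * (sg \subset copy_edges x)%:R).
Proof.
rewrite /deg /copy_weight -avg_sum; apply: eq_avg => x; rewrite -mulr_sumr; congr (_ * _).
have [h|h] := boolP (sg \subset copy_edges x).
  rewrite (bigD1 (copy_edges x)) //= eqxx big1 ?addr0 // => e /andP[_ ne].
  by rewrite eq_sym (negbTE ne).
by rewrite big1 // => e he; case: eqP => // ee; rewrite ee he in h.
Qed.

Lemma copy_weight_supp e : copy_weight e != 0 -> exists2 x, w x != 0 & copy_edges x = e.
Proof.
move=> h; have [/existsP[x /andP[wx /eqP xe]]|/existsPn nex] :=
    boolP [exists x, (w x != 0) && (copy_edges x == e)]; first by exists x.
move: h; rewrite /copy_weight (eq_avg (g := fun=> 0)) ?avg_cst ?eqxx // => x.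
have := nex x; rewrite negb_and negbK => /orP[/eqP ->|/negbTE ->].
  by rewrite mul0r.
by rewrite mulr0.
Qed.

(** Take for [J] the vertices of the edges mapped into [sg]. At most 2^|W| sets [J] occur, so a
    codegree can be bounded by a union over them. *)
Lemma codegree_shape x (sg : {set {set V}}) : w x != 0 -> sg != set0 ->
  sg \subset copy_edges x ->
  (#|cover sg| <= #|W|)%N /\
  exists J : {set W}, [&& [forall u in J, x u \in cover sg],
    [forall i : 'I_r, J :&: part tg i != set0] &
    (#|sg| <= \prod_(i < r) #|J :&: part tg i|)%N].
Proof.
move=> /w_supp[xinj _] sg0 /fintype.subsetP sx; split.
  rewrite -[X in (_ <= X)%N]cardsT.
  apply: leq_trans _ (leq_imset_card x [set: W]).
  apply: subset_leq_card; apply/fintype.subsetP => v /bigcupP[e /sx /imsetP[f _ ->]].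
  by move=> /imsetP[u _ ->]; apply/imsetP; exists u; rewrite ?inE.
pose A := [set e in multipartite_edges s | x @: (e : {set W}) \in sg].
have AsubE : A \subset multipartite_edges s.
  by apply/fintype.subsetP => e; rewrite inE => /andP[].
have imA : [set x @: (e : {set W}) | e in A] = sg.
  apply/setP => f; apply/imsetP/idP => [[e + ->]|fsg]; first by rewrite inE => /andP[].
  have /imsetP[e eE fe] := sx _ fsg; exists e => //.
  by rewrite inE eE -fe.
have cA : (#|sg| <= #|A|)%N by rewrite -imA leq_imset_card.
have A0 : A != set0 by apply: contraNneq sg0 => A0; rewrite -imA A0 imset0.
exists (cover A); apply/and3P; split.
- apply/forall_inP => u /bigcupP[e]; rewrite inE => /andP[_ eA] ue.
  by apply/bigcupP; exists (x @: (e : {set W})) => //; apply/imsetP; exists u.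
- apply/forallP => i; have [e eA] := set0Pn _ A0.
  have [_ h1 h2] := edge_transversalK (fintype.subsetP AsubE _ eA).
  apply/set0Pn; exists (edge_transversal e i).
  by rewrite !inE h2 eqxx andbT; apply/bigcupP; exists e.
exact: leq_trans cA (card_transversals AsubE).
Qed.

Variable ell : R.
Hypothesis ell0 : 0 <= ell.
Hypothesis ell_last : ell <= ln n%:R - (a_r s)%:R * ln Q.
Hypothesis ell_full :
  ((a_r1 s)%:R - 1) * (ell + ln Q) <= (\sum_(i < r) (s i)%:R - r%:R) * ln n%:R.

(** For fixed [J], its vertices must land in [cover sg]. One vertex per part gives n^(-r), which
    with the factor 1 / g of the marginal makes 1 / N; the others give the product bounded in
    [codegree_exponents]. *)
Lemma balanced_codegree (sg : {set {set V}}) : sg != set0 ->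
  deg copy_weight sg <= K * expR (- ell) ^+ #|sg|.-1 / N.
Proof.
move=> sg0; rewrite deg_copy_weight.
have K_ge0 : 0 <= K * expR (- ell) ^+ #|sg|.-1 / N.
  by rewrite divr_ge0 ?(ltW N0) // mulr_ge0 ?exprn_ge0 ?expR_ge0 // mulr_ge0.
have [/existsP[x0 /andP[wx0 sx0]]|/existsPn nex] :=
    boolP [exists x, (w x != 0) && (sg \subset copy_edges x)]; last first.
  rewrite (eq_avg (g := fun=> 0)) ?avg_cst // => x.
  have := nex x; rewrite negb_and negbK => /orP[/eqP ->|/negbTE ->].
    by rewrite mul0r.
  by rewrite mulr0.
have [cU _] := codegree_shape wx0 sg0 sx0.
pose JJ (J : {set W}) := [forall i : 'I_r, J :&: part tg i != set0] &&
    (#|sg| <= \prod_(i < r) #|J :&: part tg i|)%N.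
have le1 : avg (fun x => w x * (sg \subset copy_edges x)%:R) <=
    avg (fun x => \sum_(J | JJ J) w x * \prod_(u in J) (x u \in cover sg)%:R).
  apply: le_avg => x; have term_ge0 J : 0 <= w x * \prod_(u in J) (x u \in cover sg)%:R.
    by rewrite mulr_ge0 // prodr_ge0.
  have [wx|wx] := eqVneq (w x) 0; first by rewrite wx mul0r sumr_ge0 // => J _; rewrite mul0r.
  have [sx|_] := boolP (sg \subset copy_edges x); last by rewrite mulr0 sumr_ge0.
  have [_ [J /andP[/forall_inP J1 J2]]] := codegree_shape wx sg0 sx.
  rewrite (bigD1 J) //= big1 ?mulr1; last by move=> u uJ; rewrite J1.
  by rewrite lerDl sumr_ge0.
apply: (le_trans le1); rewrite avg_sum.
have bnd J : JJ J -> avg (fun x => w x * \prod_(u in J) (x u \in cover sg)%:R) <=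
    #|W|%:R ^+ #|W| * (expR (- ell) ^+ #|sg|.-1 / N).
  move=> /andP[/forallP J1 J2].
  have J1' l : (l < r)%N -> J :&: part tg l != set0 by move=> lr; exact: J1 (Ordinal lr).
  rewrite (avg_merge V0 J).
  set M := g^-1 * \prod_(l < r) (Q ^+ (\prod_(j < l) cp j)) ^+ #|J :&: part tg l|.-1.
  have Q0' := Q0.
  have M0 : 0 <= M.
    rewrite mulr_ge0 ?invr_ge0 ?(ltW g0) // prodr_ge0 // => l _.
    by apply: exprn_ge0; apply: exprn_ge0; exact: ltW.
  apply: (@le_trans _ _ (avg (fun y => M * \prod_(u in J) (y u \in cover sg)%:R))).
    apply: le_avg => y.
    rewrite (eq_avg (g := fun x => (\prod_(u in J) (y u \in cover sg)%:R) * w (merge J y x))).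
      rewrite avgZ mulrC; apply: ler_wpM2r; first by rewrite prodr_ge0.
      exact: w_marg.
    move=> x; rewrite mulrC; congr (_ * _); apply: eq_bigr => u uJ.
    by rewrite ffunE uJ.
  rewrite avgZ.
  rewrite (eq_avg (g := fun y => 1 * \prod_(u in J) (y u \in cover sg)%:R)); last first.
    by move=> y; rewrite mul1r.
  rewrite (avg_prod V0 (g := fun=> 1) (h := fun _ _ v => (v \in cover sg)%:R)) //.
  rewrite (eq_avg (g := fun=> (#|cover sg|%:R / n%:R) ^+ #|J|)); last first.
    move=> y; rewrite mul1r (eq_bigr (fun=> #|cover sg|%:R / n%:R)) ?prodr_const // => u _.
    rewrite /mean card_ord; congr (_ / _); rewrite -sum1_card natr_sum [RHS]big_mkcond.
    by apply: eq_bigr => v _; case: (_ \in _).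
  rewrite avg_cst // expr_div_n mulrCA.
  have cJ : #|J| = (r + \sum_(l < r) #|J :&: part tg l|.-1)%N.
    rewrite -sum1_card (partition_big (fun u : W => tag u) predT) //=.
    transitivity (\sum_(l < r) (1 + #|J :&: part tg l|.-1))%N; last first.
      by rewrite big_split /= sum1_card card_ord.
    apply: eq_bigr => l _.
    rewrite add1n prednK ?card_gt0 ?J1 // sum1dep_card; apply: eq_card => u.
    by rewrite !inE /tg -val_eqE.
  have le2 : (#|cover sg|%:R : R) ^+ #|J| <= #|W|%:R ^+ #|W|.
    apply: (@le_trans _ _ (#|W|%:R ^+ #|J|)).
      by apply: lerXn2r; rewrite ?nnegrE // ler_nat.
    apply: ler_weXn2l; last by rewrite max_card.
    by rewrite ler1n.
  apply: ler_pM => //; first by rewrite mulr_ge0 // invr_ge0 exprn_ge0.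
  have -> : M * n%:R ^- #|J| = N^-1 *
      \prod_(l < r) (Q ^+ (\prod_(i < l) cp i) / n%:R) ^+ #|J :&: part tg l|.-1.
    have -> : \prod_(l < r) (Q ^+ (\prod_(i < l) cp i) / n%:R) ^+ #|J :&: part tg l|.-1 =
        (\prod_(l < r) (Q ^+ (\prod_(i < l) cp i)) ^+ #|J :&: part tg l|.-1) *
        n%:R ^- (\sum_(l < r) #|J :&: part tg l|.-1).
      rewrite -exprVn expr_sum -big_split /=; apply: eq_bigr => l _.
      by rewrite exprMn.
    rewrite cJ exprD invfM /M /g invfM invrK.
    have nr : (n%:R : R) ^+ r != 0 by rewrite expf_neq0 // gt_eqF.
    set A := \prod_(l < r) _; set B := n%:R ^- (\sum_(l < r) _).
    by field; rewrite nr gt_eqF.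
  rewrite mulrC; apply: ler_wpM2r; first by rewrite invr_ge0 ltW.
  apply: (codegree_exponents (s := cp) (t := fun l => #|J :&: part tg l|)) => //.
  - move=> l lr; rewrite card_gt0 J1' //=.
    by rewrite subset_leq_card // subsetIr.
  - by rewrite exponent_last.
  - rewrite exponentE; have -> : \sum_(l < r) (cp l)%:R = \sum_(i < r) (s i)%:R :> R.
      by apply: eq_bigr => l _; rewrite /cp card_part.
    exact: ell_full.
apply: le_trans (_ : \sum_(J | JJ J) #|W|%:R ^+ #|W| * (expR (- ell) ^+ #|sg|.-1 / N) <= _).
  exact: ler_sum.
rewrite sumr_const -[leLHS]mulr_natl /K exprMn -!mulrA.
have tau_ge0 : 0 <= expR (- ell) ^+ #|sg|.-1 / N.
  by rewrite divr_ge0 ?(ltW N0) // exprn_ge0 ?expR_ge0.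
apply: ler_wpM2r; first by rewrite mulr_ge0 ?exprn_ge0.
rewrite -natrX ler_nat -cardsT -card_powerset; apply: subset_leq_card.
by apply/fintype.subsetP => J _; rewrite inE subsetT.
Qed.

Lemma copy_containers (k B : nat) (delta : R) : #|multipartite_edges s| = k ->
  (forall (tau N : R) (w : {set {set V}} -> R) (U : {set {set V}}) (B : nat),
    0 < tau -> 0 < N -> #|U|%:R <= N -> (forall e, 0 <= w e) ->
    (forall e, w e != 0 -> (#|e| == k) && (e \subset U)) -> 2^-1 <= deg w set0 ->
    (forall sg, sg != set0 -> deg w sg <= K * tau ^+ #|sg|.-1 / N) ->
    tau * N <= B%:R <= tau * N + 1 ->
    has_containers (indep w) U (k * B) ((1 - delta) * N)) ->
  expR (- ell) * N <= B%:R <= expR (- ell) * N + 1 ->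
  has_containers (fun I => ~~ contains_copy (complete_multipartite s) I) G (k * B)
    ((1 - delta) * N).
Proof.
move=> kE cont hB.
have wt_ge0 e : 0 <= copy_weight e by apply: avg_ge0 => x; rewrite mulr_ge0.
apply: has_containers_mono (leqnn _) (lexx _) (cont _ _ copy_weight G B _ _ _ wt_ge0 _ _ _ hB).
- move=> I free e /copy_weight_supp[x wx xe]; apply: contra free => eI.
  have [xinj _] := w_supp wx; apply/existsP; exists x; apply/andP; split.
    exact/injectiveP.
  apply/forall_inP => f fE; apply: (fintype.subsetP eI); rewrite -xe.
  by apply/imsetP; exists f.
- exact: expR_gt0.
- exact: N0.
- by [].
- move=> e /copy_weight_supp[x wx <-]; have [xinj ->] := w_supp wx.
  by rewrite andbT card_imset ?kE //; exact: imset_inj.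
- rewrite deg_copy_weight (eq_avg (g := w)) // => x; by rewrite sub0set mulr1.
- exact: balanced_codegree.
Qed.

End Balanced.
End MultipartiteContainers.

(** * Arithmetic of the exponents beta1 and beta2 *)

Section ExponentArithmetic.
Variables (R : realType) (r : nat) (s : 'I_r -> nat).
Hypothesis hr : (2 <= r)%N.
Hypothesis hs : forall i, (2 <= s i)%N.

Let r_gt0 : (0 < r)%N := ltnW hr.
Let last : 'I_r := Ordinal (eq_leq (prednK r_gt0)).

Let not_last (i : 'I_r) : (i != last) = (i.+1 < r)%N.
Proof.
rewrite -val_eqE /= -ltn_predRL ltn_neqAle andbC.
by rewrite -ltnS prednK // ltn_ord.
Qed.

Lemma a_r1E : a_r1 s = (a_r s * s last)%N.
Proof.
by rewrite /a_r1 (bigD1 last) //= mulnC /a_r (eq_bigl _ _ not_last).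
Qed.

Let sum_init := (\sum_(i < r | (i.+1 < r)%N) s i)%N.

Let sumE : (\sum_i s i = sum_init + s last)%N.
Proof. by rewrite (bigD1 last) //= addnC /sum_init (eq_bigl _ _ not_last). Qed.

Let sum_init_ge : (2 * r.-1 <= sum_init)%N.
Proof.
have -> : (2 * r.-1 = \sum_(i < r | (i.+1 < r)%N) 2)%N.
  rewrite sum_nat_const mulnC; congr (_ * _)%N.
  rewrite -(eq_card (A := predC1 last)); last by move=> i; rewrite !inE not_last.
  by rewrite cardC1 card_ord.
by apply: leq_sum.
Qed.

Let a_bernoulli : (sum_init < a_r s + r.-1)%N.
Proof.
rewrite /sum_init /a_r -(eq_bigl _ _ not_last) -[X in (_ < X + _)%N](eq_bigl _ _ not_last).
have -> : r.-1 = (\sum_(i < r | i != last) 1)%N.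
  by rewrite sum1_card cardC1 card_ord.
apply: (@proj1 _ (0 < \prod_(i | i != last) s i)%N).
elim/big_rec3: _ => [|i x y z _ [IH x0]] //.
by have := hs i; split; nia.
Qed.

Lemma a_r_ge2 : (2 <= a_r s)%N.
Proof. have := a_bernoulli; have := sum_init_ge; lia. Qed.

Lemma sum_ge : (2 * r <= \sum_i s i)%N.
Proof. have := sum_init_ge; have := hs last; rewrite sumE; have := r_gt0; lia. Qed.

Lemma sum_lt_prod : (\sum_i s i < a_r1 s + r.-1)%N.
Proof.
rewrite sumE a_r1E; have := a_bernoulli; have := a_r_ge2; have := hs last.
have := sum_init_ge; have := r_gt0; nia.
Qed.

Lemma a_r1_ge : (4 <= a_r1 s)%N.
Proof. rewrite a_r1E; have := a_r_ge2; have := hs last; nia. Qed.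

Lemma a_r_sum : (a_r1 s + a_r s * r <= a_r s * \sum_i s i + 1)%N.
Proof.
rewrite sumE a_r1E; have := sum_init_ge; have := r_gt0; have := hr; nia.
Qed.

Let a : R := (a_r s)%:R.
Let b1 : R := beta1 s R.
Let b2 : R := beta2 s R.

Lemma a_r1B1_gt0 : 0 < (a_r1 s)%:R - 1 :> R.
Proof. by rewrite subr_gt0 ltr1n (leq_trans _ a_r1_ge). Qed.

Let a2 : 2 <= a. Proof. by rewrite ler_nat a_r_ge2. Qed.

(** Equivalently, p^(a_(r+1)) n^(sum s_i) = p n^r at p = n^(-beta1): copies and edges are equally
    numerous up to constants. *)
Lemma beta1E : b1 * ((a_r1 s)%:R - 1) = \sum_(i < r) (s i)%:R - r%:R.
Proof. by rewrite /b1 /beta1 divfK // gt_eqF ?a_r1B1_gt0. Qed.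

Lemma beta1_lt1 : b1 < 1.
Proof.
rewrite /b1 /beta1 ltr_pdivrMr ?a_r1B1_gt0 // mul1r.
have := sum_lt_prod; rewrite -(ltr_nat R) natrD natr_sum.
have -> : (r.-1)%:R = r%:R - 1 :> R by rewrite -[in RHS](prednK r_gt0) -natr1; ring.
lra.
Qed.

(** Makes Q^a <= n imply Q <= n^beta1, so that the container scale exp (- ell) is at most 1. *)
Lemma a_beta1 : 1 <= a * b1.
Proof.
rewrite /b1 /beta1 mulrA ler_pdivlMr ?a_r1B1_gt0 // mul1r.
by have := a_r_sum; rewrite -(ler_nat R) !natrD !natrM natr_sum -/a; lra.
Qed.

(** Equivalently, p^(1-1/a) n^(r-1/a) = n^(r-beta1) at p = n^(-beta2). *)
Lemma beta2E : (a - 1) * b2 = a * b1 - 1.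
Proof.
have a1 : a - 1 != 0 by apply/eqP; have := a2; lra.
have k1 : (a_r1 s)%:R - 1 != 0 :> R by rewrite gt_eqF // a_r1B1_gt0.
rewrite /b2 /beta2 /b1 /beta1 -/a.
have -> : \sum_(i < r) (s i)%:R = \sum_(i < r | (i.+1 < r)%N) (s i)%:R + (s last)%:R :> R.
  by rewrite -!natr_sum -natrD -sumE.
move: k1; rewrite a_r1E natrM -/a => k1; field.
by rewrite a1 k1.
Qed.

Lemma beta2_gt0 : 0 < b2.
Proof.
have a1 := a2; have s1 : (r%:R : R) <= \sum_(i < r | (i.+1 < r)%N) (s i)%:R.
  rewrite -natr_sum ler_nat; have := sum_init_ge; have := hr; rewrite -/sum_init; lia.
have k1 := a_r1B1_gt0.
rewrite /b2 /beta2 -/a; apply: divr_gt0; last by apply: mulr_gt0 => //; lra.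
nra.
Qed.

Lemma beta2_le_beta1 : b2 <= b1.
Proof. have := beta2E; have := beta1_lt1; have := a2; nra. Qed.

End ExponentArithmetic.

(** * Containers for hypergraphs without a complete multipartite subgraph *)

Section ContainerTheorem.
Variables (R : realType) (r : nat) (s : 'I_r -> nat).
Hypothesis hr : (2 <= r)%N.
Hypothesis hs : forall i, (2 <= s i)%N.

(** The scale tau = exp (- ell) is the smallest one allowed by both codegree constraints; its two
    candidates, times |G|, give the two terms of the fingerprint bound. The density hypothesis is
    Q^a <= eta n written out. *)
Lemma multipartite_containers : exists delta kappa C : R,
  [/\ 0 < delta < 1, 0 < kappa, 0 < C &
   forall (n : nat) (G : {set {set 'I_n}}), (0 < n)%N ->
     (forall e, e \in G -> #|e| = r) -> (0 < #|G|)%N ->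
     n%:R ^+ (r * a_r s) <= kappa * (n%:R * #|G|%:R ^+ a_r s) ->
     exists2 b : nat,
       b%:R <= C * (n%:R `^ (r%:R - beta1 s R) +
                    n%:R ^+ (r * a_r s) / (n%:R * #|G|%:R ^+ (a_r s).-1)) &
       has_containers (fun I => ~~ contains_copy (complete_multipartite s) I) G b
         ((1 - delta) * #|G|%:R)].
Proof.
set a := a_r s; set b1 := beta1 s R.
have r0 : (0 < r)%N := ltnW hr.
pose W : finType := part_vertex s.
have W0 : (0 < #|W|)%N.
  have i0 : 'I_r := Ordinal r0.
  by apply/card_gt0P; exists (Tagged (fun i => 'I_(s i)) (Ordinal (ltnW (hs i0)))).
pose eps : R := (4 * r%:R)^-1.
pose eta : R := (4 * #|W|%:R ^+ 2)^-1.
pose K : R := (2 * #|W|%:R) ^+ #|W|.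
have rR : 1 <= r%:R :> R by rewrite ler1n.
have WR : 1 <= #|W|%:R :> R by rewrite ler1n.
have eps0 : 0 < eps by rewrite invr_gt0; lra.
have eta0 : 0 < eta by rewrite invr_gt0 mulr_gt0 // exprn_gt0; lra.
have eta1 : eta <= 1.
  rewrite /eta invf_le1; last by rewrite mulr_gt0 // exprn_gt0; lra.
  have h : 1 <= #|W|%:R ^+ 2 :> R by rewrite exprn_ege1.
  lra.
have K0 : 0 < K by rewrite exprn_gt0 // mulr_gt0 // ltr0n.
pose k := #|multipartite_edges s|.
have half0 : 0 < 2^-1 :> R by rewrite invr_gt0.
have [delta d01 cont] := container k K0 half0.
have a0 : (0 < a)%N := ltnW (a_r_ge2 hr hs).
exists delta, (eta * eps ^+ a), (k%:R * (eps^-1 + 1 + eps ^- a) + 1).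
have eps1 : 0 <= eps^-1 by rewrite invr_ge0 ltW.
have epsa : 0 <= eps ^- a by rewrite invr_ge0 exprn_ge0 // ltW.
split => //.
- by rewrite mulr_gt0 // exprn_gt0.
- have : 0 <= k%:R * (eps^-1 + 1 + eps ^- a) by rewrite mulr_ge0 //; lra.
  lra.
move=> n G n0 Gr G0 dense.
set N : R := #|G|%:R.
have N0 : 0 < N by rewrite ltr0n.
have nR : 0 < n%:R :> R by rewrite ltr0n.
have n1 : 1 <= n%:R :> R by rewrite ler1n.
pose g : R := N / n%:R ^+ r.
have g0 : 0 < g by rewrite divr_gt0 // exprn_gt0.
pose Q : R := (eps * g)^-1.
have Q0 : 0 < Q by rewrite invr_gt0 mulr_gt0.
have QE : Q = n%:R ^+ r / (eps * N).
  by rewrite /Q /g; field; rewrite !gt_eqF ?exprn_gt0.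
have Qa : Q ^+ a <= eta * n%:R.
  rewrite QE expr_div_n -exprM exprMn ler_pdivrMr ?mulr_gt0 ?exprn_gt0 //.
  apply: le_trans dense _; rewrite le_eqVlt; apply/orP; left; apply/eqP.
  by rewrite -/N; ring.
have lnn : 0 <= ln (n%:R : R) by rewrite ln_ge0.
have lnQa : a%:R * ln Q <= ln (n%:R : R).
  have -> : a%:R * ln Q = ln (Q ^+ a) by rewrite lnXn // mulr_natl.
  rewrite ler_ln ?posrE ?exprn_gt0 //; apply: le_trans Qa _.
  by rewrite ler_piMl // ltW.
pose ell : R := Num.min (b1 * ln n%:R - ln Q) (ln n%:R - a%:R * ln Q).
have aR : 2 <= a%:R :> R by rewrite ler_nat a_r_ge2.
have ab1 : 1 <= a%:R * b1 := a_beta1 R hr hs.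
have ell0 : 0 <= ell.
  rewrite le_min; apply/andP; split; last by lra.
  have : a%:R * ln Q <= a%:R * (b1 * ln n%:R) by nra.
  by rewrite ler_pM2l ?subr_ge0 //; lra.
have ell_last : ell <= ln n%:R - a%:R * ln Q by rewrite ge_min lexx orbT.
have ell_full : ((a_r1 s)%:R - 1) * (ell + ln Q) <= (\sum_(i < r) (s i)%:R - r%:R) * ln n%:R.
  rewrite -(beta1E R hr hs) -/b1 [b1 * _]mulrC -mulrA; apply: ler_wpM2l.
    by rewrite ltW // a_r1B1_gt0.
  have : ell <= b1 * ln n%:R - ln Q by rewrite ge_min lexx.
  lra.
have tau0 := expR_gt0 (- ell).
have tauN0 : 0 <= expR (- ell) * N by rewrite mulr_ge0 // ltW.
pose B := (Num.truncn (expR (- ell) * N)).+1.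
have [B1 B2] : expR (- ell) * N <= B%:R /\ B%:R <= expR (- ell) * N + 1.
  have /andP[h1 h2] := truncn_itv tauN0; split; first exact: ltW.
  by rewrite /B -natr1; lra.
have [w [w0 wavg wsupp wmarg]] := balanced_copies hr hs n0 Gr G0 Qa.
exists (k * B)%N; last first.
  have Bb := introT andP (conj B1 B2).
  exact (copy_containers hr hs n0 Gr G0 w0 wavg wsupp wmarg ell0 ell_last ell_full
    erefl (cont {set 'I_n}) Bb).
have tauE : expR (- ell) <= Q * n%:R `^ (- b1) + Q ^+ a / n%:R.
  have e1 : expR (ln Q - b1 * ln n%:R) = Q * n%:R `^ (- b1).
    by rewrite expRD lnK ?posrE // /powR (gt_eqF nR) mulNr.
  have e2 : expR (a%:R * ln Q - ln n%:R) = Q ^+ a / n%:R.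
    have -> : a%:R * ln Q = ln (Q ^+ a) by rewrite lnXn // mulr_natl.
    by rewrite expRD expRN !lnK ?posrE ?exprn_gt0.
  rewrite -e1 -e2 /ell.
  have [_|_] := leP (b1 * ln n%:R - ln Q) (ln n%:R - a%:R * ln Q); rewrite opprB.
    by rewrite lerDl expR_ge0.
  by rewrite lerDr expR_ge0.
have NX1 : N * (Q * n%:R `^ (- b1)) = eps^-1 * n%:R `^ (r%:R - b1).
  rewrite powRD; last by rewrite (gt_eqF nR) implybT.
  rewrite powR_mulrn ?(ltW nR) // QE; field.
  by rewrite !gt_eqF.
have NX2 : N * (Q ^+ a / n%:R) =
    eps ^- a * (n%:R ^+ (r * a) / (n%:R * N ^+ a.-1)).
  rewrite QE expr_div_n -exprM exprMn.
  have -> : N ^+ a = N * N ^+ a.-1 by rewrite -exprS prednK.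
  by field; rewrite !gt_eqF ?exprn_gt0.
have b1r : b1 <= r%:R by have := beta1_lt1 R hr hs; rewrite -/b1; lra.
have X1 : 1 <= n%:R `^ (r%:R - b1) :> R.
  by rewrite -[leLHS](powRr0 n%:R); apply: ler_powR => //; lra.
set X := n%:R `^ (r%:R - b1) in NX1 X1 *.
set Y := n%:R ^+ (r * a) / (n%:R * N ^+ a.-1) in NX2 *.
have Y0 : 0 <= Y by rewrite divr_ge0 ?exprn_ge0 ?mulr_ge0 ?exprn_ge0 // ltW.
have Bb : B%:R <= (eps^-1 + 1 + eps ^- a) * (X + Y).
  apply: (le_trans B2).
  have : expR (- ell) * N <= eps^-1 * X + eps ^- a * Y.
    by rewrite -NX1 -NX2 -mulrDr mulrC; apply: ler_wpM2l => //; exact: ltW.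
  have : 0 <= eps^-1 * Y by rewrite mulr_ge0.
  have : 0 <= eps ^- a * X by rewrite mulr_ge0 //; lra.
  lra.
rewrite natrM; apply: (@le_trans _ _ (k%:R * ((eps^-1 + 1 + eps ^- a) * (X + Y)))).
  exact: ler_wpM2l.
by rewrite mulrA; apply: ler_wpM2r; lra.
Qed.
End ContainerTheorem.

(** * Random subsets *)

Section BernoulliSubset.
Variables (R : realType) (T : finType).
Implicit Types (D H S : {set T}) (p t : R) (f g : {set T} -> R) (e : T).

Definition bern D p H : R := \prod_(e in D) (if e \in H then p else 1 - p).
Definition bern_mean D p f : R := \sum_(H : {set T} | H \subset D) bern D p H * f H.

Lemma eq_bern_mean D p f g : (forall H, H \subset D -> f H = g H) ->
  bern_mean D p f = bern_mean D p g.
Proof. by move=> fg; apply: eq_bigr => H HD; rewrite fg. Qed.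

Lemma bern_mean0 p f : bern_mean set0 p f = f set0.
Proof.
rewrite /bern_mean (big_pred1 set0) => [|H]; last by rewrite subset0.
by rewrite /bern big_set0 mul1r.
Qed.

Lemma bern_meanU1 D p f e : e \notin D ->
  bern_mean (e |: D) p f =
  p * bern_mean D p (fun H => f (e |: H)) + (1 - p) * bern_mean D p f.
Proof.
move=> eD; rewrite /bern_mean (bigID (fun H : {set T} => e \in H)) /=.
have bernU H : bern (e |: D) p H = (if e \in H then p else 1 - p) * bern D p H.
  by rewrite /bern big_setU1.
congr (_ + _); rewrite mulr_sumr.
  rewrite (reindex_onto (fun H => e |: H) (fun H => H :\ e)) /=; last first.
    by move=> H /andP[_ eH]; rewrite setD1K.
  apply: eq_big => H; last first.
    move=> _; rewrite bernU setU11 -mulrA; congr (_ * (_ * _)).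
    apply: eq_bigr => e' e'D; rewrite !inE.
    by case: eqP => // ee'; rewrite -ee' e'D in eD.
  rewrite setU11 andbT subUset sub1set setU11 /=.
  apply/andP/idP => [[/fintype.subsetP HD /eqP eH]|HD].
    apply/fintype.subsetP => z zH; have := HD z zH; rewrite !inE => /predU1P[ze|//].
    by move: zH; rewrite -eH ze !inE eqxx.
  split; first by apply: subset_trans HD (subsetUr _ _).
  by rewrite setU1K //; apply: contra eD; exact: (fintype.subsetP HD).
apply: eq_big => H; last by move=> /andP[_ /negbTE eH]; rewrite bernU eH mulrA.
apply/andP/idP => [[/fintype.subsetP HD eH]|HD].
  apply/fintype.subsetP => z zH; have := HD z zH; rewrite !inE => /predU1P[ze|//].
  by rewrite -ze zH in eH.
split; first by apply: subset_trans HD (subsetUr _ _).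
by apply: contra eD; exact: (fintype.subsetP HD).
Qed.

Lemma bern_meanD D p f g :
  bern_mean D p (fun H => f H + g H) = bern_mean D p f + bern_mean D p g.
Proof. by rewrite /bern_mean -big_split; apply: eq_bigr => H _; rewrite mulrDr. Qed.

Lemma bern_meanZ D p (c : R) f : bern_mean D p (fun H => c * f H) = c * bern_mean D p f.
Proof. by rewrite /bern_mean mulr_sumr; apply: eq_bigr => H _; rewrite mulrCA. Qed.

Lemma bern_mean_sum D p (I : finType) (P : pred I) (F : I -> {set T} -> R) :
  bern_mean D p (fun H => \sum_(i | P i) F i H) = \sum_(i | P i) bern_mean D p (F i).
Proof.
by rewrite /bern_mean exchange_big; apply: eq_bigr => H _; rewrite mulr_sumr.
Qed.

Lemma set_ind (P : {set T} -> Prop) :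
  P set0 -> (forall D e, e \notin D -> P D -> P (e |: D)) -> forall D, P D.
Proof.
move=> P0 PU D; have [m] := ubnP #|D|; elim: m D => // m IH D Dm.
have [->//|[e eD]] := set_0Vmem D.
rewrite -(setD1K eD); apply: PU; first by rewrite !inE eqxx.
by apply: IH; move: Dm; rewrite (cardsD1 e) eD.
Qed.

Lemma bern_mean_cst D p (c : R) : bern_mean D p (fun=> c) = c.
Proof.
elim/set_ind: D => [|D e eD IH]; first by rewrite bern_mean0.
by rewrite bern_meanU1 // IH; ring.
Qed.

Lemma bern_mean_superset D p S : S \subset D ->
  bern_mean D p (fun H => (S \subset H)%:R) = p ^+ #|S|.
Proof.
elim/set_ind: D S => [|D e eD IH] S SD.
  by move: SD; rewrite subset0 => /eqP ->; rewrite bern_mean0 sub0set cards0.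
rewrite bern_meanU1 //.
have [eS|eS] := boolP (e \in S).
  have SD' : S :\ e \subset D.
    apply/fintype.subsetP => z; rewrite !inE => /andP[ze zS].
    by have := fintype.subsetP SD z zS; rewrite !inE (negbTE ze).
  rewrite (@eq_bern_mean _ p _ (fun H => (S :\ e \subset H)%:R)); last first.
    move=> H _; congr (_%:R); congr nat_of_bool.
    apply/idP/idP => /fintype.subsetP h; apply/fintype.subsetP => z.
      by rewrite !inE => /andP[/negbTE ze zS]; have := h z zS; rewrite !inE ze.
    move=> zS; rewrite !inE; case: eqP => //= /eqP ze.
    by apply: h; rewrite !inE ze.
  rewrite IH // [X in _ + _ * X](@eq_bern_mean _ p _ (fun=> 0)); last first.
    move=> H HD; rewrite (_ : (S \subset H) = false) //; apply/negbTE/negP => /fintype.subsetP h.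
    by move: eD; rewrite (fintype.subsetP HD) ?h.
  by rewrite bern_mean_cst mulr0 addr0 -exprS (cardsD1 e S) eS.
have SD' : S \subset D.
  apply/fintype.subsetP => z zS; have := fintype.subsetP SD z zS; rewrite !inE.
  by case/predU1P=> // ze; rewrite -ze zS in eS.
rewrite (@eq_bern_mean _ p _ (fun H => (S \subset H)%:R)); last first.
  move=> H _; congr (_%:R); congr nat_of_bool.
  apply/idP/idP => /fintype.subsetP h; apply/fintype.subsetP => z zS; last first.
    by rewrite !inE h ?orbT.
  have := h z zS; rewrite !inE; case/predU1P=> // ze; by rewrite -ze zS in eS.
rewrite IH //; ring.
Qed.

Lemma bern_mean_card D p : bern_mean D p (fun H => #|H|%:R) = p * #|D|%:R.
Proof.
rewrite (@eq_bern_mean _ p _ (fun H => \sum_(e in D) ([set e] \subset H)%:R)); last first.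
  move=> H HD; rewrite -sum1_card natr_sum big_mkcond [RHS]big_mkcond.
  apply: eq_bigr => e _; rewrite sub1set.
  have [eH|eH] := boolP (e \in H); first by rewrite (fintype.subsetP HD).
  by case: ifP.
rewrite bern_mean_sum (eq_bigr (fun=> p)); first by rewrite sumr_const mulr_natr.
by move=> e eD; rewrite bern_mean_superset ?sub1set // cards1.
Qed.

Section Probability.
Variable p : R.
Hypothesis p01 : 0 <= p <= 1.

Let p0 : 0 <= p. Proof. by case/andP: p01. Qed.
Let p1 : 0 <= 1 - p. Proof. by rewrite subr_ge0; case/andP: p01. Qed.

Lemma bern_ge0 D H : 0 <= bern D p H.
Proof. by apply: prodr_ge0 => e _; case: ifP. Qed.

Lemma le_bern_mean D f g : (forall H, H \subset D -> f H <= g H) ->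
  bern_mean D p f <= bern_mean D p g.
Proof. by move=> fg; apply: ler_sum => H HD; rewrite ler_wpM2l ?bern_ge0 ?fg. Qed.

Definition lipschitz1 D f := forall e H, e \in D -> H \subset D ->
  f H <= f (e |: H) <= f H + 1.

(** Reveal one element e: the conditional means A and B differ by at most 1, so e adds p (1 - p) (A
    - B)^2 <= p to the variance. *)
Lemma bern_variance D f : lipschitz1 D f ->
  bern_mean D p (fun H => f H ^+ 2) <= bern_mean D p f ^+ 2 + #|D|%:R * p.
Proof.
elim/set_ind: D f => [|D e eD IH] f lip.
  by rewrite !bern_mean0 cards0 mul0r addr0.
have DD : D \subset e |: D := subsetUr _ _.
have lip0 : lipschitz1 D f.
  move=> e' H e'D HD; apply: lip; last exact: subset_trans HD DD.
  exact: (fintype.subsetP DD).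
have lip1 : lipschitz1 D (fun H => f (e |: H)).
  move=> e' H e'D HD; rewrite setUCA; apply: lip; first exact: (fintype.subsetP DD).
  by apply: setUS.
rewrite !bern_meanU1 // cardsU1 eD natrD.
have := IH _ lip0; have := IH _ lip1.
set A := bern_mean D p (fun H => f (e |: H)); set B := bern_mean D p f.
have AB : B <= A.
  by apply: le_bern_mean => H HD; have /andP[] := lip e H (setU11 _ _) (subset_trans HD DD).
have AB1 : A <= B + 1.
  rewrite -[X in _ <= _ + X](bern_mean_cst D p 1) -bern_meanD.
  by apply: le_bern_mean => H HD; have /andP[] := lip e H (setU11 _ _) (subset_trans HD DD).
have p0' := p0; have p1' := p1 => h1 h0.
have h2 := ler_wpM2l p0 h1; have h3 := ler_wpM2l p1 h0.
have h4 : p * (1 - p) * (A - B) ^+ 2 <= p.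
  have d1 : (A - B) ^+ 2 <= 1 by rewrite expr_le1 //; lra.
  have d2 : p * (1 - p) <= p by rewrite ler_piMr //; lra.
  have d3 : 0 <= (A - B) ^+ 2 := sqr_ge0 _.
  apply: le_trans (_ : p * 1 <= _); last by rewrite mulr1.
  by apply: ler_pM => //; rewrite mulr_ge0.
have -> : (p * A + (1 - p) * B) ^+ 2 = p * A ^+ 2 + (1 - p) * B ^+ 2 - p * (1 - p) * (A - B) ^+ 2.
  by ring.
rewrite /=; lra.
Qed.

Definition bern_prob D (E : pred {set T}) : R := bern_mean D p (fun H => (E H)%:R).

Lemma bern_prob_le D (E E' : pred {set T}) : (forall H, H \subset D -> E H -> E' H) ->
  bern_prob D E <= bern_prob D E'.
Proof.
move=> EE'; apply: le_bern_mean => H HD; rewrite ler_nat.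
by case: (boolP (E H)) => // /(EE' _ HD) ->.
Qed.

Lemma bern_prob_union D (E E1 E2 : pred {set T}) :
  (forall H, H \subset D -> [|| E H, E1 H | E2 H]) ->
  1 - bern_prob D E1 - bern_prob D E2 <= bern_prob D E.
Proof.
move=> EE; rewrite -(bern_mean_cst D p 1) -subr_ge0.
have : bern_mean D p (fun=> 1) <=
    bern_mean D p (fun H => (E H)%:R + ((E1 H)%:R + (E2 H)%:R)).
  apply: le_bern_mean => H /EE; rewrite -!natrD ler1n.
  by case: (E H); case: (E1 H); case: (E2 H).
by rewrite !bern_meanD -!/(bern_prob D _); lra.
Qed.

Lemma bern_prob_le1 D E : bern_prob D E <= 1.
Proof.
rewrite -[leRHS](bern_mean_cst D p); apply: le_bern_mean => H _.
by case: (E H).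
Qed.

Lemma bern_markov D (E : pred {set T}) f (t : R) : 0 < t ->
  (forall H, H \subset D -> 0 <= f H) -> (forall H, H \subset D -> E H -> t <= f H) ->
  bern_prob D E <= bern_mean D p f / t.
Proof.
move=> t0 f0 Ef; rewrite ler_pdivlMr // mulrC -bern_meanZ; apply: le_bern_mean => H HD.
by case: (boolP (E H)) => EH; rewrite ?mulr1 ?mulr0 ?Ef ?f0.
Qed.

Lemma bern_chebyshev D (E : pred {set T}) f t : lipschitz1 D f -> 0 < t ->
  (forall H, H \subset D -> E H -> t <= `|f H - bern_mean D p f|) ->
  bern_prob D E <= #|D|%:R * p / t ^+ 2.
Proof.
move=> lip t0 Ef; set m := bern_mean D p f.
apply: (@le_trans _ _ (bern_mean D p (fun H => (f H - m) ^+ 2) / t ^+ 2)).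
  apply: bern_markov; first exact: exprn_gt0.
    by move=> H _; exact: sqr_ge0.
  move=> H HD EH; rewrite -(real_normK (num_real (f H - m))).
  by apply: lerXn2r; rewrite ?nnegrE ?(ltW t0) ?Ef.
rewrite ler_pM2r ?invr_gt0 ?exprn_gt0 //.
rewrite (@eq_bern_mean _ p _ (fun H => f H ^+ 2 + ((- 2 * m) * f H + m ^+ 2))); last first.
  by move=> H _; ring.
rewrite !bern_meanD bern_meanZ bern_mean_cst -/m.
have := bern_variance lip; rewrite -/m; lra.
Qed.

End Probability.
End BernoulliSubset.

(** * Turan numbers as functions of a random edge set *)

Section TuranNumber.
Variables (R : realType) (r : nat) (W : finType) (F : rgraph r W).

Definition max_free (V : finType) (H : {set {set V}}) : nat :=
  \max_(G : {set {set V}} | (G \subset H) && ~~ contains_copy F G) #|G|.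

Definition complete_edges n : {set {set 'I_n}} := [set e : {set 'I_n} | #|e| == r].

Lemma edges_complete n (G : rgraph r 'I_n) : edges G \subset complete_edges n.
Proof.
apply/fintype.subsetP => e eG; rewrite inE; exact: (forall_inP (edges_uniform G)).
Qed.

Lemma insub_edges n (G : {set {set 'I_n}}) : G \subset complete_edges n ->
  omap (@edges r 'I_n) (insub G) = Some G.
Proof.
move=> Gc; case: insubP => [G' _ <-//|].
by case/forall_inP => e /(fintype.subsetP Gc); rewrite inE.
Qed.

Lemma turan_inE n (H : rgraph r 'I_n) : turan_in H F = max_free (edges H).
Proof.
rewrite /turan_in /max_free [RHS](reindex_omap (@edges r 'I_n) insub); last first.
  by move=> G /andP[GH _]; apply/insub_edges/(subset_trans GH)/edges_complete.
apply: eq_bigl => G; rewrite valK eqxx andbT; congr (_ && _).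
Qed.

Lemma Hnp_probE n (p : R) (A : pred (rgraph r 'I_n)) (B : pred {set {set 'I_n}}) :
  (forall H, A H = B (edges H)) -> Hnp_prob p A = bern_prob p (complete_edges n) B.
Proof.
move=> AB; rewrite /Hnp_prob /bern_prob /bern_mean.
rewrite [RHS](reindex_omap (@edges r 'I_n) insub); last exact: insub_edges.
rewrite big_mkcond; apply: eq_big => H.
  by rewrite valK eqxx andbT edges_complete.
move=> _; rewrite AB; case: (B _); rewrite ?mulr1 ?mulr0 //.
by apply: eq_bigl => e; rewrite inE.
Qed.

Lemma max_free_ge V (G H : {set {set V}}) : G \subset H -> ~~ contains_copy F G ->
  (#|G| <= max_free H)%N.
Proof. by move=> GH Gf; rewrite /max_free (bigop.bigmax_sup G) // GH. Qed.

Lemma contains_copyS V (G H : {set {set V}}) : G \subset H ->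
  contains_copy F G -> contains_copy F H.
Proof.
move=> /fintype.subsetP GH /existsP[f /andP[fi /forall_inP fG]]; apply/existsP; exists f.
by rewrite fi; apply/forall_inP => e eF; apply: GH; exact: fG.
Qed.

Lemma max_free_witness V (H : {set {set V}}) : (0 < max_free H)%N ->
  exists2 G : {set {set V}}, (G \subset H) && ~~ contains_copy F G & #|G| = max_free H.
Proof.
move=> m0; have [G GP|none] := pickP (fun G : {set {set V}} => (G \subset H) && ~~ contains_copy F G).
  have [G' G'P E] := @bigop.eq_bigmax_cond _ (fun G : {set {set V}} => (G \subset H) && ~~ contains_copy F G) (fun G => #|G|) ltac:(by apply/card_gt0P; exists G).
  by exists G'; [exact: G'P|rewrite -E].
by move: m0; rewrite /max_free big_pred0.
Qed.

Lemma max_free_lipschitz n : lipschitz1 (complete_edges n) (fun H => (max_free H)%:R : R).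
Proof.
move=> e H _ _; rewrite natr1 !ler_nat; apply/andP; split.
  apply/bigop.bigmax_leqP => G /andP[GH Gf]; apply: max_free_ge => //.
  exact: subset_trans GH (subsetUr _ _).
apply/bigop.bigmax_leqP => G /andP[GH Gf].
rewrite (cardsD1 e G) -add1n leq_add ?leq_b1 //; apply: max_free_ge.
  apply/fintype.subsetP => z; rewrite !inE => /andP[ze zG].
  by have := fintype.subsetP GH z zG; rewrite !inE (negbTE ze).
by apply: contra Gf; apply: contains_copyS; exact: subD1set.
Qed.

Lemma card_lipschitz n : lipschitz1 (complete_edges n) (fun H => #|H|%:R : R).
Proof.
by move=> e H _ _; rewrite natr1 !ler_nat cardsU1; case: (_ \notin _); rewrite ?add0n ?add1n leqnn leqnSn.
Qed.

Lemma max_free_le_card V (H : {set {set V}}) : (max_free H <= #|H|)%N.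
Proof. by apply/bigop.bigmax_leqP => G /andP[GH _]; exact: subset_leq_card. Qed.

End TuranNumber.

(** * Constructions of large free subgraphs *)

Section Deletion.
Variables (R : realType) (r : nat) (W : finType) (F : rgraph r W) (e0 : {set W}).
Hypothesis e0F : e0 \in edges F.

Let image (V : finType) (f : {ffun W -> V}) : {set {set V}} :=
  [set f @: (e : {set W}) | e in edges F].

Let card_image (V : finType) (f : {ffun W -> V}) : injectiveb f -> #|image f| = #|edges F|.
Proof. by move=> /injectiveP fi; rewrite card_imset //; exact: imset_inj. Qed.

(** The image of [e0] is deleted for every copy in [G]: at most one edge per copy, and no copy
    survives. *)
Lemma deletion (V : finType) (G H : {set {set V}}) : G \subset H ->
  #|G|%:R - \sum_(f : {ffun W -> V} | injectiveb f) (image f \subset G)%:R <=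
  (max_free F H)%:R :> R.
Proof.
move=> GH.
pose copies := [set f : {ffun W -> V} | injectiveb f & image f \subset G].
have -> : \sum_(f : {ffun W -> V} | injectiveb f) (image f \subset G)%:R = #|copies|%:R :> R.
  rewrite -sum1_card natr_sum big_mkcond [RHS]big_mkcond; apply: eq_bigr => f _.
  by rewrite inE; case: (injectiveb f); case: (_ \subset _).
pose hit := [set (f : {ffun W -> V}) @: e0 | f in copies].
have h1 : (#|G :\: hit| <= max_free F H)%N.
  apply: max_free_ge; first exact: subset_trans (subsetDl _ _) GH.
  apply/negP => /existsP[f /andP[fi /forall_inP fG]].
  have : f @: e0 \in G :\: hit by exact: fG.
  rewrite inE => /andP[/negP nh _]; apply: nh; apply/imsetP; exists f => //.
  rewrite inE fi /=; apply/fintype.subsetP => x /imsetP[e eF ->].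
  by have := fG e eF; rewrite inE => /andP[].
have h2 : (#|G| <= #|G :\: hit| + #|copies|)%N.
  rewrite -(cardsID hit G) addnC leq_add2l.
  apply: leq_trans (leq_imset_card (fun f : {ffun W -> V} => f @: e0) _).
  by rewrite subset_leq_card // subsetIr.
by rewrite lerBlDr -natrD ler_nat (leq_trans h2) // leq_add2r.
Qed.

(** Keeping each edge of H with probability rho = p' / p produces density p'. The maximum in H is at
    least the average of the deletion bound over such random subsets of H, which replaces a coupling
    of the two densities. *)
Lemma mean_max_free_thinning n (p p' : R) : 0 < p <= 1 -> 0 <= p' <= p ->
  p' * #|complete_edges r n|%:R - p' ^+ #|edges F| * n%:R ^+ #|W| <=
  bern_mean (complete_edges r n) p (fun H => (max_free F H)%:R).
Proof.
move=> /andP[p0 p1] /andP[p'0 p'p]; set D := complete_edges r n.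
set k := #|edges F|.
pose rho := p' / p.
have rho01 : 0 <= rho <= 1.
  by rewrite divr_ge0 ?(ltW p0) //= ler_pdivrMr // mul1r.
have p01 : 0 <= p <= 1 by rewrite p1 ltW.
have rp : rho * p = p' by rewrite divfK // gt_eqF.
have pt (H : {set {set 'I_n}}) : H \subset D -> rho * #|H|%:R + - rho ^+ k *
    (\sum_(f : {ffun W -> 'I_n} | injectiveb f) (image f \subset H)%:R) <= (max_free F H)%:R.
  move=> HD; rewrite -(bern_mean_cst H rho (max_free F H)%:R).
  apply: le_trans (le_bern_mean rho01 (fun G GH => deletion GH)).
  rewrite bern_meanD bern_mean_card lerD2l.
  rewrite (@eq_bern_mean _ _ _ rho _ (fun G => -1 *
    (\sum_(f : {ffun W -> 'I_n} | injectiveb f) (image f \subset G)%:R))); last first.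
    by move=> G _; rewrite mulN1r.
  rewrite bern_meanZ bern_mean_sum mulN1r mulNr lerN2 mulr_sumr; apply: ler_sum => f fi.
  have [fH|fH] := boolP (image f \subset H).
    by rewrite bern_mean_superset // card_image // mulr1.
  rewrite (@eq_bern_mean _ _ _ rho _ (fun=> 0)) ?bern_mean_cst ?mulr0 // => G GH.
  by rewrite (_ : (_ \subset _) = false) //; apply/negbTE; apply: contra fH => /subset_trans; apply.
apply: le_trans (le_bern_mean p01 pt).
rewrite bern_meanD !bern_meanZ bern_mean_card mulrA rp lerD2l mulNr lerN2.
rewrite bern_mean_sum mulr_sumr.
apply: (@le_trans _ _ (\sum_(f : {ffun W -> 'I_n} | injectiveb f) p' ^+ k)).
  apply: ler_sum => f fi; have [fD|fD] := boolP (image f \subset D).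
    by rewrite bern_mean_superset // card_image // -exprMn rp.
  rewrite (@eq_bern_mean _ _ _ p _ (fun=> 0)) ?bern_mean_cst ?mulr0 ?exprn_ge0 // => G GH.
  by rewrite (_ : (_ \subset _) = false) //; apply/negbTE; apply: contra fD => /subset_trans; apply.
rewrite sumr_const -[leLHS]mulr_natr; apply: ler_wpM2l; first exact: exprn_ge0.
by rewrite -natrX ler_nat -[X in (_ <= X ^ _)%N](card_ord n) -card_ffun max_card.
Qed.

End Deletion.

Section Coloring.
Variables (R : realType) (r : nat) (s : 'I_r -> nat) (n m : nat).
Hypothesis hr : (2 <= r)%N.
Hypothesis hs : forall i, (2 <= s i)%N.
Hypotheses (m0 : (0 < m)%N) (mn : (m <= n)%N).

Let W : finType := part_vertex s.
Let K := complete_multipartite s.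
Let chi (u : 'I_n) : 'I_m := Ordinal (ltn_pmod u m0).
Variable Gm : {set {set 'I_m}}.
Hypothesis Gm_r : forall e, e \in Gm -> #|e| = r.
Hypothesis Gm_free : ~~ contains_copy K Gm.

Definition conflict (e e' : {set 'I_n}) : bool :=
  [exists u in e, [exists u', [&& u' != u, chi u' == chi u & e' == u' |: (e :\ u)]]].

Definition rainbow_edges (H : {set {set 'I_n}}) :=
  [set e in H | (chi @: e \in Gm) && ~~ [exists e' in H, (e' != e) && conflict e e']].

Let i0 : 'I_r := Ordinal (ltnW hr).
Let w0 : W := Tagged (fun i => 'I_(s i)) (Ordinal (ltnW (hs i0))).
Let bs (l : nat) : W :=
  let i := odflt i0 (insub l) in Tagged (fun i => 'I_(s i)) (Ordinal (ltnW (hs i))).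

Let tag_bs (l : nat) (lr : (l < r)%N) : (tag (bs l) : nat) = l.
Proof. by rewrite /bs /=; case: insubP => [i _ <-|]; rewrite ?lr. Qed.

(** Vertices of different parts must also get different colours: they lie in a common edge of the
    copy, whose colours form an r-set of [Gm]. *)
Lemma rainbow_free H : ~~ contains_copy K (rainbow_edges H).
Proof.
apply: contra Gm_free => /existsP[f /andP[/injectiveP fi /forall_inP fH]].
have trans (c : nat -> W) : (forall l, (l < r)%N -> (tag (c l) : nat) = l) ->
    f @: [set c i | i : 'I_r] \in rainbow_edges H.
  by move=> tc; apply: fH; apply: transversal_edge.
apply/existsP; exists [ffun u => chi (f u)]; apply/andP; split; last first.
  apply/forall_inP => e eK; have := fH e eK; rewrite inE => /and3P[_ + _].
  rewrite -imset_comp (_ : [ffun u => chi (f u)] @: e = (chi \o f) @: e) //.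
  by apply: eq_imset => u; rewrite ffunE.
apply/injectiveP => u u'; rewrite !ffunE => cc; apply/eqP/negPn/negP => uu'.
have [tt|tt] := eqVneq (tag u) (tag u'); last first.
  pose c (l : nat) := if l == tag u :> nat then u else if l == tag u' :> nat then u' else bs l.
  have tc l : (l < r)%N -> (tag (c l) : nat) = l.
    by move=> lr; rewrite /c; case: eqVneq => [->//|_]; case: eqVneq => [->//|_]; exact: tag_bs.
  have := trans c tc; rewrite inE => /and3P[_ /Gm_r + _].
  rewrite -!imset_comp -[in RHS](card_ord r) => /eqP/imset_injP inj.
  have tt' : (tag u' == tag u :> nat) = false by rewrite eq_sym; exact: negbTE.
  have : tag u = tag u'.
    by apply: (inj (tag u) (tag u')) => //=; rewrite /c eqxx tt' eqxx.
  by move/eqP; rewrite (negbTE tt).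
pose c (l : nat) := if l == tag u :> nat then u else bs l.
pose c' (l : nat) := if l == tag u :> nat then u' else bs l.
have tc l : (l < r)%N -> (tag (c l) : nat) = l.
  by move=> lr; rewrite /c; case: eqVneq => [->//|_]; exact: tag_bs.
have tc' l : (l < r)%N -> (tag (c' l) : nat) = l.
  by move=> lr; rewrite /c'; case: eqVneq => [->//|_]; [rewrite tt|exact: tag_bs].
have := trans c' tc'; rewrite inE => /and3P[e'H _ _].
have := trans c tc; rewrite inE => /and3P[_ _ /negP]; apply.
apply/exists_inP; exists (f @: [set c' i | i : 'I_r]) => //.
have cu : c (tag u) = u by rewrite /c eqxx.
have cu' : c' (tag u) = u' by rewrite /c' eqxx.
have ne (i : 'I_r) : i != tag u -> c i = bs i /\ c' i = bs i.
  by move=> it; rewrite /c /c' (negbTE (it : (i : nat) != tag u)).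
have fuc : f u \in f @: [set c i | i : 'I_r].
  by apply/imsetP; exists u => //; apply/imsetP; exists (tag u).
have notin : f u' \notin f @: [set c i | i : 'I_r].
  apply/negP => /imsetP[z /imsetP[i _ ->] /fi]; have [->|it] := eqVneq i (tag u).
    by rewrite cu => e; rewrite e eqxx in uu'.
  have [-> _] := ne i it => e; move: it; rewrite -val_eqE /= -(tag_bs (ltn_ord i)) -e tt eqxx.
  by [].
apply/andP; split.
  apply: contraNneq notin => <-; apply/imsetP; exists u' => //.
  by apply/imsetP; exists (tag u).
apply/exists_inP; exists (f u) => //; apply/existsP; exists (f u').
apply/and3P; split; [by apply: contra uu' => /eqP/fi ->|by rewrite cc|].
apply/eqP/setP => z; rewrite !inE; apply/imsetP/predU1P.
  case=> w /imsetP[i _ ->] ->; have [->|it] := eqVneq i (tag u); first by rewrite cu'; left.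
  have [h1 h2] := ne i it; right; apply/andP; split.
    rewrite h2 -h1; apply: contra it => /eqP/fi e.
    by rewrite -val_eqE /= -(tc i) // e.
  by apply/imsetP; exists (c' i) => //; apply/imsetP; exists i; rewrite ?h1 ?h2.
case=> [->|/andP[zu /imsetP[w /imsetP[i _ ->] zE]]].
  by exists u' => //; apply/imsetP; exists (tag u).
have [it|it] := eqVneq i (tag u); first by move: zu; rewrite zE it cu eqxx.
have [h1 h2] := ne i it.
by exists (c i) => //; apply/imsetP; exists i; rewrite ?h1 ?h2.
Qed.

(** With n.-1 in place of n the bound vanishes at m = n, where all colours differ; this covers p of
    constant order. *)
Lemma card_same_color (u : 'I_n) : (#|[set u' | (u' != u) && (chi u' == chi u)]| <= n.-1 %/ m)%N.
Proof.
pose q (u' : 'I_n) : 'I_(n.-1 %/ m).+1 := inord (u' %/ m).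
have qE u' : q u' = (u' %/ m)%N :> nat.
  rewrite inordK // ltnS leq_div2r // -ltnS prednK ?ltn_ord //.
  exact: leq_ltn_trans (leq0n u') (ltn_ord u').
pose A := [set u' | chi u' == chi u].
have : {in A &, injective q}.
  move=> u1 u2; rewrite !inE => /eqP/(congr1 val) /= e1 /eqP/(congr1 val) /= e2 qq.
  apply: val_inj => /=; rewrite (divn_eq u1 m) (divn_eq u2 m) -!qE qq e1 e2 //.
move=> /card_in_imset qA; have : (#|A| <= (n.-1 %/ m).+1)%N.
  by rewrite -qA -[X in (_ <= X)%N]card_ord max_card.
rewrite (cardsD1 u A) inE eqxx add1n ltnS; apply: leq_trans.
by rewrite subset_leq_card //; apply/fintype.subsetP => u'; rewrite !inE.
Qed.

Lemma card_conflict (e : {set 'I_n}) : #|e| = r ->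
  (#|[set e' | (e' != e) && conflict e e']| <= r * (n.-1 %/ m))%N.
Proof.
move=> er; pose cand u := [set (u' |: (e :\ u)) | u' in [set u' | (u' != u) && (chi u' == chi u)]].
apply: (@leq_trans #|\bigcup_(u in e) cand u|).
  apply: subset_leq_card; apply/fintype.subsetP => e'; rewrite inE => /andP[_].
  move=> /exists_inP[u ue /existsP[u' /and3P[h1 h2 /eqP ->]]].
  by apply/bigcupP; exists u => //; apply/imsetP; exists u' => //; rewrite inE h1 h2.
apply: (@leq_trans (\sum_(u in e) #|cand u|)).
  elim/big_rec2: _ => [|u x y _ IH]; first by rewrite cards0.
  by rewrite (leq_trans (leq_card_setU _ _)) // leq_add2l.
rewrite -er -sum_nat_const; apply: leq_sum => u _.
exact: leq_trans (leq_imset_card _ _) (card_same_color u).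
Qed.

Lemma card_colored_edges : (#|Gm| * (n %/ m) ^ r <=
  #|[set e in complete_edges r n | chi @: e \in Gm]|)%N.
Proof.
have b0 : (0 < n %/ m)%N by rewrite divn_gt0.
have ltn_lift (x : 'I_m) (j : 'I_(n %/ m)) : (x + j * m < n)%N.
  apply: (@leq_trans (j.+1 * m)); first by rewrite mulSn ltn_add2r.
  by apply: leq_trans (leq_divM n m); rewrite leq_mul2r ltn_ord orbT.
pose lift x j : 'I_n := Ordinal (ltn_lift x j).
have chi_lift x j : chi (lift x j) = x.
  by apply: val_inj; rewrite /= addnC modnMDl modn_small.
pose j0 : 'I_(n %/ m) := Ordinal b0.
pose fiber (g : {set 'I_m}) := [set e in complete_edges r n | chi @: e == g].
have fiber_ge g : g \in Gm -> ((n %/ m) ^ r <= #|fiber g|)%N.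
  (* Functions with the value [j0] outside [g], so that the lift of [g] determines them. *)
  move=> gG; pose A := [set h : {ffun 'I_m -> 'I_(n %/ m)} | h \in pffun_on j0 (mem g) predT].
  have cA : #|A| = ((n %/ m) ^ r)%N.
    by rewrite cardsE card_pffun_on (Gm_r gG) cardT size_enum_ord.
  pose E (h : {ffun 'I_m -> 'I_(n %/ m)}) : {set 'I_n} := [set lift x (h x) | x in g].
  have inj : {in A &, injective E}.
    move=> h h'; rewrite !inE => /pffun_onP[/fintype.subsetP sh _] /pffun_onP[/fintype.subsetP sh' _] Eh.
    apply/ffunP => x; have [xg|xg] := boolP (x \in g).
      have : lift x (h x) \in E h' by rewrite -Eh; apply/imsetP; exists x.
      move=> /imsetP[x' _ e]; have xx' : x = x' by rewrite -(chi_lift x (h x)) e chi_lift.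
      move: e; rewrite -xx' => /(congr1 val) /= /addnI/eqP.
      by rewrite eqn_mul2r eqn0Ngt m0 /= => /eqP/val_inj.
    have hx : h x = j0 by apply/eqP/negPn/negP => h1; have := sh x h1; rewrite (negbTE xg).
    by rewrite hx; apply/esym/eqP/negPn/negP => h1; have := sh' x h1; rewrite (negbTE xg).
  rewrite -cA -(card_in_imset inj); apply: subset_leq_card; apply/fintype.subsetP => e /imsetP[h _ ->].
  rewrite !inE; apply/andP; split.
    rewrite card_imset ?(Gm_r gG) // => x x' /(congr1 chi); by rewrite !chi_lift.
  rewrite -imset_comp (eq_imset (g := id)) ?imset_id // => x.
  exact: chi_lift.
rewrite -sum_nat_const; apply: leq_trans (leq_sum _ fiber_ge) _.
apply: eq_leq; rewrite -[RHS]sum1_card (partition_big (fun e : {set 'I_n} => chi @: e) (mem Gm)) /=.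
  apply: eq_bigr => g gG; rewrite -sum1_card; apply: eq_bigl => e; rewrite !inE.
  case: (eqVneq (chi @: e) g) => [->|_]; rewrite ?andbF // !andbT.
  by rewrite (gG : g \in Gm) andbT.
by move=> e; rewrite inE => /andP[].
Qed.

(** The indicator of a kept edge is at least that of e in H minus those of e, e' in H over the
    conflicting e'; its mean is at least p - p^2 r (n.-1 / m) >= p / 2. *)
Lemma mean_max_free_coloring (p : R) : 0 <= p <= 1 ->
  p * (r * (n.-1 %/ m))%:R <= 2^-1 ->
  p / 2 * (#|Gm| * (n %/ m) ^ r)%:R <=
  bern_mean (complete_edges r n) p (fun H => (max_free K H)%:R).
Proof.
move=> p01 psmall; have /andP[p0 p1] := p01.
set D := complete_edges r n.
pose E := [set e in D | chi @: e \in Gm].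
pose C (e : {set 'I_n}) := [set e' | (e' != e) && conflict e e'].
have pt (H : {set {set 'I_n}}) : H \subset D ->
    \sum_(e in E) (([set e] \subset H)%:R + \sum_(e' in C e) - ([set e; e'] \subset H)%:R) <=
    (max_free K H)%:R :> R.
  move=> HD; apply: (@le_trans _ _ (#|rainbow_edges H|%:R)); last first.
    rewrite ler_nat; apply: max_free_ge; last exact: rainbow_free.
    by apply/fintype.subsetP => e; rewrite inE => /andP[].
  rewrite -sum1_card natr_sum [leRHS]big_mkcond [leLHS]big_mkcond; apply: ler_sum => e _.
  have bound : ([set e] \subset H)%:R + \sum_(e' in C e) - ([set e; e'] \subset H)%:R <=
      ((e \in H) && ~~ [exists e' in H, (e' != e) && conflict e e'])%:R :> R.
    rewrite sub1set sumrN; have [eH|eH] := boolP (e \in H); last first.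
      by rewrite sub0r oppr_le0 sumr_ge0.
    case: (boolP [exists e' in H, _]) => [/exists_inP[e' e'H ce']|_]; last first.
      by rewrite gerDl oppr_le0 sumr_ge0.
    rewrite (bigD1 e') ?inE //= subUset !sub1set eH e'H.
    by rewrite opprD addrA subrr sub0r oppr_le0 sumr_ge0.
  rewrite /E inE; case: ifP => [/andP[eD eG]|_].
    by apply: le_trans bound _; rewrite inE eG /=; case: ifP => // ->.
  by case: ifP.
apply: le_trans (le_bern_mean p01 pt).
rewrite bern_mean_sum.
apply: (@le_trans _ _ (\sum_(e in E) (p / 2))).
  rewrite sumr_const -[leRHS]mulr_natr; apply: ler_wpM2l; first by rewrite divr_ge0.
  by rewrite ler_nat; exact: card_colored_edges.
apply: ler_sum => e; rewrite inE => /andP[eD _].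
rewrite bern_meanD bern_mean_superset ?sub1set // cards1 expr1 bern_mean_sum.
have ce : (#|C e| <= r * (n.-1 %/ m))%N by apply: card_conflict; move: eD; rewrite inE => /eqP.
have pair e' : e' \in C e -> - p ^+ 2 <=
    bern_mean D p (fun H => - ([set e; e'] \subset H)%:R).
  rewrite inE => /andP[ne _].
  rewrite (@eq_bern_mean _ _ _ p _ (fun H => -1 * ([set e; e'] \subset H)%:R)); last first.
    by move=> H _; rewrite mulN1r.
  rewrite bern_meanZ mulN1r lerN2; have [e'D|e'D] := boolP (e' \in D).
    by rewrite bern_mean_superset ?subUset ?sub1set ?eD ?e'D // cards2 eq_sym ne.
  rewrite (@eq_bern_mean _ _ _ p _ (fun=> 0)) ?bern_mean_cst ?exprn_ge0 // => H HD.
  rewrite (_ : (_ \subset _) = false) //; apply/negbTE; apply: contra e'D.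
  by rewrite subUset !sub1set => /andP[_]; exact: (fintype.subsetP HD).
have sum_ge : - (p ^+ 2 * (r * (n.-1 %/ m))%:R) <=
    \sum_(e' in C e) bern_mean D p (fun H => - ([set e; e'] \subset H)%:R).
  apply: le_trans (ler_sum _ pair); rewrite sumr_const -[leRHS]mulr_natr mulNr lerN2.
  by apply: ler_wpM2l; rewrite ?exprn_ge0 // ler_nat.
have : p * (p * (r * (n.-1 %/ m))%:R) <= p * 2^-1 by exact: ler_wpM2l.
rewrite mulrA -expr2; lra.
Qed.

End Coloring.

(** * Partition functions of free families *)

Section PartitionFunction.
Variables (R : realType) (T : finType) (free : pred {set T}).
Hypothesis free_sub : forall I J : {set T}, I \subset J -> free J -> free I.
Implicit Types (G C S I : {set T}) (lam theta : R).

Definition partition_function lam G : R :=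
  \sum_(I : {set T} | (I \subset G) && free I) lam ^+ #|I|.

Lemma sum_subsets lam G : \sum_(S : {set T} | S \subset G) lam ^+ #|S| = (1 + lam) ^+ #|G|.
Proof.
elim/set_ind: G => [|G e eG IH].
  by rewrite (big_pred1 set0) => [|H]; rewrite ?subset0 // cards0 !expr0.
rewrite cardsU1 eG exprS -IH mulrDl mul1r mulr_sumr.
rewrite (bigID (fun S : {set T} => e \in S)) /= addrC; congr (_ + _).
  apply: eq_bigl => S; apply/andP/idP => [[/fintype.subsetP SG eS]|SG].
    apply/fintype.subsetP => z zS; have := SG z zS; rewrite !inE => /predU1P[ze|//].
    by rewrite -ze zS in eS.
  split; first by apply: subset_trans SG (subsetUr _ _).
  by apply: contra eG; exact: (fintype.subsetP SG).
rewrite (reindex_onto (fun S => e |: S) (fun S => S :\ e)) /=; last first.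
  by move=> S /andP[_ eS]; rewrite setD1K.
apply: eq_big => S.
  rewrite setU11 andbT subUset sub1set setU11 /=.
  apply/andP/idP => [[/fintype.subsetP SG /eqP eS]|SG].
    apply/fintype.subsetP => z zS; have := SG z zS; rewrite !inE => /predU1P[ze|//].
    by move: zS; rewrite -eS ze !inE eqxx.
  split; first by apply: subset_trans SG (subsetUr _ _).
  by rewrite setU1K //; apply: contra eG; exact: (fintype.subsetP SG).
move=> /andP[/andP[_ _] /eqP eS].
have eS' : e \notin S by rewrite -eS !inE eqxx.
by rewrite cardsU1 eS' exprS.
Qed.

Lemma expr_1D_le (x : R) n : 0 <= x -> (1 + x) ^+ n <= expR (x * n%:R).
Proof.
move=> x0; rewrite mulrC expRM_natl.
by apply: lerXn2r; rewrite ?nnegrE ?expR_ge0 ?addr_ge0 ?expR_ge1Dx.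
Qed.

Lemma partition_function_le lam G : 0 <= lam ->
  partition_function lam G <= expR (lam * #|G|%:R).
Proof.
move=> l0; apply: (@le_trans _ _ ((1 + lam) ^+ #|G|)).
  rewrite -sum_subsets /partition_function [leRHS](bigID free) /= lerDl sumr_ge0 // => S _.
  exact: exprn_ge0.
exact: expr_1D_le.
Qed.

(** A free [I] splits into its fingerprint and a free subset of the container. Fingerprints are
    counted with a Chernoff weight: lam^|S| <= theta^(-b) (theta lam)^|S| for |S| <= b, and the sum
    of (theta lam)^|S| over all subsets of [G] is at most exp (theta lam |G|). *)
Lemma partition_function_containers lam theta G (b : nat) (M B : R) :
  0 <= lam -> 0 < theta <= 1 -> 0 <= B ->
  has_containers free G b M ->
  (forall C, C \subset G -> #|C|%:R <= M -> partition_function lam C <= B) ->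
  partition_function lam G <= theta ^- b * expR (theta * lam * #|G|%:R) * B.
Proof.
move=> l0 /andP[t0 t1] B0 [f hf] Cle.
pose cond (I S : {set T}) := [&& S \subset I, (#|S| <= b)%N, I :\: S \subset f S & #|f S|%:R <= M].
have powl S : 0 <= lam ^+ #|S| by exact: exprn_ge0.
apply: (@le_trans _ _ (\sum_(I : {set T} | (I \subset G) && free I)
    \sum_(S : {set T} | (S \subset G) && (#|S| <= b)%N && cond I S) lam ^+ #|I|)).
  apply: ler_sum => I /andP[IG If]; have [S /andP[S1 S2] /andP[S3 S4]] := hf I If.
  move: S1 S3; rewrite (setIidPl IG) => S1 S3.
  rewrite (bigD1 S) /=; last by rewrite /cond S1 S2 S3 S4 (subset_trans S1 IG).
  by rewrite lerDl sumr_ge0.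
rewrite (exchange_big_dep (fun S : {set T} => (S \subset G) && (#|S| <= b)%N)) /=; last first.
  by move=> I S _ /andP[].
apply: (@le_trans _ _ (\sum_(S : {set T} | (S \subset G) && (#|S| <= b)%N) lam ^+ #|S| * B)).
  apply: ler_sum => S /andP[SG Sb].
  have [/existsP[I0 /andP[_ /and4P[_ _ _ fM]]]|/existsPn none] :=
      boolP [exists I : {set T}, ((I \subset G) && free I) && cond I S]; last first.
    rewrite big_pred0 ?mulr_ge0 // => I; rewrite SG Sb /=.
    by apply/negbTE; exact: none.
  (* The container [f S] may leave [G], so its trace on [G] is used. *)
  apply: (@le_trans _ _ (lam ^+ #|S| * partition_function lam (f S :&: G))); last first.
    apply: ler_wpM2l => //; apply: Cle; first exact: subsetIr.
    by apply: le_trans fM; rewrite ler_nat subset_leq_card // subsetIl.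
  rewrite /partition_function mulr_sumr.
  rewrite (eq_bigr (fun I => lam ^+ #|S| * lam ^+ #|I :\: S|)); last first.
    move=> I /and3P[_ _ /and4P[SI _ _ _]].
    by rewrite -exprD -(cardsID S I) (setIidPr SI).
  pose P I := [&& (I \subset G) && free I, (S \subset G) && (#|S| <= b)%N & cond I S].
  have inj : {in [pred I | P I] &, injective (fun I => I :\: S)}.
    move=> I J; rewrite !inE /P => /and3P[_ _ /and4P[SI _ _ _]] /and3P[_ _ /and4P[SJ _ _ _]] e.
    by rewrite -(setID I S) -(setID J S) (setIidPr SI) (setIidPr SJ) e.
  rewrite -(big_imset (fun I => lam ^+ #|S| * lam ^+ #|I|) inj) /=.
  rewrite [leRHS](bigID (fun J => J \in [set I :\: S | I in [pred I | P I]])) /=.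
  rewrite [X in X + _](eq_bigl (fun J => J \in [set I :\: S | I in [pred I | P I]])).
    by rewrite lerDl sumr_ge0 // => J _; rewrite mulr_ge0.
  move=> J; apply: andb_idl => /imsetP[I]; rewrite inE.
  move=> /and3P[/andP[IG If] _ /and4P[SI _ If' _]] ->.
  rewrite subsetI If' /=; apply/andP; split; first exact: subset_trans (subsetDl _ _) IG.
  by apply: free_sub If; exact: subsetDl.
rewrite -mulr_suml; apply: ler_wpM2r => //.
apply: (@le_trans _ _ (theta ^- b * \sum_(S : {set T} | S \subset G) (theta * lam) ^+ #|S|)).
  rewrite mulr_sumr [leRHS](bigID (fun S : {set T} => (#|S| <= b)%N)) /=.
  rewrite -[leLHS]addr0; apply: lerD; last first.
    by apply: sumr_ge0 => S _; rewrite mulr_ge0 ?invr_ge0 ?exprn_ge0 ?mulr_ge0 // ltW.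
  apply: ler_sum => S /andP[_ Sb]; rewrite exprMn mulrA; apply: ler_peMl => //.
  rewrite -{1}(subnK Sb) exprD invfM -mulrA mulVf ?mulr1; last by rewrite expf_neq0 // gt_eqF.
  by rewrite invf_ge1 ?exprn_gt0 // exprn_ile1 // ltW.
apply: ler_wpM2l; first by rewrite invr_ge0 exprn_ge0 // ltW.
by rewrite sum_subsets; apply: expr_1D_le; rewrite mulr_ge0 // ltW.
Qed.

Section Iteration.
Variables (D : {set T}) (M0 B1 B2 delta lam : R).
Hypotheses (delta01 : 0 < delta < 1) (M0_gt0 : 0 < M0) (B1_ge0 : 0 <= B1)
  (B2_ge0 : 0 <= B2) (lam0 : 0 <= lam).
Hypothesis cont : forall G, G \subset D -> M0 < #|G|%:R ->
  exists2 b : nat, b%:R <= B1 + B2 * (M0 / #|G|%:R) &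
                   has_containers free G b ((1 - delta) * #|G|%:R).

Let x := 1 - delta.
Let gam := x^-1.
Let x0 : 0 < x. Proof. by rewrite /x; case/andP: delta01; lra. Qed.
Let x1 : x <= 1. Proof. by rewrite /x; case/andP: delta01; lra. Qed.
Let gam1 : 1 <= gam. Proof. by rewrite invf_ge1. Qed.
Let gam0 : 0 < gam. Proof. by rewrite invr_gt0. Qed.
Let lng : 0 <= ln gam. Proof. by rewrite ln_ge0. Qed.

(** Logarithmic price of the round with M0 gam^l < |G| <= M0 gam^(l+1) and theta = x^(2 l). The
    exponent 2 makes theta lam |G| decay like x^l. The price b ln (1 / theta) is linear in l times
    b, so the constant part [B1] of b sums to order i^2, while the part B2 x^l gives a convergent
    series. *)
Let cost l : R := B1 * (2 * l%:R * ln gam) +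
  (B2 * (2 * ln gam) + lam * M0 * gam) * ((l%:R + 1) * x ^+ l).

Let cost_ge0 l : 0 <= cost l.
Proof.
apply: addr_ge0; first by rewrite !mulr_ge0.
apply: mulr_ge0; last by rewrite mulr_ge0 ?addr_ge0 ?exprn_ge0 // ltW.
by apply: addr_ge0; rewrite !mulr_ge0 // ltW.
Qed.

Lemma partition_function_iter i G : G \subset D -> #|G|%:R <= M0 * gam ^+ i ->
  partition_function lam G <= expR (lam * M0 + \sum_(l < i) cost l).
Proof.
elim: i G => [|i IH] G GD Gi.
  apply: (le_trans (partition_function_le G lam0)).
  by rewrite big_ord0 addr0 ler_expR; apply: ler_wpM2l => //; rewrite expr0 mulr1 in Gi.
rewrite big_ord_recr /= addrA.
have [Gs|Gb] := lerP #|G|%:R (M0 * gam ^+ i).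
  apply: (le_trans (IH G GD Gs)); by rewrite ler_expR lerDl.
have gi1 : 1 <= gam ^+ i by exact: exprn_ege1.
have G_gt : M0 < #|G|%:R.
  by apply: le_lt_trans Gb; rewrite ler_peMr // ltW.
have G_gt0 : 0 < #|G|%:R :> R by apply: lt_trans G_gt.
have [b bB hb] := cont GD G_gt.
have t01 : 0 < x ^+ (2 * i) <= 1 by rewrite exprn_gt0 //= exprn_ile1 // ltW.
apply: (le_trans (partition_function_containers lam0 t01 (expR_ge0 _) hb _)) => [C CG Cs|].
  apply: IH; first exact: subset_trans CG GD.
  apply: (le_trans Cs); rewrite -/x.
  apply: (le_trans (ler_wpM2l (ltW x0) Gi)); rewrite le_eqVlt; apply/orP; left; apply/eqP.
  rewrite exprS; transitivity (x * gam * (M0 * gam ^+ i)); first by ring.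
  by rewrite mulfV ?mul1r // gt_eqF.
have xE : x = expR (- ln gam) by rewrite -lnV ?posrE // /gam invrK lnK.
have xnE k : x ^+ k = expR (- (k%:R * ln gam)) by rewrite [in LHS]xE -expRM_natl mulrN.
have -> : (x ^+ (2 * i)) ^- b = expR (b%:R * (2 * i%:R * ln gam)).
  by rewrite -exprM xnE -expRN opprK !natrM; congr expR; ring.
rewrite -!expRD ler_expR [leLHS]addrC lerD2l.
have xg : x ^+ i * gam ^+ i = 1 by rewrite -exprMn mulfV ?expr1n // gt_eqF.
have xi0 : 0 < x ^+ i by exact: exprn_gt0.
have h1 : M0 / #|G|%:R <= x ^+ i.
  rewrite ler_pdivrMr //; have := ler_wpM2l (ltW xi0) (ltW Gb).
  by rewrite mulrCA xg mulr1.
have h2 : x ^+ (2 * i) * lam * #|G|%:R <= lam * M0 * gam * x ^+ i.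
  have := ler_wpM2l (mulr_ge0 (exprn_ge0 (2 * i) (ltW x0)) lam0) Gi.
  move=> h; apply: (le_trans h); rewrite le_eqVlt; apply/orP; left; apply/eqP.
  rewrite mul2n -addnn exprD exprS.
  transitivity (lam * M0 * gam * x ^+ i * (x ^+ i * gam ^+ i)); first by ring.
  by rewrite xg mulr1.
have l0 : 0 <= 2 * i%:R * ln gam by rewrite !mulr_ge0.
have h3 : b%:R * (2 * i%:R * ln gam) <= (B1 + B2 * x ^+ i) * (2 * i%:R * ln gam).
  apply: ler_wpM2r => //; apply: (le_trans bB); rewrite lerD2l; exact: ler_wpM2l.
have h4 : 0 <= B2 * x ^+ i * (2 * ln gam) by rewrite !mulr_ge0 // ltW.
have h5 : 0 <= lam * M0 * gam * x ^+ i * i%:R by rewrite !mulr_ge0 // ltW.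
rewrite /cost.
move: h2 h3 h4 h5; set u := x ^+ i; set v := x ^+ (2 * i) * lam * #|G|%:R.
nra.
Qed.

Lemma sum_arith_geom i : \sum_(l < i) ((l%:R + 1) * x ^+ l) <= delta ^- 2.
Proof.
have [d0 d1] := andP delta01.
have -> : \sum_(l < i) ((l%:R + 1) * x ^+ l) =
    delta ^- 2 - (i%:R / delta + delta ^- 2) * x ^+ i.
  elim: i => [|i IH]; first by rewrite big_ord0 mul0r add0r expr0 mulr1 subrr.
  rewrite big_ord_recr IH /= -natr1 (exprS x i); set u := x ^+ i; rewrite /x; field.
  by rewrite gt_eqF.
rewrite gerBl mulr_ge0 ?exprn_ge0 ?(ltW x0) // addr_ge0 ?divr_ge0 ?invr_ge0 ?exprn_ge0 //;
  exact: ltW.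
Qed.

Lemma partition_function_bound i : #|D|%:R <= M0 * gam ^+ i ->
  partition_function lam D <= expR (lam * M0 + B1 * (ln gam * i%:R ^+ 2) +
    (B2 * (2 * ln gam) + lam * M0 * gam) / delta ^+ 2).
Proof.
move=> Di; apply: (le_trans (partition_function_iter (subxx D) Di)).
rewrite ler_expR -addrA lerD2l /cost big_split /= -!mulr_sumr; apply: lerD.
  apply: ler_wpM2l => //; rewrite -mulr_suml mulrC; apply: ler_wpM2l => //.
  elim: i {Di} => [|i IH]; first by rewrite big_ord0 exprn_ge0.
  rewrite big_ord_recr /= -natr1.
  have : 0 <= i%:R :> R by []. nra.
apply: ler_wpM2l; last exact: sum_arith_geom.
by apply: addr_ge0; rewrite !mulr_ge0 // ltW.
Qed.

End Iteration.

(** Each [I] counted has e^(|I| - m) >= 1. Allowing q > p lets the middle range use its upper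
    endpoint. *)
Lemma union_bound (D : {set T}) (p q : R) (m : R) : 0 <= p <= 1 -> p <= q ->
  bern_prob p D (fun H => [exists I : {set T}, [&& I \subset H, free I & m <= #|I|%:R]]) <=
  expR (- m) * partition_function (expR 1 * q) D.
Proof.
move=> p01 pq; have [p0 p1] := andP p01.
apply: (@le_trans _ _ (bern_mean D p (fun H =>
    \sum_(I : {set T} | [&& I \subset D, free I & m <= #|I|%:R]) (I \subset H)%:R))).
  apply: le_bern_mean => // H HD; case: existsP => [[I /and3P[IH If Im]]|_].
    by rewrite (bigD1 I) /= ?IH ?lerDl ?sumr_ge0 // If Im (subset_trans IH HD).
  by rewrite sumr_ge0.
rewrite bern_mean_sum /partition_function mulr_sumr.
rewrite [leRHS](bigID (fun I : {set T} => m <= #|I|%:R)) /= -[leLHS]addr0.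
have e0 : 0 <= expR 1 * q by rewrite mulr_ge0 ?expR_ge0 // (le_trans p0).
apply: lerD; last by apply: sumr_ge0 => I _; rewrite mulr_ge0 ?expR_ge0 ?exprn_ge0.
rewrite (eq_bigl (fun I : {set T} => (I \subset D) && free I && (m <= #|I|%:R))); last first.
  by move=> I; rewrite andbA.
apply: ler_sum => I /andP[/andP[ID _] Im].
rewrite bern_mean_superset // exprMn -expRM_natl mulr1 mulrA -expRD.
apply: (@le_trans _ _ (1 * p ^+ #|I|)); first by rewrite mul1r.
apply: ler_pM => //; rewrite ?exprn_ge0 //; last by apply: lerXn2r; rewrite ?nnegrE // (le_trans p0).
by rewrite -[leLHS](@expR0 R) ler_expR addrC subr_ge0.
Qed.

End PartitionFunction.

(** * The upper tail bound *)

Section UpperTail.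
Variables (R : realType) (r : nat) (s : 'I_r -> nat).
Hypothesis hr : (2 <= r)%N.
Hypothesis hs : forall i, (2 <= s i)%N.

Let a : R := (a_r s)%:R.
Let b1 : R := beta1 s R.

Lemma card_complete_edges n : #|complete_edges r n| = 'C(n, r).
Proof. by rewrite /complete_edges card_draws card_ord. Qed.

Lemma bin_le_expn n k : ('C(n, k) <= n ^ k)%N.
Proof.
apply: (@leq_trans (n ^_ k)); first by rewrite -bin_ffact leq_pmulr // fact_gt0.
elim: k => [|k IH]; first by rewrite ffactn0.
by rewrite ffactnSr expnSr leq_mul // leq_subr.
Qed.

Definition turan_rate (q : R) (n : nat) : R := q `^ (1 - 1 / a) * n%:R `^ (r%:R - 1 / a).

(** The iteration stops at a size M with q M of order X = [turan_rate q n], where the trivial bound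
    exp (e q M) on the partition function is affordable. The hypothesis on n^(r-beta1) (ln n)^2
    absorbs the constant part of the fingerprint sizes over O(ln n) rounds. The partition function
    is at most exp (C1 X), so the threshold (C1 + 1) X leaves exp (- X). *)
Lemma upper_tail : exists2 C : R, 0 < C & forall (n : nat) (p q : R),
  (0 < n)%N -> 1 <= ln (n%:R : R) -> 0 <= p <= 1 -> p <= q -> 0 < q <= 1 ->
  n%:R `^ (r%:R - b1) * ln n%:R ^+ 2 <= turan_rate q n ->
  bern_prob p (complete_edges r n)
    (fun H => C * turan_rate q n < (max_free (complete_multipartite s) H)%:R) <=
  expR (- turan_rate q n).
Proof.
have [delta [kappa [C0 [d01 k0 C00 cont]]]] := multipartite_containers R hr hs.
have [d0 d1] := andP d01.
pose gam := (1 - delta)^-1.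
have gam1 : 1 < gam by rewrite invf_gt1; lra.
have gam0 : 0 < gam := lt_trans ltr01 gam1.
have lng : 0 < ln gam by rewrite ln_gt0.
(* Makes every G with more than M edges dense enough for the container theorem. *)
pose k1 := Num.max 1 kappa^-1.
have k11 : 1 <= k1 by rewrite le_max lexx.
have k10 : 0 < k1 := lt_le_trans ltr01 k11.
have k1k : 1 <= kappa * k1.
  have : kappa^-1 <= k1 by rewrite le_max lexx orbT.
  by move=> h; have := ler_wpM2l (ltW k0) h; rewrite mulfV // gt_eqF.
(* At most c ln n rounds lead from n^r edges down to M >= 1; the summand 1 covers the rounding, as
   ln n >= 1. *)
pose c := r%:R / ln gam + 1.
pose e1 : R := expR 1.
have e10 : 0 < e1 := expR_gt0 1.
pose C1 := e1 * k1 + C0 * (ln gam * c ^+ 2) + (C0 * (2 * ln gam) + e1 * k1 * gam) / delta ^+ 2.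
have c1 : 1 <= c by rewrite lerDr divr_ge0 // ltW.
have C10 : 0 <= C1.
  have h1 : 0 <= e1 * k1 by rewrite mulr_ge0 // ltW.
  have h2 : 0 <= C0 * (ln gam * c ^+ 2).
    by rewrite !mulr_ge0 ?exprn_ge0 ?(ltW C00) ?(ltW lng) // (le_trans ler01).
  have h3 : 0 <= C0 * (2 * ln gam) by rewrite !mulr_ge0 ?(ltW C00) ?(ltW lng).
  have h4 : 0 <= e1 * k1 * gam by rewrite mulr_ge0 // ltW.
  have h5 : 0 <= (C0 * (2 * ln gam) + e1 * k1 * gam) / delta ^+ 2.
    by rewrite divr_ge0 ?addr_ge0 // exprn_ge0 // ltW.
  by rewrite /C1 !addr_ge0.
exists (C1 + 1); first by lra.
move=> n p q n0 ln1 p01 pq /andP[q0 q1] XB.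
set X := turan_rate q n in XB *; set D := complete_edges r n.
set K := complete_multipartite s.
have nR : 0 < n%:R :> R by rewrite ltr0n.
have n1 : 1 <= n%:R :> R by rewrite ler1n.
have a2 : (2 <= a_r s)%N := a_r_ge2 hr hs.
have a2R : 2 <= a by rewrite /a ler_nat.
have a0 : 0 < a by lra.
have a00 : a != 0 by rewrite gt_eqF.
have qn0 : (q == 0) = false := gt_eqF q0.
have nn0 : (n%:R == 0 :> R) = false := gt_eqF nR.
have X0 : 0 < X by rewrite /X /turan_rate mulr_gt0 ?powR_gt0.
pose M := k1 * (q `^ (- (1 / a)) * n%:R `^ (r%:R - 1 / a)).
have M0 : 0 < M by rewrite !mulr_gt0 ?powR_gt0.
have qM : q * M = k1 * X.
  have qE : q `^ (1 - 1 / a) = q * q `^ (- (1 / a)).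
    by rewrite powRD ?qn0 ?implybT // powRr1 // ltW.
  by rewrite /M /X /turan_rate qE; ring.
have Ma : M ^+ a_r s = k1 ^+ a_r s * (q^-1 * (n%:R ^+ (r * a_r s) / n%:R)).
  have aa : - (1 / a) * a = -1 by rewrite mulNr mul1r mulVf.
  have ra : (r%:R - 1 / a) * a = (r * a_r s)%:R - 1.
    by rewrite mulrBl mul1r mulVf // natrM.
  have powX (y z : R) k : (y `^ z) ^+ k = y `^ (z * k%:R).
    by rewrite -powR_mulrn ?powR_ge0 // -powRrM.
  rewrite /M 2!exprMn !powX -/a aa ra powR_inv1 ?(ltW q0) //.
  by rewrite powRB ?nn0 ?implybT // powRr1 ?(ltW nR) // powR_mulrn // ltW.
have ia : 1 / a <= 1 by rewrite ler_pdivrMr // mul1r; lra.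
have rR : 2 <= r%:R :> R by rewrite ler_nat.
have M1 : 1 <= M.
  rewrite /M; apply: mulr_ege1 => //; apply: mulr_ege1.
    rewrite -[leLHS](powRr0 q); apply: ger_powR; first by rewrite q0 q1.
    by rewrite oppr_le0 divr_ge0 // ltW.
  by rewrite -[leLHS](powRr0 n%:R); apply: ler_powR => //; lra.
pose B := n%:R `^ (r%:R - b1) : R.
have B0 : 0 <= B := powR_ge0 _ _.
have hcont (G : {set {set 'I_n}}) : G \subset D -> M < #|G|%:R ->
    exists2 b : nat, b%:R <= C0 * B + C0 * X * (M / #|G|%:R) &
      has_containers (fun I => ~~ contains_copy K I) G b ((1 - delta) * #|G|%:R).
  move=> GD MG; have G0 : 0 < #|G|%:R :> R := lt_trans M0 MG.
  have Gr e : e \in G -> #|e| = r by move=> /(fintype.subsetP GD); rewrite inE => /eqP.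
  have nra : n%:R ^+ (r * a_r s) / n%:R = q * (M ^+ a_r s / k1 ^+ a_r s).
    by rewrite Ma; field; rewrite qn0 nn0 expf_neq0 ?gt_eqF.
  have dense : n%:R ^+ (r * a_r s) <= kappa * (n%:R * #|G|%:R ^+ a_r s).
    have le1 : q * (M ^+ a_r s / k1 ^+ a_r s) <= kappa * #|G|%:R ^+ a_r s.
      apply: (@le_trans _ _ (M ^+ a_r s / k1)).
        apply: (@le_trans _ _ (M ^+ a_r s / k1 ^+ a_r s)).
          by rewrite ler_piMl // divr_ge0 ?exprn_ge0 // ltW.
        apply: ler_wpM2l; first by rewrite exprn_ge0 // ltW.
        rewrite lef_pV2 ?posrE ?exprn_gt0 //.
        by rewrite -[leLHS]expr1 ler_weXn2l // (leq_trans _ a2).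
      rewrite mulrC; apply: ler_pM; rewrite ?invr_ge0 ?exprn_ge0 ?(ltW M0) ?(ltW k10) //.
        by rewrite -[leLHS]mul1r ler_pdivrMr.
      by apply: lerXn2r; rewrite ?nnegrE ?(ltW M0) ?(ltW G0) ?(ltW MG).
    have := ler_wpM2l (ltW nR) le1; rewrite -nra [n%:R * (_ / _)]mulrC divfK ?nn0 //.
    by rewrite mulrCA.
  have [b bC hb] := cont n G n0 Gr ltac:(by rewrite -(ltr_nat R)) dense.
  exists b => //; apply: (le_trans bC); rewrite mulrDr lerD2l -mulrA.
  apply: ler_wpM2l; first exact: ltW.
  (* Since a >= 2, the bound X M / |G| is reached with a spare factor (M / |G|)^a' <= 1. *)
  have [a' aE] : exists a', a_r s = a'.+2.
    by exists (a_r s).-2; rewrite prednK ?prednK // ?(ltnW a2) // -ltnS prednK // ltnW.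
  have -> : n%:R ^+ (r * a_r s) / (n%:R * #|G|%:R ^+ (a_r s).-1) =
      X * (M / #|G|%:R) * ((M / #|G|%:R) ^+ a' / k1 ^+ a'.+1).
    have XE : X = q * M / k1 by rewrite qM mulrC mulKf // gt_eqF.
    rewrite invfM mulrA nra XE aE /= !exprS expr_div_n.
    by field; rewrite ?expf_neq0 !gt_eqF.
  have MG1 : M / #|G|%:R <= 1 by rewrite ler_pdivrMr // mul1r ltW.
  have MG0 : 0 <= M / #|G|%:R by rewrite divr_ge0 // ltW.
  apply: ler_piMr; first by rewrite mulr_ge0 // ltW.
  rewrite ler_pdivrMr ?exprn_gt0 // mul1r.
  by apply: (@le_trans _ _ 1); [exact: exprn_ile1|exact: exprn_ege1].
have l0 : 0 <= expR 1 * q by rewrite mulr_ge0 ?(ltW q0) ?(ltW e10).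
pose i := (Num.truncn (r%:R * ln n%:R / ln gam)).+1.
have rl0 : 0 <= r%:R * ln n%:R / ln gam.
  by rewrite divr_ge0 ?(ltW lng) // mulr_ge0 // (le_trans ler01).
have /andP[i1 i2] := truncn_itv rl0.
have Di : #|D|%:R <= M * (1 - delta)^-1 ^+ i.
  rewrite -/gam; apply: (@le_trans _ _ (1 * gam ^+ i)); last first.
    by apply: ler_wpM2r => //; rewrite exprn_ge0 // ltW.
  rewrite mul1r card_complete_edges; apply: (@le_trans _ _ (n%:R ^+ r)).
    by rewrite -natrX ler_nat bin_le_expn.
  rewrite -ler_ln ?posrE ?exprn_gt0 // !lnXn // -[leLHS]mulr_natl -[leRHS]mulr_natl.
  by rewrite -ler_pdivrMr // ltW.
have freeS : forall I J : {set {set 'I_n}}, I \subset J ->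
    ~~ contains_copy K J -> ~~ contains_copy K I.
  by move=> I J IJ; apply: contra; exact: contains_copyS.
have C0B : 0 <= C0 * B by rewrite mulr_ge0 // ltW.
have C0X : 0 <= C0 * X by rewrite mulr_ge0 // ltW.
have Zb := partition_function_bound freeS d01 M0 C0B C0X l0 hcont Di.
apply: (@le_trans _ _ (bern_prob p D (fun H => [exists I : {set {set 'I_n}},
    [&& I \subset H, ~~ contains_copy K I & (C1 + 1) * X <= #|I|%:R]]))).
  apply: bern_prob_le => // H HD hH.
  have m0 : (0 < max_free K H)%N.
    by rewrite -(ltr_nat R); apply: le_lt_trans hH; rewrite mulr_ge0 ?(ltW X0) // addr_ge0.
  have [I /andP[IH If] cI] := max_free_witness m0.
  by apply/existsP; exists I; rewrite IH If cI ltW.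
apply: (le_trans (union_bound _ _ _ p01 pq)).
apply: (le_trans (ler_wpM2l (expR_ge0 _) Zb)).
rewrite -expRD ler_expR.
have ic : i%:R ^+ 2 <= c ^+ 2 * ln n%:R ^+ 2.
  have cl : 0 <= c * ln n%:R by rewrite mulr_ge0 ?(le_trans ler01).
  rewrite -exprMn; apply: lerXn2r; rewrite ?nnegrE //.
  rewrite /i -natr1 /c mulrDl mul1r; apply: lerD => //.
  by rewrite [leRHS]mulrAC.
have BX : B * i%:R ^+ 2 <= c ^+ 2 * X.
  apply: le_trans (ler_wpM2l B0 ic) _; rewrite mulrCA; apply: ler_wpM2l => //.
  by rewrite exprn_ge0 // (le_trans ler01).
have h1 : C0 * B * (ln gam * i%:R ^+ 2) <= C0 * (ln gam * c ^+ 2) * X.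
  rewrite (_ : C0 * B * _ = C0 * ln gam * (B * i%:R ^+ 2)); last by ring.
  rewrite (_ : C0 * (ln gam * c ^+ 2) * X = C0 * ln gam * (c ^+ 2 * X)); last by ring.
  by apply: ler_wpM2l => //; rewrite mulr_ge0 // ltW.
have h2 : expR 1 * q * M = e1 * k1 * X by rewrite -mulrA qM mulrA.
rewrite h2 -/gam.
have h3 : (C0 * X * (2 * ln gam) + e1 * k1 * X * gam) / delta ^+ 2 =
    (C0 * (2 * ln gam) + e1 * k1 * gam) / delta ^+ 2 * X by ring.
rewrite h3 /C1.
set w := (C0 * (2 * ln gam) + e1 * k1 * gam) / delta ^+ 2.
move: h1; move: (C0 * B * _) (C0 * (ln gam * c ^+ 2)) (e1 * k1) w.
by clear => u v z w; lra.
Qed.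
End UpperTail.

(** * Bounds in expectation *)

Section MeanLowerBounds.
Variables (R : realType) (r : nat) (s : 'I_r -> nat).
Hypothesis hr : (2 <= r)%N.
Hypothesis hs : forall i, (2 <= s i)%N.

Let K := complete_multipartite s.
Let a : R := (a_r s)%:R.
Let b1 : R := beta1 s R.
Let mean n p : R := bern_mean (complete_edges r n) p (fun H => (max_free K H)%:R).

Lemma expn_le_bin n : (2 * r <= n)%N -> (n ^ r <= 2 ^ r * r`! * 'C(n, r))%N.
Proof.
move=> rn; have h k : (k <= r)%N -> ((n - r) ^ k <= n ^_ k)%N.
  elim: k => [|k IH] kr; first by rewrite ffactn0.
  by rewrite ffactnSr expnSr; apply: leq_mul; [exact: IH (ltnW kr)|lia].
rewrite -mulnA [(r`! * _)%N]mulnC bin_ffact.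
apply: leq_trans (leq_mul (leqnn _) (h r (leqnn r))).
by rewrite -expnMn leq_exp2r; lia.
Qed.

(** Thinning to eps p': by the choice of beta1 the expected number of copies is at most eps p' times
    eps n^r, and the second eps, available because a copy has several edges, makes this at most half
    the expected number of edges. The sparse range takes p' = p, the middle range p' =
    n^(-beta1). *)
Lemma mean_lower_sparse : exists2 c : R, 0 < c & forall n (p p' : R),
  (2 * r <= n)%N -> 0 < p' -> p' <= p -> p <= 1 -> p' <= n%:R `^ (- b1) ->
  c * (p' * n%:R ^+ r) <= mean n p.
Proof.
pose cr : R := (2 ^ r * r`!)%:R^-1.
have cr0 : 0 < cr by rewrite invr_gt0 ltr0n muln_gt0 expn_gt0 fact_gt0.
pose eps := Num.min 2^-1 (cr / 2).
have eps0 : 0 < eps by rewrite lt_min invr_gt0 ltr0n divr_gt0.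
have eps1 : eps <= 2^-1 by rewrite ge_min lexx.
have epsc : eps <= cr / 2 by rewrite ge_min lexx orbT.
exists (eps * (cr / 2)); first by rewrite mulr_gt0 // divr_gt0.
move=> n p p' rn p'0 p'p p1 p'b.
have n0 : (0 < n)%N by lia.
have nR : 0 < n%:R :> R by rewrite ltr0n.
have p0 : 0 < p := lt_le_trans p'0 p'p.
have i0 : 'I_r := Ordinal (ltnW hr).
have k4 : (4 <= #|multipartite_edges s|)%N.
  exact: leq_trans (a_r1_ge hr hs) (card_multipartite_edges hr hs).
have [e0 e0E] : exists e0, e0 \in edges K.
  by apply/set0Pn; rewrite -card_gt0 (leq_trans _ k4).
have ep : 0 <= eps * p' <= p.
  by rewrite mulr_ge0 ?(ltW eps0) ?(ltW p'0) //= (le_trans _ p'p) // ler_piMl ?(ltW p'0) //; lra.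
have p01 : 0 < p <= 1 by rewrite p0 p1.
apply: le_trans (mean_max_free_thinning e0E n p01 ep).
have cD : cr * n%:R ^+ r <= #|complete_edges r n|%:R.
  rewrite card_complete_edges /cr mulrC ler_pdivrMr ?ltr0n ?muln_gt0 ?expn_gt0 ?fact_gt0 //.
  by rewrite -natrX -natrM ler_nat mulnC expn_le_bin.
have W_E : #|{: part_vertex s}| = (\sum_i s i)%N by exact: card_part_vertex.
set k := #|edges K|; set v := #|{: part_vertex s}|.
pose k1 := a_r1 s.
have k1k : (k1 <= k)%N := card_multipartite_edges hr hs.
have k14 : (4 <= k1)%N := a_r1_ge hr hs.
have ep1 : eps * p' <= 1.
  by rewrite mulr_ile1 ?(ltW eps0) ?(ltW p'0) ?(le_trans p'p) //; lra.
have powk : (eps * p') ^+ k <= eps * (p' * (eps * p' ^+ k1.-1)).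
  apply: (@le_trans _ _ ((eps * p') ^+ k1)).
    by apply: ler_wiXn2l => //; case/andP: ep.
  rewrite -{1}(prednK (leq_trans _ k14)) // exprS exprMn -!mulrA.
  rewrite !ler_pM2l //.
  apply: ler_wpM2r; first by rewrite exprn_ge0 // ltW.
  have [k' ->] : exists k', k1.-1 = k'.+1 by move: (k1) k14; case=> [|[|k']] // _; exists k'.
  have eps_le1 : eps <= 1 by apply: le_trans eps1 _; rewrite invf_le1 // ler1n.
  by rewrite exprS ler_piMr ?(ltW eps0) // exprn_ile1 ?(ltW eps0).
have pn : p' ^+ k1.-1 * n%:R ^+ v <= n%:R ^+ r.
  apply: (@le_trans _ _ ((n%:R `^ (- b1)) ^+ k1.-1 * n%:R ^+ v)).
    apply: ler_wpM2r; first by rewrite exprn_ge0 // ltW.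
    by apply: lerXn2r; rewrite ?nnegrE ?powR_ge0 // ltW.
  rewrite -!powR_mulrn ?powR_ge0 ?(ltW nR) // -powRrM -powRD; last first.
    by rewrite (gt_eqF nR) implybT.
  rewrite (_ : - b1 * k1.-1%:R + v%:R = r%:R) //.
  have -> : k1.-1%:R = k1%:R - 1 :> R by rewrite -[in RHS](prednK (leq_trans _ k14)) // -natr1 addrK.
  by rewrite mulNr (beta1E R hr hs) /v W_E natr_sum; ring.
have pn' := ler_wpM2l (ltW (mulr_gt0 (mulr_gt0 eps0 p'0) eps0)) pn.
have step : (eps * p') ^+ k * n%:R ^+ v <= eps * p' * (cr / 2 * n%:R ^+ r).
  apply: (@le_trans _ _ (eps * (p' * (eps * p' ^+ k1.-1)) * n%:R ^+ v)).
    by apply: ler_wpM2r => //; rewrite exprn_ge0 // ltW.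
  apply: (@le_trans _ _ (eps * p' * eps * n%:R ^+ r)).
    by apply: le_trans pn'; rewrite le_eqVlt; apply/orP; left; apply/eqP; ring.
  rewrite -mulrA; apply: ler_wpM2l; first by rewrite mulr_ge0 // ltW.
  by apply: ler_wpM2r => //; rewrite exprn_ge0 // ltW.
suff fin : eps * (cr / 2) * (p' * n%:R ^+ r) <=
    eps * p' * #|complete_edges r n|%:R - (eps * p') ^+ k * n%:R ^+ v by exact: fin.
move: step (ler_wpM2l (ltW (mulr_gt0 eps0 p'0)) cD).
move: (eps) (n%:R ^+ r) #|complete_edges r n|%:R ((eps * p') ^+ k * _) => e T Z Y.
by clear; lra.
Qed.

(** With m colours the construction keeps about p ex(m, K) (n / m)^r edges, at least of order p n^r
    m^(-1/a); m of order p n gives the rate. The condition m1 <= p n puts m where the extremal bound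
    is available. *)
Lemma mean_lower_dense (c : R) (m1 : nat) : 0 < c ->
  (forall m, (m1 <= m)%N -> c * m%:R `^ (r%:R - 1 / a) <= (turan m K)%:R) ->
  exists2 c' : R, 0 < c' & forall n (p : R), (0 < n)%N -> (m1 <= n)%N -> 0 <= p <= 1 ->
    1 <= p * n%:R -> m1%:R <= p * n%:R -> c' * turan_rate s p n <= mean n p.
Proof.
move=> c0 ex_lower.
have r0 : 0 < r%:R :> R by rewrite ltr0n ltnW.
have rR : 2 <= r%:R :> R by rewrite ler_nat.
exists (c / (2 ^+ r.+1 * (3 * r%:R))); first by rewrite divr_gt0 // !mulr_gt0 // exprn_gt0.
move=> n p n0 m1n /andP[p0 p1] pn1 pnm.
have nR : 0 < n%:R :> R by rewrite ltr0n.
pose x := 2 * r%:R * (p * n%:R).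
have x0 : 0 <= x by rewrite !mulr_ge0 // ltW.
have /andP[x1 x2] := truncn_itv x0.
(* More than 2 r p n colours keep the expected number of conflicts of an edge at most 1/2; if this
   would exceed n, all vertices get different colours and no conflict occurs. *)
pose m := minn n (Num.truncn x).+1.
have m0 : (0 < m)%N by rewrite leq_min n0.
have mn : (m <= n)%N by rewrite geq_minl.
have m1m : (m1 <= m)%N.
  rewrite leq_min m1n -(ler_nat R); apply: (le_trans pnm); apply: ltW; apply: le_lt_trans x2.
  by rewrite /x ler_peMl //; lra.
have mR : 0 < m%:R :> R by rewrite ltr0n.
have m_le : m%:R <= 3 * r%:R * (p * n%:R).
  apply: (@le_trans _ _ (Num.truncn x).+1%:R); first by rewrite ler_nat geq_minr.
  rewrite -natr1; have : x + 1 <= 3 * r%:R * (p * n%:R) by rewrite /x; nra.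
  lra.
have small : p * (r * (n.-1 %/ m))%:R <= 2^-1.
  have [e|lt] := eqVneq m n.
    by rewrite e divn_small ?muln0 ?mulr0 ?invr_ge0 // prednK.
  have mE : m = (Num.truncn x).+1.
    move: lt; rewrite /m; have [h|h] := leqP n (Num.truncn x).+1.
      by rewrite eqxx.
    by [].
  have d1 : (n.-1 %/ m)%:R * m%:R <= n%:R :> R.
    by rewrite -natrM ler_nat (leq_trans (leq_divM _ _)) // leq_pred.
  have d2 : x <= m%:R by rewrite mE ltW.
  rewrite natrM -(ler_pM2r mR).
  have : p * r%:R * ((n.-1 %/ m)%:R * m%:R) <= p * r%:R * n%:R.
    by apply: ler_wpM2l => //; rewrite mulr_ge0 // ltW.
  by move: d2; rewrite /x; lra.
have [Gm GmP cGm] : exists2 Gm : {set {set 'I_m}},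
    (forall e, e \in Gm -> #|e| = r) /\ ~~ contains_copy K Gm & #|Gm| = turan m K.
  have tpos : (0 < turan m K)%N.
    rewrite -(ltr_nat R); apply: lt_le_trans (ex_lower m m1m).
    by rewrite mulr_gt0 ?powR_gt0.
  have tE : turan m K = max_free K (edges (full_rgraph r 'I_m)) by rewrite /turan turan_inE.
  rewrite tE in tpos *; have [G /andP[GD Gf] cG] := max_free_witness tpos.
  exists G => //; split=> // e /(fintype.subsetP GD); rewrite inE => /eqP.
  by [].
have p01 : 0 <= p <= 1 by rewrite p0 p1.
apply: le_trans (mean_max_free_coloring hr hs m0 mn GmP.1 GmP.2 p01 small).
rewrite cGm natrM natrX.
have b_ge : n%:R / (2 * m%:R) <= (n %/ m)%:R :> R.
  rewrite ler_pdivrMr ?mulr_gt0 //.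
  have : (n < (n %/ m).+1 * m)%N by rewrite ltn_ceil.
  have : (0 < n %/ m)%N by rewrite divn_gt0.
  rewrite -(ler_nat R) -(ltr_nat R) natrM -natr1; nra.
have t_ge := ex_lower m m1m.
have pow_b : (n%:R / (2 * m%:R)) ^+ r <= (n %/ m)%:R ^+ r :> R.
  by apply: lerXn2r; rewrite ?nnegrE ?divr_ge0 ?mulr_ge0 // ltW.
have main : c * m%:R `^ (r%:R - 1 / a) * (n%:R / (2 * m%:R)) ^+ r <=
    (turan m K)%:R * (n %/ m)%:R ^+ r.
  by apply: ler_pM => //; rewrite ?mulr_ge0 ?powR_ge0 ?exprn_ge0 ?divr_ge0 ?mulr_ge0 // ltW.
apply: le_trans (ler_wpM2l (divr_ge0 p0 (ler0n _ 2)) main).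
have nn0 : (n%:R == 0 :> R) = false := gt_eqF nR.
have mm0 : (m%:R == 0 :> R) = false := gt_eqF mR.
have pp : 0 < p by rewrite lt_neqAle p0 andbT; apply: contraTneq pn1 => <-; rewrite mul0r -ltNge.
have -> : c * m%:R `^ (r%:R - 1 / a) * (n%:R / (2 * m%:R)) ^+ r =
    c / 2 ^+ r * n%:R ^+ r * m%:R `^ (- (1 / a)).
  rewrite powRD ?mm0 ?implybT // powR_mulrn ?(ltW mR) // expr_div_n exprMn; field.
  by rewrite !expf_neq0 ?mm0 ?pnatr_eq0.
have a2 : 2 <= a by rewrite /a ler_nat a_r_ge2.
have ia1 : 1 / a <= 1 by rewrite ler_pdivrMr ?mul1r; lra.
have ia0 : 0 <= 1 / a by rewrite divr_ge0 //; lra.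
have m_pow : (3 * r%:R)^-1 * (p * n%:R) `^ (- (1 / a)) <= m%:R `^ (- (1 / a)).
  rewrite !powRN -invfM lef_pV2 ?posrE ?mulr_gt0 ?powR_gt0 ?mulr_gt0 //.
  apply: (@le_trans _ _ ((3 * r%:R * (p * n%:R)) `^ (1 / a))).
    by apply: ge0_ler_powR; rewrite ?nnegrE ?mulr_ge0 ?invr_ge0 ?(le_trans _ a2).
  rewrite powRM ?mulr_ge0 ?(ltW nR) ?(ltW r0) //; apply: ler_wpM2r; first exact: powR_ge0.
  by apply: ler1_powR => //; lra.
have -> : c / (2 ^+ r.+1 * (3 * r%:R)) * turan_rate s p n =
    p / 2 * (c / 2 ^+ r * n%:R ^+ r) * ((3 * r%:R)^-1 * (p * n%:R) `^ (- (1 / a))).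
  rewrite /turan_rate powRM ?(ltW pp) ?(ltW nR) //.
  rewrite [p `^ _]powRD ?(gt_eqF pp) ?implybT // powRr1 ?(ltW pp) //.
  rewrite [n%:R `^ (r%:R - _)]powRD ?nn0 ?implybT // powR_mulrn ?(ltW nR) // exprS -/a; field.
  by rewrite (gt_eqF r0) expf_neq0 ?pnatr_eq0.
rewrite [leRHS]mulrA; apply: ler_wpM2l => //.
by rewrite !mulr_ge0 ?invr_ge0 ?exprn_ge0 ?(ltW c0) ?(ltW nR).
Qed.

Lemma lower_tail n (p L : R) : 0 <= p <= 1 -> 0 < L -> 2 * L <= mean n p ->
  bern_prob p (complete_edges r n) (fun H => (max_free K H)%:R < L) <=
  p * n%:R ^+ r / L ^+ 2.
Proof.
move=> p01 L0 Lm; have /andP[p0 _] := p01.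
apply: (@le_trans _ _ (#|complete_edges r n|%:R * p / L ^+ 2)); last first.
  rewrite ler_pM2r ?invr_gt0 ?exprn_gt0 // mulrC; apply: ler_wpM2l => //.
  by rewrite -natrX ler_nat card_complete_edges bin_le_expn.
apply: (bern_chebyshev p01 (@max_free_lipschitz R r _ K n) L0) => H HD HL.
rewrite -/(mean n p) distrC ger0_norm; lra.
Qed.

Lemma edge_count_tail n (p : R) : 0 <= p <= 1 -> 0 < p * n%:R ^+ r ->
  bern_prob p (complete_edges r n) (fun H => 2 * (p * n%:R ^+ r) < (max_free K H)%:R) <=
  (p * n%:R ^+ r)^-1.
Proof.
move=> p01 L0; have /andP[p0 _] := p01; set L := p * n%:R ^+ r in L0 *.
have cD : #|complete_edges r n|%:R <= n%:R ^+ r :> R.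
  by rewrite -natrX ler_nat card_complete_edges bin_le_expn.
have pD : p * #|complete_edges r n|%:R <= L by exact: ler_wpM2l.
apply: (@le_trans _ _ (#|complete_edges r n|%:R * p / L ^+ 2)); last first.
  rewrite ler_pdivrMr ?exprn_gt0 // expr2 mulrA mulVf ?gt_eqF // mul1r mulrC.
  exact: pD.
apply: (bern_chebyshev p01 (@card_lipschitz R r n) L0) => H HD HL.
have : (max_free K H)%:R <= #|H|%:R :> R by rewrite ler_nat max_free_le_card.
rewrite bern_mean_card => h; rewrite ger0_norm; lra.
Qed.

End MeanLowerBounds.

(** * Asymptotics *)

Section Asymptotics.
Variable R : realType.

Lemma ln_large (A : R) : \forall n \near \oo%classic, A <= ln (n%:R : R).
Proof.
near=> n; have An : expR A <= n%:R by near: n; exact: nbhs_infty_ger.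
by rewrite -(expRK A) ler_ln ?posrE ?expR_gt0 // (lt_le_trans (expR_gt0 A)).
Unshelve. all: end_near. Qed.

Lemma powR_expR (x y : R) : 0 < x -> x `^ y = expR (y * ln x).
Proof. by move=> x0; rewrite /powR gt_eqF. Qed.

Lemma powR_ge_ln (n y : R) : 0 < n -> y * ln n <= n `^ y.
Proof.
move=> n0; rewrite powR_expR //; apply: le_trans (expR_ge1Dx _).
by rewrite lerDr.
Qed.

Section Between.
Variables (r : nat) (W : finType) (F : rgraph r W).

(** The rate 1 / ln n is slow enough to serve the tails of all three ranges. *)
Lemma aas_between (p L U : nat -> R) (E : R) : (forall n, 0 <= p n <= 1) ->
  (\forall n \near \oo%classic,
     bern_prob (p n) (complete_edges r n) (fun H => (max_free F H)%:R < L n) <= E / ln n%:R /\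
     bern_prob (p n) (complete_edges r n) (fun H => U n < (max_free F H)%:R) <= E / ln n%:R) ->
  aas_turan_between F p L U.
Proof.
move=> p01 tails; rewrite /aas_turan_between /aas; apply/cvgrPdist_le => e e0.
near=> n.
have [t1 t2] : bern_prob (p n) (complete_edges r n) (fun H => (max_free F H)%:R < L n) <= E / ln n%:R /\
     bern_prob (p n) (complete_edges r n) (fun H => U n < (max_free F H)%:R) <= E / ln n%:R.
  by near: n.
have ln1 : 1 <= ln (n%:R : R) by near: n; exact: ln_large.
have lnE : 2 * E / e <= ln (n%:R : R) by near: n; exact: ln_large.
pose B (H : {set {set 'I_n}}) := L n <= (max_free F H)%:R <= U n.
rewrite (@Hnp_probE R r n (p n) _ B); last by move=> H; rewrite /B turan_inE.
have le1 := bern_prob_le1 (p01 n) (complete_edges r n) B.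
have ge1 : 1 - bern_prob (p n) (complete_edges r n) (fun H => (max_free F H)%:R < L n) -
    bern_prob (p n) (complete_edges r n) (fun H => U n < (max_free F H)%:R) <=
    bern_prob (p n) (complete_edges r n) B.
  apply: bern_prob_union => // H _; rewrite /B.
  by case: leP => //= _; rewrite ?orbT //; case: leP.
have Ee : E / ln n%:R <= e / 2.
  rewrite ler_pdivrMr ?(lt_le_trans ltr01) //.
  by move: lnE; rewrite ler_pdivrMr //; lra.
rewrite ger0_norm ?subr_ge0 //; lra.
Unshelve. all: end_near. Qed.

End Between.
End Asymptotics.

(** * The three ranges of p *)

Section Main.
Variables (R : realType) (r : nat) (s : 'I_r -> nat).
Hypothesis hr : (2 <= r)%N.
Hypothesis hs : forall i, (2 <= s i)%N.

Let K := complete_multipartite s.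
Let a : R := (a_r s)%:R.
Let b1 : R := beta1 s R.
Let b2 : R := beta2 s R.
Let p0 (n : nat) : R := n%:R `^ (- (r%:R / 2)) * ln n%:R.
Let p1 (n : nat) : R := n%:R `^ (- b1).
Let p2 (n : nat) : R := n%:R `^ (- b2) * ln n%:R `^ (2 * a / (a - 1)).

Let rR : 2 <= r%:R :> R. Proof. by rewrite ler_nat. Qed.
Let a2 : 2 <= a. Proof. by rewrite /a ler_nat a_r_ge2. Qed.
Let b1_lt1 : b1 < 1. Proof. exact: beta1_lt1. Qed.

Let large_n (A : R) (m : nat) : \forall n \near \oo%classic,
  [/\ (m <= n)%N, 1 <= ln (n%:R : R) & A <= ln (n%:R : R)].
Proof.
near=> n; split; near: n; [exact: nbhs_infty_ge|exact: ln_large|exact: ln_large].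
Unshelve. all: end_near. Qed.

(** Chebyshev leaves failure probabilities of order 1 / (p n^r), and p >= p0 makes p n^r at least ln
    n. *)
Lemma sparse_range : exists c C : R, [/\ 0 < c, 0 < C &
  forall p : nat -> R, prob_between p0 p1 p ->
    aas_turan_between K p (fun n => c * (p n * n%:R ^+ r)) (fun n => C * (p n * n%:R ^+ r))].
Proof.
have [cs cs0 lower] := mean_lower_sparse R hr hs.
pose c := cs / 2; have c0 : 0 < c by rewrite divr_gt0.
exists c, 2; split => // p [p01 pb].
apply: (@aas_between R _ _ K p _ _ (c ^- 2 + 1)) => //; near=> n.
have [n1 ln1 _] : [/\ (2 * r + 1 <= n)%N, 1 <= ln (n%:R : R) & 0 <= ln (n%:R : R)].
  by near: n; exact: large_n.
have /andP[pl pu] : p0 n <= p n <= p1 n by near: n.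
have n0 : (0 < n)%N by apply: leq_trans n1; rewrite addn1.
have rn : (2 * r <= n)%N by apply: leq_trans n1; rewrite leq_addr.
have nR : 0 < n%:R :> R by rewrite ltr0n.
have nge1 : 1 <= n%:R :> R by rewrite ler1n.
have ln0 : 0 < ln (n%:R : R) by exact: lt_le_trans ln1.
have pn_ge : ln (n%:R : R) <= p n * n%:R ^+ r.
  apply: (@le_trans _ _ (p0 n * n%:R ^+ r)); last by apply: ler_wpM2r => //; rewrite exprn_ge0 // ltW.
  rewrite /p0 mulrAC -powR_mulrn ?(ltW nR) // -powRD ?(gt_eqF nR) ?implybT //.
  apply: ler_peMl; first exact: ltW.
  rewrite -[leLHS](powRr0 n%:R); apply: ler_powR => //.
  by have := rR; lra.
have pn_gt0 : 0 < p n * n%:R ^+ r by exact: lt_le_trans pn_ge.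
have pgt0 : 0 < p n by move: pn_gt0; rewrite pmulr_lgt0 // exprn_gt0.
have inv_le : (p n * n%:R ^+ r)^-1 <= (ln n%:R)^-1 by rewrite lef_pV2 ?posrE.
have c2 : 0 <= c ^- 2 by rewrite invr_ge0 exprn_ge0 // ltW.
have linv : 0 <= (ln n%:R)^-1 :> R by rewrite invr_ge0 ltW.
split.
  have L0 : 0 < c * (p n * n%:R ^+ r) by rewrite mulr_gt0.
  have Lm : 2 * (c * (p n * n%:R ^+ r)) <=
      bern_mean (complete_edges r n) (p n) (fun H => (max_free K H)%:R).
    rewrite mulrA (_ : 2 * c = cs); last by rewrite /c mulrC divfK.
    apply: lower => //; by case/andP: (p01 n).
  apply: le_trans (lower_tail (p01 n) L0 Lm) _.
  move: pn_gt0 inv_le; set P := p n * _ => P0 inv_le.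
  have -> : P / (c * P) ^+ 2 = c ^- 2 / P by field; rewrite !gt_eqF.
  rewrite mulrDl.
  apply: le_trans (ler_wpM2l c2 inv_le) _.
  by rewrite lerDl mul1r.
apply: le_trans (edge_count_tail s (p01 n) pn_gt0) _.
apply: le_trans inv_le _; rewrite mulrDl mul1r lerDr mulr_ge0 //.
Unshelve. all: end_near. Qed.

(** Origin of the logarithmic power in the threshold: (2 a / (a - 1)) (1 - 1 / a) = 2, exactly the
    (ln n)^2 that [upper_tail] asks for. *)
Lemma turan_rate_p2 (n : nat) : (0 < n)%N -> 0 < ln (n%:R : R) ->
  turan_rate s (p2 n) n = n%:R `^ (r%:R - b1) * ln n%:R ^+ 2.
Proof.
move=> n0 ln0; have nR : 0 < n%:R :> R by rewrite ltr0n.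
have a1 : 0 < a - 1 by have := a2; lra.
have a0 : 0 < a by have := a2; lra.
rewrite /turan_rate -/a /p2 powRM ?powR_ge0 // -!powRrM mulrAC -powRD ?(gt_eqF nR) ?implybT //.
congr (_ * _).
  congr (_ `^ _); have E := beta2E R hr hs; rewrite -/a -/b1 -/b2 in E.
  have -> : - b2 * (1 - 1 / a) = - ((a - 1) * b2) / a by field; rewrite gt_eqF.
  by rewrite E; field; rewrite gt_eqF.
rewrite -powR_mulrn ?(ltW ln0) //; congr (_ `^ _).
by field; rewrite !gt_eqF.
Qed.

(** The power of n wins because ln ln n <= 2 sqrt (ln n). The middle range applies [upper_tail] at q
    = p2, which requires 0 < q <= 1. *)
Lemma p2_le1 : exists A : R, forall n : nat, (0 < n)%N -> 1 <= ln (n%:R : R) -> A <= ln (n%:R : R) ->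
  0 < p2 n <= 1.
Proof.
have b20 : 0 < b2 := beta2_gt0 R hr hs.
have a1 : 0 < a - 1 by have := a2; lra.
have a0 : 0 < a by have := a2; lra.
pose g := 2 * a / (a - 1); have g0 : 0 < g by rewrite divr_gt0 // mulr_gt0.
exists ((2 * g / b2) ^+ 2) => n n0 ln1 lnA.
have nR : 0 < n%:R :> R by rewrite ltr0n.
have ln0 : 0 < ln (n%:R : R) by exact: lt_le_trans ln1.
rewrite mulr_gt0 ?powR_gt0 //= /p2 !powR_expR // -expRD -[leRHS](@expR0 R) ler_expR -/g.
set u := ln (n%:R : R) in ln1 lnA ln0 *.
pose v := Num.sqrt u; have v0 : 0 < v by rewrite sqrtr_gt0.
have uv : u = v ^+ 2 by rewrite sqr_sqrtr // ltW.
have lnu : ln u <= 2 * v.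
  by rewrite uv lnXn // -[leLHS]mulr_natl ler_pM2l // ltW // ln_sublinear.
have q0 : 0 <= 2 * g / b2.
  by apply: ltW; apply: divr_gt0 => //; apply: mulr_gt0.
have vA : 2 * g / b2 <= v.
  by rewrite -(@ler_pXn2r _ 2) ?nnegrE ?(ltW v0) // -uv.
have h1 : g * ln u <= g * (2 * v) by apply: ler_wpM2l => //; exact: ltW.
have h2 : 2 * g <= v * b2 by have := vA; rewrite ler_pdivrMr.
have h3 : v * (2 * g) <= v * (v * b2) by apply: ler_wpM2l => //; exact: ltW.
rewrite mulNr addrC subr_le0; apply: (le_trans h1); rewrite uv.
have -> : g * (2 * v) = v * (2 * g) by ring.
have -> : b2 * v ^+ 2 = v * (v * b2) by ring.
exact: h3.
Qed.

(** The lower bound is the one at p1, reached by thinning, and the upper bound the one at p2. In the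
    lower tail p <= 1 suffices: variance over squared mean is at most of order n^(-g) with g = r - 2
    beta1 > 0. *)
Lemma middle_range_tails : exists c C E : R, [/\ 0 < c, 0 < C &
  forall p : nat -> R, prob_between p1 p2 p ->
    \forall n \near \oo%classic,
     bern_prob (p n) (complete_edges r n)
       (fun H => (max_free K H)%:R < c * n%:R `^ (r%:R - b1)) <= E / ln n%:R /\
     bern_prob (p n) (complete_edges r n)
       (fun H => C * (n%:R `^ (r%:R - b1) * ln n%:R ^+ 2) < (max_free K H)%:R) <= E / ln n%:R].
Proof.
have [cs cs0 lower] := mean_lower_sparse R hr hs.
have [C C0 upper] := upper_tail R hr hs.
have [A hA] := p2_le1.
pose c := cs / 2; have c0 : 0 < c by rewrite divr_gt0.
pose g := r%:R - 2 * b1; have g0 : 0 < g by rewrite /g; have := b1_lt1; have := rR; lra.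
exists c, C, (c ^- 2 / g + 1); split => // p [p01 pb]; near=> n.
have [n1 ln1 lnA] : [/\ (2 * r + 1 <= n)%N, 1 <= ln (n%:R : R) & A <= ln (n%:R : R)].
  by near: n; exact: large_n.
have /andP[pl pu] : p1 n <= p n <= p2 n by near: n.
have n0 : (0 < n)%N by apply: leq_trans n1; rewrite addn1.
have rn : (2 * r <= n)%N by apply: leq_trans n1; rewrite leq_addr.
have nR : 0 < n%:R :> R by rewrite ltr0n.
have nn0 : (n%:R == 0 :> R) = false := gt_eqF nR.
have nge1 : 1 <= n%:R :> R by rewrite ler1n.
have ln0 : 0 < ln (n%:R : R) by exact: lt_le_trans ln1.
have linv : 0 <= (ln n%:R)^-1 :> R by rewrite invr_ge0 ltW.
have p1pos : 0 < p1 n by exact: powR_gt0.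
have c2 : 0 < c ^- 2 by rewrite invr_gt0 exprn_gt0.
have [pn0 pn1] := andP (p01 n).
set X := n%:R `^ (r%:R - b1) : R.
have X0 : 0 < X by exact: powR_gt0.
split.
  have L0 : 0 < c * X by rewrite mulr_gt0.
  have Lm : 2 * (c * X) <=
      bern_mean (complete_edges r n) (p n) (fun H => (max_free K H)%:R).
    rewrite mulrA (_ : 2 * c = cs); last by rewrite /c mulrC divfK.
    rewrite (_ : X = p1 n * n%:R ^+ r); last first.
      by rewrite /X /p1 powRD ?nn0 ?implybT // powR_mulrn ?(ltW nR) // mulrC.
    exact: lower.
  apply: le_trans (lower_tail (p01 n) L0 Lm) _.
  apply: (@le_trans _ _ (n%:R ^+ r / (c * X) ^+ 2)).
    apply: ler_wpM2r; first by rewrite invr_ge0 exprn_ge0 // ltW.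
    by rewrite ler_piMl // exprn_ge0 // ltW.
  have -> : n%:R ^+ r / (c * X) ^+ 2 = c ^- 2 * (n%:R `^ g)^-1.
    have XE : X ^+ 2 = n%:R ^+ r * n%:R `^ g.
      rewrite -!powR_mulrn ?powR_ge0 ?(ltW nR) // -powRrM -powRD ?nn0 ?implybT //.
      by congr (_ `^ _); rewrite /g; ring.
    by rewrite exprMn XE; field; rewrite !gt_eqF ?exprn_gt0 ?powR_gt0.
  rewrite mulrDl; apply: (@le_trans _ _ (c ^- 2 / g / ln n%:R)); last by rewrite lerDl mul1r.
  have -> : c ^- 2 / g / ln n%:R = c ^- 2 * (g * ln n%:R)^-1 by field; rewrite !gt_eqF.
  apply: ler_wpM2l; first exact: ltW.
  by rewrite lef_pV2 ?posrE ?powR_gt0 ?mulr_gt0 // powR_ge_ln.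
have q01 := hA n n0 ln1 lnA.
have := upper n (p n) (p2 n) n0 ln1 (p01 n) pu q01.
rewrite turan_rate_p2 // => /(_ (lexx _)); rewrite -/K -/X => h.
apply: le_trans h _; rewrite expRN mulrDl mul1r.
have X1 : 1 <= X.
  rewrite /X -[leLHS](powRr0 n%:R); apply: ler_powR => //.
  by have := b1_lt1; have := rR; lra.
apply: (@le_trans _ _ (ln n%:R)^-1); last by rewrite lerDr mulr_ge0 // divr_ge0 // ltW.
rewrite lef_pV2 ?posrE ?expR_gt0 //; apply: le_trans (expR_ge1Dx _).
rewrite -[leLHS]add0r; apply: lerD => //; rewrite -[leLHS]mul1r; apply: ler_pM => //.
  by rewrite ltW.
by rewrite expr2 ler_peMl // ltW.
Unshelve. all: end_near. Qed.

Lemma middle_range : exists c C : R, [/\ 0 < c, 0 < C &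
  forall p : nat -> R, prob_between p1 p2 p ->
    aas_turan_between K p (fun n => c * n%:R `^ (r%:R - b1))
      (fun n => C * (n%:R `^ (r%:R - b1) * ln n%:R ^+ 2))].
Proof.
have [c [C [E [c0 C0 tails]]]] := middle_range_tails.
exists c, C; split => // p pb; apply: (@aas_between R _ _ K p _ _ E); first by case: pb.
exact: tails.
Qed.

(** With d n = 1 / sqrt (ln n), the factor n^(d n) = exp (sqrt (ln n)) beats both C (ln n)^2 and 1 /
    c, uniformly in p. *)
Lemma middle_range_o1 : exists2 d : nat -> R, (d @ \oo --> (0 : R))%classic &
  forall p : nat -> R, prob_between p1 p2 p ->
    aas_turan_between K p (fun n => n%:R `^ (r%:R - b1 - d n))
      (fun n => n%:R `^ (r%:R - b1 + d n)).
Proof.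
have [c [C [E [c0 C0 tails]]]] := middle_range_tails.
pose d (n : nat) : R := (Num.sqrt (ln n%:R))^-1.
exists d.
  apply/cvgrPdist_le => e e0; near=> n.
  have ln1 : 1 <= ln (n%:R : R) by near: n; exact: ln_large.
  have lne : e ^- 2 <= ln (n%:R : R) by near: n; exact: ln_large.
  have ln0 : 0 < ln (n%:R : R) by exact: lt_le_trans ln1.
  have v0 : 0 < Num.sqrt (ln n%:R) :> R by rewrite sqrtr_gt0.
  rewrite sub0r normrN /d ger0_norm ?invr_ge0 ?(ltW v0) //.
  rewrite invf_ple ?posrE // -(@ler_pXn2r _ 2) ?nnegrE ?invr_ge0 ?(ltW e0) ?(ltW v0) //.
  by rewrite sqr_sqrtr ?(ltW ln0) // exprVn.
move=> p pb; have [p01 _] := pb.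
apply: (@aas_between R _ _ K p _ _ E) => //; near=> n.
have [t1 t2] : bern_prob (p n) (complete_edges r n)
       (fun H => (max_free K H)%:R < c * n%:R `^ (r%:R - b1)) <= E / ln n%:R /\
     bern_prob (p n) (complete_edges r n)
       (fun H => C * (n%:R `^ (r%:R - b1) * ln n%:R ^+ 2) < (max_free K H)%:R) <= E / ln n%:R.
  by near: n; exact: tails.
have [n0 ln1 lnA] : [/\ (1 <= n)%N, 1 <= ln (n%:R : R) & (c^-1 + 120 * C) ^+ 2 <= ln (n%:R : R)].
  by near: n; exact: large_n.
have nR : 0 < n%:R :> R by rewrite ltr0n.
have nn0 : (n%:R == 0 :> R) = false := gt_eqF nR.
have ln0 : 0 < ln (n%:R : R) by exact: lt_le_trans ln1.
pose v : R := Num.sqrt (ln n%:R); have v0 : 0 < v by rewrite sqrtr_gt0.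
have lv : ln n%:R = v ^+ 2 by rewrite sqr_sqrtr // ltW.
have vA : c^-1 + 120 * C <= v.
  rewrite -(@ler_pXn2r _ 2) ?nnegrE ?(ltW v0) //; first by rewrite -lv.
  by rewrite addr_ge0 ?invr_ge0 ?mulr_ge0 ?(ltW c0) ?(ltW C0).
have nd : n%:R `^ d n = expR v.
  by rewrite powR_expR // /d -/v lv expr2 mulrA mulVf ?mul1r // gt_eqF.
have X0 : 0 < n%:R `^ (r%:R - b1) :> R by exact: powR_gt0.
have ev1 : c^-1 <= expR v.
  apply: (@le_trans _ _ v).
    by apply: le_trans vA; rewrite lerDl mulr_ge0 // ltW.
  by apply: le_trans (expR_ge1Dx v); rewrite lerDr.
(* Since exp v >= v^5 / 5! and ln n = v^2, it is enough that v >= 120 C. *)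
have ev2 : C * ln n%:R ^+ 2 <= expR v.
  apply: le_trans (expR_ge1Dxn 4 (ltW v0)).
  have -> : (5`!)%:R = 120 :> R by [].
  have -> : C * ln n%:R ^+ 2 = 120 * C * v ^+ 4 / 120 by rewrite lv -exprM; field.
  rewrite -[leLHS]add0r; apply: lerD => //; apply: ler_wpM2r; first by rewrite invr_ge0.
  rewrite [leRHS]exprS; apply: ler_wpM2r; first by rewrite exprn_ge0 // ltW.
  by apply: le_trans vA; rewrite lerDr invr_ge0 ltW.
split.
  apply: le_trans t1; apply: bern_prob_le => // H _ hH; apply: (lt_le_trans hH).
  rewrite powRB ?nn0 ?implybT // nd ler_pdivrMr ?expR_gt0 // mulrAC.
  rewrite ler_peMl ?(ltW X0) // -ler_pdivrMl // mulr1.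
  exact: ev1.
apply: le_trans t2; apply: bern_prob_le => // H _ hH; apply: le_lt_trans hH.
rewrite [n%:R `^ (_ + d n)]powRD ?nn0 ?implybT // nd mulrCA.
by apply: ler_wpM2l => //; exact: ltW.
Unshelve. all: end_near. Qed.

Lemma dense_range : (exists2 c : R, 0 < c &
     \forall n \near \oo%classic,
       c * n%:R `^ (r%:R - 1 / a) <= (turan n K)%:R) ->
  exists c C : R, [/\ 0 < c, 0 < C &
        forall p : nat -> R, prob_between p2 (fun=> 1) p ->
          aas_turan_between K p
            (fun n => c * (p n `^ (1 - 1 / a) * n%:R `^ (r%:R - 1 / a)))
            (fun n => C * (p n `^ (1 - 1 / a) * n%:R `^ (r%:R - 1 / a)))].
Proof.
move=> [ct ct0 [m1 _ ex_lower]].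
have [cs cs0 lower] := mean_lower_dense hr hs ct0 ex_lower.
have [C C0 upper] := upper_tail R hr hs.
pose c := cs / 2; have c0 : 0 < c by rewrite divr_gt0.
have b20 : 0 < b2 := beta2_gt0 R hr hs.
have b21 : b2 < 1 by exact: le_lt_trans (beta2_le_beta1 R hr hs) b1_lt1.
have g0 : 0 < 1 - b2 by rewrite subr_gt0.
have a0 : 0 < a by apply: lt_le_trans a2.
exists c, C; split => // p [p01 pb].
apply: (@aas_between R _ _ K p _ _ (c ^- 2 + 1)) => //; near=> n.
have [n1 ln1 lnA] : [/\ (m1 + 1 <= n)%N, 1 <= ln (n%:R : R) &
    (m1%:R + 1) / (1 - b2) <= ln (n%:R : R)].
  by near: n; exact: large_n.
have /andP[pl _] : p2 n <= p n <= 1 by near: n.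
have n0 : (0 < n)%N by apply: leq_trans n1; rewrite addn1.
have m1n : (m1 <= n)%N by apply: leq_trans n1; rewrite leq_addr.
have nR : 0 < n%:R :> R by rewrite ltr0n.
have nn0 : (n%:R == 0 :> R) = false := gt_eqF nR.
have nge1 : 1 <= n%:R :> R by rewrite ler1n.
have ln0 : 0 < ln (n%:R : R) by exact: lt_le_trans ln1.
have linv : 0 <= (ln n%:R)^-1 :> R by rewrite invr_ge0 ltW.
have c2 : 0 < c ^- 2 by rewrite invr_gt0 exprn_gt0.
have [pn0 pn1] := andP (p01 n).
have a1 : 0 < a - 1 by rewrite subr_gt0; apply: lt_le_trans a2; rewrite ltr1n.
have p2pos : 0 < p2 n by rewrite mulr_gt0 ?powR_gt0.
have pgt0 : 0 < p n by exact: lt_le_trans pl.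
have ia0 : 0 < 1 / a by rewrite divr_gt0.
have ia2 : 1 / a <= 2^-1 by rewrite ler_pdivrMr // ler_pdivlMl // mulr1 ; exact: a2.
(* As beta2 < 1, p n tends to infinity, so the number of colours eventually exceeds [m1]. *)
have pn_ge : n%:R `^ (1 - b2) <= p n * n%:R.
  apply: (@le_trans _ _ (p2 n * n%:R)); last by apply: ler_wpM2r => //; exact: ltW.
  rewrite /p2 mulrAC addrC powRD ?nn0 ?implybT // powRr1 ?(ltW nR) //.
  apply: ler_peMr; first by rewrite mulr_ge0 ?powR_ge0 // ltW.
  rewrite -[leLHS](powRr0 (ln n%:R)); apply: ler_powR => //.
  by rewrite divr_ge0 ?mulr_ge0 // ltW.
have pn_m1 : m1%:R + 1 <= p n * n%:R.
  apply: le_trans pn_ge; apply: le_trans (powR_ge_ln _ nR).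
  by rewrite mulrC -ler_pdivrMr.
have pn_1 : 1 <= p n * n%:R by apply: le_trans pn_m1; rewrite lerDr.
have pn_m : m1%:R <= p n * n%:R by apply: le_trans pn_m1; rewrite lerDl.
set X := p n `^ (1 - 1 / a) * n%:R `^ (r%:R - 1 / a).
have XE : turan_rate s (p n) n = X by [].
have X0 : 0 < X by rewrite mulr_gt0 ?powR_gt0.
(* Needed for Chebyshev: X = p n^r (p n)^(-1/a), and a >= 2 gives (p n)^(-2/a) >= 1 / (p n), whence
   X^2 >= p n^r n^(r-1). *)
have X2 : p n * n%:R ^+ r * ln n%:R <= X ^+ 2.
  have XX : X = p n * n%:R ^+ r * (p n * n%:R) `^ (- (1 / a)).
    rewrite powRM ?(ltW nR) // /X powRD ?(gt_eqF pgt0) ?implybT // powRr1 //.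
    by rewrite [n%:R `^ (r%:R - _)]powRD ?nn0 ?implybT // powR_mulrn ?(ltW nR) //; ring.
  rewrite XX exprMn expr2 -!mulrA ler_pM2l // ler_pM2l ?exprn_gt0 //.
  apply: (@le_trans _ _ (n%:R ^+ r.-1)).
    apply: (@le_trans _ _ n%:R); first exact: ltW (ln_sublinear nR).
    rewrite -[leLHS]expr1; apply: ler_weXn2l => //.
    by rewrite -ltnS prednK ?(ltnW hr).
  have -> : (p n * n%:R) `^ (- (1 / a)) ^+ 2 = (p n * n%:R) `^ (- (2 / a)).
    by rewrite -powR_mulrn ?powR_ge0 // -powRrM; congr (_ `^ _); ring.
  have h : (p n * n%:R)^-1 <= (p n * n%:R) `^ (- (2 / a)).
    rewrite -powR_inv1 ?mulr_ge0 ?(ltW nR) //; apply: ler_powR => //.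
    have -> : 2 / a = 2 * (1 / a) by rewrite mul1r.
    by rewrite lerN2 -ler_pdivlMl // mulr1; exact: ia2.
  have h2 : 0 <= p n * n%:R ^+ r by rewrite mulr_ge0 // exprn_ge0 // ltW.
  apply: le_trans (_ : p n * n%:R ^+ r * (p n * n%:R)^-1 <= _).
    rewrite -[in n%:R ^+ r](prednK (ltnW hr)) exprS le_eqVlt; apply/orP; left; apply/eqP.
    by field; rewrite (gt_eqF pgt0) nn0.
  by rewrite [leRHS]mulrA; apply: ler_wpM2l.
split.
  have L0 : 0 < c * X by rewrite mulr_gt0.
  have Lm : 2 * (c * X) <=
      bern_mean (complete_edges r n) (p n) (fun H => (max_free K H)%:R).
    rewrite mulrA (_ : 2 * c = cs); last by rewrite /c mulrC divfK.
    exact: lower.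
  apply: le_trans (lower_tail (p01 n) L0 Lm) _.
  rewrite mulrDl; apply: (@le_trans _ _ (c ^- 2 / ln n%:R)); last by rewrite lerDl mul1r.
  rewrite exprMn ler_pdivrMr; last by apply: mulr_gt0; apply: exprn_gt0.
  have -> : c ^- 2 / ln n%:R * (c ^+ 2 * X ^+ 2) = X ^+ 2 / ln n%:R.
    by field; rewrite !gt_eqF ?exprn_gt0.
  by rewrite ler_pdivlMr.
have rate_ge : n%:R `^ (r%:R - b1) * ln n%:R ^+ 2 <= turan_rate s (p n) n.
  rewrite -turan_rate_p2 // /turan_rate -/a; apply: ler_wpM2r; first exact: powR_ge0.
  apply: ge0_ler_powR; rewrite ?nnegrE ?(ltW p2pos) ?(ltW pgt0) //.
  by rewrite subr_ge0; apply: le_trans ia2 _; rewrite invf_le1 // ler1n.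
have pq : 0 < p n <= 1 by rewrite pgt0.
have := upper n (p n) (p n) n0 ln1 (p01 n) (lexx _) pq rate_ge; rewrite XE => h.
apply: (@le_trans _ _ (expR (- X))); first exact: h.
 rewrite expRN mulrDl mul1r.
apply: (@le_trans _ _ (ln n%:R)^-1); last by rewrite lerDr mulr_ge0 // ltW.
rewrite lef_pV2 ?posrE ?expR_gt0 //; apply: le_trans (expR_ge1Dx _).
rewrite -[leLHS]add0r; apply: lerD => //.
rewrite -XE; apply: le_trans rate_ge.
have X1 : 1 <= n%:R `^ (r%:R - b1) :> R.
  rewrite -[leLHS](powRr0 n%:R); apply: ler_powR => //.
  by have := b1_lt1; have := rR; lra.
rewrite -[leLHS]mul1r; apply: ler_pM => //; first exact: ltW.
by rewrite expr2 ler_peMl // ltW.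
Unshelve. all: end_near. Qed.

End Main.

Theorem theorem1p3 (R : realType) (r : nat) (s : 'I_r -> nat)
  (hr : (2 <= r)%N)
  (hs2 : forall i : 'I_r, (2 <= s i)%N)
  (hs : forall i j : 'I_r, (i <= j)%N -> (s i <= s j)%N) :
  let K := complete_multipartite s in
  let a : R := (a_r s)%:R in
  let b1 : R := beta1 s R in
  let b2 : R := beta2 s R in
  let p0 := fun n : nat => n%:R `^ (- (r%:R / 2)) * ln n%:R : R in
  let p1 := fun n : nat => n%:R `^ (- b1) : R in
  let p2 := fun n : nat => n%:R `^ (- b2) * ln n%:R `^ (2 * a / (a - 1)) : R in
  (exists2 c : R, 0 < c &
     \forall n \near \oo%classic,
       c * n%:R `^ (r%:R - 1 / a) <= (turan n K)%:R) ->
  [/\ (* n^(-r/2) log n <= p <= n^(-beta1) *)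
      exists c C : R, [/\ 0 < c, 0 < C &
        forall p : nat -> R, prob_between p0 p1 p ->
          aas_turan_between K p
            (fun n => c * (p n * n%:R ^+ r))
            (fun n => C * (p n * n%:R ^+ r))],
      (* n^(-beta1) <= p <= n^(-beta2) (log n)^(2a/(a-1)), o(1) form *)
      exists2 d : nat -> R, (d @ \oo --> (0 : R))%classic &
        forall p : nat -> R, prob_between p1 p2 p ->
          aas_turan_between K p
            (fun n => n%:R `^ (r%:R - b1 - d n))
            (fun n => n%:R `^ (r%:R - b1 + d n)),
      (* n^(-beta2) (log n)^(2a/(a-1)) <= p <= 1 *)
      exists c C : R, [/\ 0 < c, 0 < C &
        forall p : nat -> R, prob_between p2 (fun=> 1) p ->
          aas_turan_between K p
            (fun n => c * (p n `^ (1 - 1 / a) * n%:R `^ (r%:R - 1 / a)))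
            (fun n => C * (p n `^ (1 - 1 / a) * n%:R `^ (r%:R - 1 / a)))] &
      (* the more precise bounds in the middle range *)
      exists c C : R, [/\ 0 < c, 0 < C &
        forall p : nat -> R, prob_between p1 p2 p ->
          aas_turan_between K p
            (fun n => c * n%:R `^ (r%:R - b1))
            (fun n => C * (n%:R `^ (r%:R - b1) * ln n%:R ^+ 2))]].
Proof.
move=> K a b1 b2 p0 p1 p2 ex_lower; split.
- exact: sparse_range hr hs2.
- exact: middle_range_o1 hr hs2.
- exact: dense_range hr hs2 ex_lower.
- exact: middle_range hr hs2.
Qed.
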